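(* Let $(X,d,\mu)$ be a bounded doubling metric measure space, $\ell=\operatorname{diam}X$, and let $p\in\mathbb{P}(X)$. Let $x_1,\dots,x_N\in X$ be distinct points and $$\varrho(x)=\prod_{k=1}^N w_k(d(x,x_k)).$$ Suppose that for every $k=1,\dots,N$ the function $r\mapsto r^{\frac{m(\mu B)}{p(x_k)}}w_k(r)$ belongs to $\Phi^0_{m(\mu B)}([0,\ell])$, or, equivalently, that for every $k=1,\dots,N$ one has $w_k\in\widetilde{W}([0,\ell])$ and $$-\frac{m(\mu B)}{p(x_k)}<m(w_k)\le M(w_k)<\frac{m(\mu B)}{p'(x_k)} .$$ Then the Hardy-Littlewood maximal operator $\mathcal{M}$ is bounded in $L^{p(\cdot)}(X,\varrho)$, i.e. there is a constant $C>0$ such that $\|\mathcal{M}f\|_{L^{p(\cdot)}(X,\varrho)}\le C\|f\|_{L^{p(\cdot)}(X,\varrho)}$ for all $f\in L^{p(\cdot)}(X,\varrho)$.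
   Context: A doubling metric measure space $(X,d,\mu)$ (space of homogeneous type) is a set $X$ with a quasimetric $d$ (that is, $d\ge 0$, $d(x,y)=0$ iff $x=y$, $d(x,y)=d(y,x)$, and $d(x,y)\le c_0[d(x,z)+d(z,y)]$ for a constant $c_0\ge 1$) and a non-negative Borel regular measure $\mu$ for which all balls $B(x,r)=\{y\in X: d(x,y)<r\}$ are measurable with $0<\mu B(x,r)<\infty$ and the doubling condition $\mu B(x,2r)\le C\mu B(x,r)$ holds with $C$ independent of $x\in X$ and $r>0$. $X$ is bounded if $\operatorname{diam}X=\sup_{x,y\in X}d(x,y)<\infty$. $\mathbb{P}(X)$ is the set of bounded measurable functions $p:X\to\mathbb{R}$ such that $1<p_-\le p(x)\le p^+<\infty$ for all $x\in X$, where $p_-=\inf_{x\in X}p(x)$ and $p^+=\sup_{x\in X}p(x)$, and for some constant $A>0$, $|p(x)-p(y)|\le A/\ln\frac{1}{d(x,y)}$ for all $x,y\in X$ with $0<d(x,y)\le\frac12$. The conjugate exponent is $p'(x)=\frac{p(x)}{p(x)-1}$. $L^{p(\cdot)}(X,\varrho)$ is the space of measurable $f:X\to\mathbb{C}$ with $$\|f\|_{L^{p(\cdot)}(X,\varrho)}=\inf\left\{\lambda>0:\int_X\left|\frac{\varrho(x)f(x)}{\lambda}\right|^{p(x)}d\mu(x)\le 1\right\}<\infty .$$ The maximal operator is $\displaystyle \mathcal{M}f(x)=\sup_{r>0}\frac{1}{\mu B(x,r)}\int_{B(x,r)}|f(y)|\,d\mu(y)$, $x\in X$. Uniform lower index of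 the measure: $$m(\mu B)=\lim_{t\to 0}\frac{\ln\left(\limsup\limits_{r\to 0}\ \sup\limits_{x\in X}\frac{\mu B(x,rt)}{\mu B(x,r)}\right)}{\ln t} =\sup_{t>1}\frac{\ln\left(\liminf\limits_{r\to 0}\ \inf\limits_{x\in X}\frac{\mu B(x,rt)}{\mu B(x,r)}\right)}{\ln t}.$$ Function classes on $[0,\ell]$, $0<\ell<\infty$. A non-negative function $u$ is almost increasing if $u(s)\le Cu(t)$ for all $s\le t$ with some constant $C>0$. $W=W([0,\ell])$ is the set of $w\in C([0,\ell])$ with $w(t)>0$ for $t>0$ that are almost increasing. $\widetilde{W}([0,\ell])$ is the set of functions $\varphi$ on $(0,\ell]$ for which there is $a\in\mathbb{R}$ such that $t^a\varphi(t)$ (extended continuously to $t=0$) belongs to $W([0,\ell])$. For $-\infty<\alpha<\beta<\infty$, $\Phi^\alpha_\beta([0,\ell])=\mathcal{Z}^\alpha\cap\mathcal{Z}_\beta$, where $\mathcal{Z}^\alpha$ is the set of $w\in\widetilde{W}([0,\ell])$ with $\int_0^h\frac{w(t)}{t^{1+\alpha}}dt\le c\frac{w(h)}{h^\alpha}$, and $\mathcal{Z}_\beta$ is the set of $w\in W([0,\ell])$ with $\int_h^\ell\frac{w(t)}{t^{1+\beta}}dt\le c\frac{w(h)}{h^\beta}$, where $c=c(w)>0$ does not depend on $h\in(0,\ell]$. Lower and upper indices of $w\in\widetilde{W}([0,\ell])$: $$m(w)=\sup_{t>1}\frac{\ln\left(\liminf\limits_{h\to 0}\frac{w(ht)}{w(h)}\right)}{\ln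 t},\qquad M(w)=\inf_{t>1}\frac{\ln\left(\limsup\limits_{h\to 0}\frac{w(ht)}{w(h)}\right)}{\ln t}.$$ *)

(* Defs.v *)
(* MathComp-Analysis; complex numbers R[i] from mathcomp-real-closed. *)
From HB Require Import structures.
From mathcomp Require Import all_boot all_order all_algebra.
From mathcomp Require Import complex.
From mathcomp Require Import all_classical all_reals all_analysis.

Set Implicit Arguments.
Unset Strict Implicit.
Unset Printing Implicit Defensive.

Import Order.TTheory GRing.Theory Num.Theory.
Import numFieldNormedType.Exports.

Local Open Scope classical_set_scope.
Local Open Scope ring_scope.

(** ** Spaces of homogeneous type *)

Section homogeneous_type.
Context {R : realType} {T : Type}.
Implicit Types dist : T -> T -> R.

Record is_quasimetric dist : Prop := IsQuasimetric {
  qdist_ge0 : forall x y, 0 <= dist x y ;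
  qdist_eq0 : forall x y, dist x y = 0 <-> x = y ;
  qdistC : forall x y, dist x y = dist y x ;
  qdist_triangle : exists2 c0 : R, 1 <= c0 &
    forall x y z, dist x y <= c0 * (dist x z + dist z y) }.

Definition qball dist (x : T) (r : R) : set T := [set y | dist x y < r].

(* The balls of a quasimetric need not be open for this topology. *)
Definition qopen dist (U : set T) : Prop :=
  forall x, U x -> exists2 r : R, 0 < r & qball dist x r `<=` U.

Definition qborel dist : set (set T) := <<s [set U | qopen dist U] >>.

Definition diam dist : \bar R := ereal_sup [set (dist z.1 z.2)%:E | z in setT].

End homogeneous_type.

Section doubling.
Context {R : realType} {disp : measure_display} {X : measurableType disp}.
Implicit Types (dist : X -> X -> R) (mu : {measure set X -> \bar R}).

(* The sigma-algebra of X may be larger than the Borel one. *)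
Definition borel_regular dist mu : Prop :=
  qborel dist `<=` measurable /\
  forall A, measurable A ->
    exists B, [/\ qborel dist B, A `<=` B & mu B = mu A].

Record is_doubling_space dist mu : Prop := IsDoublingSpace {
  doubling_quasimetric : is_quasimetric dist ;
  doubling_borel_regular : borel_regular dist mu ;
  doubling_measurable_ball :
    forall x (r : R), 0 < r -> measurable (qball dist x r) ;
  doubling_ball_gt0 : forall x (r : R), 0 < r -> (0 < mu (qball dist x r))%E ;
  doubling_ball_lty :
    forall x (r : R), 0 < r -> (mu (qball dist x r) < +oo)%E ;
  doubling_doubling : exists2 C : R, 0 < C & forall x (r : R), 0 < r ->
    (mu (qball dist x (2 * r)) <= C%:E * mu (qball dist x r))%E }.

Definition ball_ratio dist mu (x : X) (r t : R) : R :=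
  fine (mu (qball dist x (r * t))) / fine (mu (qball dist x r)).

(* In a bounded doubling space of positive diameter the limit exists and is a
   nonnegative real number, because t |-> limsup_r sup_x (ball_ratio x r t) is
   submultiplicative and bounded below by a multiple of a power of t. *)
Definition lower_index_measure dist mu : R :=
  fine (lim ((lne (limf_esup
                     (fun r : R => ereal_sup [set (ball_ratio dist mu x r t)%:E
                                             | x in setT]) 0^'+)
              * ((ln t)^-1)%:E)%E @[t --> (0 : R)^'+])).

End doubling.

(** ** Variable exponent Lebesgue spaces *)

Section variable_exponent.
Context {R : realType} {disp : measure_display} {X : measurableType disp}.
Implicit Types (dist : X -> X -> R) (mu : {measure set X -> \bar R}).

Record is_log_exponent dist (p : X -> R) : Prop := IsLogExponent {
  exponent_measurable : measurable_fun setT p ;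
  exponent_inf : (1 < ereal_inf [set (p x)%:E | x in setT])%E ;
  exponent_sup : (ereal_sup [set (p x)%:E | x in setT] < +oo)%E ;
  exponent_log : exists2 A : R, 0 < A & forall x y,
    0 < dist x y -> dist x y <= 1 / 2 ->
    `|p x - p y| <= A / ln (1 / dist x y) }.

Definition conj_exponent (p : X -> R) (x : X) : R := p x / (p x - 1).

(* Defined on \bar R-valued functions, since a maximal function may take the
   value +oo; a complex function f is measured through its modulus. *)
Definition Lvar_norm mu (p rho : X -> R) (g : X -> \bar R) : \bar R :=
  ereal_inf [set lam%:E | lam in [set lam : R | 0 < lam /\
    (\int[mu]_x (`| (rho x)%:E * g x * (lam^-1)%:E | `^ (p x)) <= 1)%E]].

Definition cmod (f : X -> R[i]) (x : X) : \bar R := (Normc.normc (f x))%:E.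

Definition cmeasurable (f : X -> R[i]) : Prop :=
  measurable_fun setT (fun x => complex.Re (f x)) /\
  measurable_fun setT (fun x => complex.Im (f x)).

Definition in_Lvar mu (p rho : X -> R) (f : X -> R[i]) : Prop :=
  cmeasurable f /\ (Lvar_norm mu p rho (cmod f) < +oo)%E.

Definition maximal_function dist mu (f : X -> R[i]) (x : X) : \bar R :=
  ereal_sup [set ((fine (mu (qball dist x r)))^-1%:E *
                  \int[mu]_(y in qball dist x r) cmod f y)%E
            | r in [set r : R | 0 < r]].

End variable_exponent.

(** ** Function classes on [0, l] *)

Section function_classes.
Context {R : realType}.
Implicit Types (l a alpha beta : R) (u w phi : R -> R).

Definition almost_increasing l u : Prop :=
  (forall t, 0 <= t -> t <= l -> 0 <= u t) /\
  exists2 C : R, 0 < C &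
    forall s t, 0 <= s -> s <= t -> t <= l -> u s <= C * u t.

Definition class_W l w : Prop :=
  [/\ {within `[0, l], continuous w},
      forall t, 0 < t -> t <= l -> 0 < w t
    & almost_increasing l w].

(* phi lives on ]0, l]: its value at 0 is irrelevant, and u is the continuous
   extension of t^a phi(t) to [0, l]. *)
Definition class_Wt l phi : Prop :=
  exists a, exists2 u, class_W l u &
    forall t, 0 < t -> t <= l -> u t = t `^ a * phi t.

Definition class_Zup alpha l w : Prop :=
  class_Wt l w /\ exists2 c : R, 0 < c & forall h, 0 < h -> h <= l ->
    (\int[lebesgue_measure]_(t in `]0%R, h]) (w t / t `^ (1 + alpha))%:E
       <= (c * (w h / h `^ alpha))%:E)%E.

Definition class_Zlow beta l w : Prop :=
  class_W l w /\ exists2 c : R, 0 < c & forall h, 0 < h -> h <= l ->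
    (\int[lebesgue_measure]_(t in `[h, l]) (w t / t `^ (1 + beta))%:E
       <= (c * (w h / h `^ beta))%:E)%E.

Definition class_Phi alpha beta l w : Prop :=
  class_Zup alpha l w /\ class_Zlow beta l w.

(* The indices are extended real: they are infinite for, e.g., exp(-1/t). *)
Definition lower_index w : \bar R :=
  ereal_sup [set (lne (limf_einf (fun h : R => (w (h * t) / w h)%:E) 0^'+)
                  * ((ln t)^-1)%:E)%E | t in [set t : R | 1 < t]].

Definition upper_index w : \bar R :=
  ereal_inf [set (lne (limf_esup (fun h : R => (w (h * t) / w h)%:E) 0^'+)
                  * ((ln t)^-1)%:E)%E | t in [set t : R | 1 < t]].

End function_classes.

(* Main.v *)
(** A weight satisfying either condition lies between two powers [r^lo] and
    [r^hi] in the sense that [w s <= C (s/r)^lo (w r)] and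
    [w r <= C (s/r)^(-hi) (w s)] for [s <= r], with [lo > -m/p(x_k)] and
    [hi < m/p'(x_k)]; both conditions amount to such bounds because a strict
    contraction at one single scale iterates to a power bound. Likewise
    [mu B(x,s) <= C (s/r)^(m-eps) (mu B(x,r))].

    For the maximal operator write [f = g / rho] with modular of [g] at most
    [1]. For two points [x], [y] either [rho x <= C rho y], and the averages
    over such [y] are controlled by unweighted averages of [g] (Vitali covering
    for a constant exponent, then log-Hoelder continuity), or for some [k] the
    distance [d x y] dominates [d x x_k] and [d y x_k]. In the second case the
    average is a Hardy sum over dyadic annuli around [x_k]: on the annulus of
    index [j] the exponent is [p(x_k)] up to a bounded factor, and the power
    bounds make the kernel of the sum decay geometrically off the diagonal.
    This gives a pointwise bound of the modular density of [rho (M f)] by a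
    function of bounded integral, which scales to the norm inequality. *)

Require Import Defs.
From mathcomp Require Import all_boot all_order all_algebra.
From mathcomp Require Import complex ring lra zify.
From mathcomp Require Import all_classical all_reals all_analysis.
From mathcomp Require Import measurable_realfun.

Set Implicit Arguments.
Unset Strict Implicit.
Unset Printing Implicit Defensive.

Import Order.TTheory GRing.Theory Num.Theory.
Import numFieldNormedType.Exports.

Local Open Scope classical_set_scope.
Local Open Scope ring_scope.

(** * Power bounds *)

(** Two obstacles shape the proof. Balls need not be open, so the maximal function may fail to be
    measurable. Hence all averages at a point are dominated by the value of one measurable function
    of controlled integral, built from a countable family of balls. The second obstacle is the
    change of exponent. Replacing p(y) by the exponent at a nearby point costs a factor lam^(p(x) -
    p(y)). At dyadic scale n the exponents differ by at most A / (n + 1), so this factor is bounded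
    as soon as lam lies between G^-(n+1) and G^(n+1) for a fixed G. The upper bound comes from
    doubling, started from a ball that is the whole space. The lower bound is forced by adding a
    harmless positive term to the quantity that defines lam: 1 for balls, 2^-j for the annulus of
    index j. Far from a centre no such oscillation bound is available. Annulus index 0 collects that
    region, and the estimates there are separate normalisation clauses. The scale is small enough
    that at most one centre has a positive index at any given point, so the product of weights acts
    as a single weight. *)

Ltac pos := first [assumption | lazymatch goal with
  | |- is_true (0 <= _ + _)%R =>
      first [by apply: addr_ge0; pos | by apply: ltW | lra]
  | |- is_true (0 <= _ * _)%R => apply: mulr_ge0; pos
  | |- is_true (0 <= _^-1)%R => rewrite invr_ge0; pos
  | |- is_true (0 <= _ `^ _)%R => exact: powR_ge0
  | |- is_true (0 <= _ ^+ _)%R => apply: exprn_ge0; pos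
  | |- is_true (0 <= `|_|)%R => exact: normr_ge0
  | |- is_true (0 < _ * _)%R => apply: mulr_gt0; pos
  | |- is_true (0 < _^-1)%R => rewrite invr_gt0; pos
  | |- is_true (0 < _ `^ _)%R => apply: powR_gt0; pos
  | |- is_true (0 < _ ^+ _)%R => apply: exprn_gt0; pos
  | |- is_true (0 < _ + _)%R =>
      first [by apply: addr_gt0; pos | by apply: ltr_wpDr; pos | by apply: ltr_wpDl; pos | lra]
  | |- is_true (0 <= _)%R => first [done | by apply: ltW; pos | lra]
  | |- is_true (0 < _)%R => first [done | lra]
  | |- _ => done
  end].

Section power_bounds.
Context {R : realType}.
Implicit Types (L a t s r : R) (phi : R -> R).

(** Equivalently, phi(r) / r^a is almost increasing on ]0, L]. An upper power bound on a weight is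
    the same property of its inverse with the exponent negated, so one iteration argument serves
    both sides. *)
Definition lower_pow L phi a := exists2 C, 0 < C & forall s r,
  0 < s -> s <= r -> r <= L -> phi s <= C * (s / r) `^ a * phi r.

Lemma powR_ge_norm (q0 q a : R) : 0 < q0 -> q0 <= q -> q <= 1 ->
  q0 `^ `|a| <= q `^ a.
Proof.
move=> q00 q0q q1; have q_gt0 := lt_le_trans q00 q0q.
apply: (@le_trans _ _ (q `^ `|a|)).
  by rewrite ge0_ler_powR// ?nnegrE ltW.
by rewrite ger_powR ?q_gt0// ler_norm.
Qed.

Lemma powR_le_norm (x1 x a : R) : 1 <= x -> x <= x1 -> x `^ a <= x1 `^ `|a|.
Proof.
move=> x_ge1 xx1; apply: (@le_trans _ _ (x `^ `|a|)).
  by rewrite ler_powR// ler_norm.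
by rewrite ge0_ler_powR// ?nnegrE; lra.
Qed.

Lemma exprn_lt_exists (t e : R) : 0 < t -> t < 1 -> 0 < e ->
  exists n, t ^+ n < e.
Proof.
move=> t0 t1 e0.
have /cvgrPdist_lt/(_ _ e0)[n _ /(_ n)] : (fun n => t ^+ n) @ \oo --> (0 : R).
  by apply: cvg_expr; rewrite gtr0_norm.
rewrite /= leqnn => /(_ isT); rewrite sub0r normrN ger0_norm ?exprn_ge0 ?ltW//.
by exists n.
Qed.

Lemma geometric_bracket (t s r : R) : 0 < t -> t < 1 -> 0 < s -> s <= r ->
  exists n, t ^+ n.+1 * r < s /\ s <= t ^+ n * r.
Proof.
move=> t0 t1 s0 sr.
have r0 := lt_le_trans s0 sr.
have [N tN] := exprn_lt_exists t0 t1 (divr_gt0 s0 r0).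
have exP : exists n, t ^+ n * r < s by exists N; rewrite -ltr_pdivlMr.
case: (ex_minnP exP) => -[|n] tn minn.
  by move: tn; rewrite expr0 mul1r ltNge sr.
by exists n; split => //; rewrite leNgt; apply/negP => /minn; rewrite ltnn.
Qed.

(** The contraction at the single ratio [t0] is iterated along the radii t0^n r. Comparability
    within one step fills the gaps between consecutive radii, and bounds away from 0 carry the
    estimate from [r < r0] to all [r <= L]. *)
Lemma one_scale_lower_pow L phi a (t0 r0 c : R) :
  0 < t0 -> t0 < 1 -> 0 < r0 -> r0 <= L ->
  (forall r, 0 < r -> r <= L -> 0 < phi r) ->
  (forall r, 0 < r -> r < r0 -> phi (t0 * r) <= t0 `^ a * phi r) ->
  (forall s r, 0 < s -> s <= r -> r < r0 -> t0 * r <= s ->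
    phi s <= c * phi r) ->
  (forall r1, 0 < r1 -> r1 <= L -> exists b B : R, [/\ 0 < b, 0 < B &
     forall r, r1 <= r -> r <= L -> b <= phi r /\ phi r <= B]) ->
  lower_pow L phi a.
Proof.
move=> t00 t01 r00 r0L phi0 H1 H2 H3.
have iter n r : 0 < r -> r < r0 -> phi (t0 ^+ n * r) <= (t0 ^+ n) `^ a * phi r.
  move=> r_gt0 rr0; elim: n => [|n IH]; first by rewrite expr0 powR1 !mul1r.
  have tn0 : 0 < t0 ^+ n by rewrite exprn_gt0.
  have tn1 : t0 ^+ n <= 1 by rewrite exprn_ile1// ltW.
  have tnr_r : t0 ^+ n * r <= r by rewrite ler_piMl// ltW.
  have := H1 _ (mulr_gt0 tn0 r_gt0) (le_lt_trans tnr_r rr0).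
  rewrite mulrA -exprS => /le_trans; apply.
  by rewrite exprS powRM ?(ltW t00) ?(ltW tn0)// -mulrA ler_pM2l// powR_gt0.
pose c' := Num.max c 1.
have c'0 : 0 < c' by rewrite lt_max ltr01 orbT.
have small s r : 0 < s -> s <= r -> r < r0 ->
    phi s <= c' / t0 `^ `|a| * (s / r) `^ a * phi r.
  move=> s0 sr rr0; have r_gt0 := lt_le_trans s0 sr.
  have [n [tn1 tn]] := geometric_bracket t00 t01 s0 sr.
  have tn0 : 0 < t0 ^+ n by rewrite exprn_gt0.
  have tnle1 : t0 ^+ n <= 1 by rewrite exprn_ile1// ltW.
  have tnr_r : t0 ^+ n * r <= r by rewrite ler_piMl// ltW.
  have phir0 : 0 < phi r by rewrite phi0// (le_trans (ltW rr0)).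
  have phitn0 : 0 < phi (t0 ^+ n * r).
    by rewrite phi0 ?mulr_gt0// (le_trans tnr_r)// (le_trans (ltW rr0)).
  have -> : s / r = t0 ^+ n * (s / (t0 ^+ n * r)).
    by field; rewrite !gt_eqF.
  have q0 : 0 < s / (t0 ^+ n * r) by rewrite divr_gt0// mulr_gt0.
  have q_ge : t0 `^ `|a| <= (s / (t0 ^+ n * r)) `^ a.
    apply: powR_ge_norm => //.
      by rewrite ler_pdivlMr ?mulr_gt0// mulrA -exprS ltW.
    by rewrite ler_pdivrMr ?mulr_gt0// mul1r.
  apply: (@le_trans _ _ (c' * phi (t0 ^+ n * r))).
    apply: (@le_trans _ _ (c * phi (t0 ^+ n * r))).
      apply: H2 => //; first exact: le_lt_trans rr0.
      by rewrite mulrA -exprS ltW.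
    by rewrite ler_wpM2r ?(ltW phitn0)// le_max lexx.
  rewrite powRM ?(ltW tn0) ?(ltW q0)// -!mulrA ler_pM2l//.
  apply: (le_trans (iter n r r_gt0 rr0)).
  rewrite mulrCA ler_pM2l ?powR_gt0// mulrA ler_peMl ?(ltW phir0)//.
  by rewrite ler_pdivlMl ?powR_gt0// mulr1.
(* Strictly below [r0], so that the iterated bound applies at [r1] itself, which is the intermediate
   point when [s < r1] and [r0 <= r]. *)
pose r1 := r0 / 2.
have r10 : 0 < r1 by rewrite divr_gt0.
have r1r0 : r1 < r0 by rewrite /r1; lra.
have L0 : 0 < L by exact: lt_le_trans r0L.
have [b [B [b0 B0 bB]]] := H3 r1 r10 (le_trans (ltW r1r0) r0L).
have LP s r : r1 <= s -> s <= r -> r <= L -> phi s <= (B / b) * phi r.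
  move=> r1s sr rL.
  have [_ sB] := bB s r1s (le_trans sr rL).
  have [br _] := bB r (le_trans r1s sr) rL.
  apply: (le_trans sB); rewrite -mulrA ler_peMr ?(ltW B0)//.
  by rewrite ler_pdivlMl// mulr1.
pose K := (L / r1) `^ `|a|.
have K0 : 0 < K by rewrite /K powR_gt0// divr_gt0.
have K1 : 1 <= K.
  rewrite /K -(powRr0 (L / r1)) ler_powR// ler_pdivlMr// mul1r.
  by rewrite (le_trans (ltW r1r0)).
have Bb0 : 0 < B / b by rewrite divr_gt0.
pose D := c' / t0 `^ `|a|.
have D0 : 0 < D by rewrite divr_gt0// powR_gt0.
(* One summand per case: [r < r0]; [r0 <= r] with [r1 <= s]; [s < r1] with [r0 <= r]. *)
exists (D + B / b * K + D * K * (B / b)).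
  by pos.
move=> s r s0 sr rL; have r_gt0 := lt_le_trans s0 sr.
have phir0 := phi0 r r_gt0 rL.
have sr0 : 0 < (s / r) `^ a by rewrite powR_gt0// divr_gt0.
have S0 : 0 <= (s / r) `^ a * phi r by rewrite mulr_ge0// ltW.
have e1 : 0 <= D * ((s / r) `^ a * phi r) by rewrite mulr_ge0// ltW.
have e2 : 0 <= B / b * K * ((s / r) `^ a * phi r).
  by pos.
have e3 : 0 <= D * K * (B / b) * ((s / r) `^ a * phi r).
  by pos.
rewrite -mulrA !mulrDl.
have [rr0|r0r] := ltP r r0.
  by have := small s r s0 sr rr0; rewrite -/D -mulrA; lra.
have [r1s|sr1] := leP r1 s.
  have := LP s r r1s sr rL.
  suff : B / b * phi r <= B / b * K * ((s / r) `^ a * phi r) by lra.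
  have -> : B / b * K * ((s / r) `^ a * phi r) =
    K * (s / r) `^ a * (B / b * phi r) by ring.
  rewrite ler_peMl//; first by pos.
  have <- : K * (r1 / L) `^ `|a| = 1.
    rewrite /K -powRM; [|by pos|by pos].
    by rewrite mulf_div (mulrC L) divff ?powR1// mulf_neq0// gt_eqF.
  rewrite ler_pM2l//; apply: powR_ge_norm; first by pos.
    by rewrite ler_pdivrMr// mulrAC ler_pdivlMr// ler_pM//; pos.
  by rewrite ler_pdivrMr// mul1r.
have := small s r1 s0 (ltW sr1) r1r0; rewrite -/D.
have := LP r1 r (lexx _) (le_trans (ltW r1r0) r0r) rL.
move=> h1 h2.
suff : D * (s / r1) `^ a * phi r1 <=  D * K * (B / b) * ((s / r) `^ a * phi r) by lra.
apply: (@le_trans _ _ (D * (s / r1) `^ a * (B / b * phi r))).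
  by rewrite ler_wpM2l// mulr_ge0 ?powR_ge0// ltW.
have -> : s / r1 = s / r * (r / r1) by field; rewrite !gt_eqF.
rewrite powRM; [|by rewrite divr_ge0 ?ltW|by rewrite divr_ge0 ?ltW].
have -> : D * ((s / r) `^ a * (r / r1) `^ a) * (B / b * phi r) =
   (r / r1) `^ a * (D * (B / b) * ((s / r) `^ a * phi r)) by ring.
have -> : D * K * (B / b) * ((s / r) `^ a * phi r) =
   K * (D * (B / b) * ((s / r) `^ a * phi r)) by ring.
rewrite ler_wpM2r//; first by pos.
apply: powR_le_norm.
  by rewrite ler_pdivlMr// mul1r ltW// (lt_le_trans r1r0).
by rewrite ler_pM2r// invr_gt0.
Qed.

End power_bounds.

Section lower_pow_theory.
Context {R : realType} (l : R) (l0 : 0 < l).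
Implicit Types (a b t s r : R) (phi w : R -> R).

Definition positive_on w := forall r, 0 < r -> r <= l -> 0 < w r.

Lemma powR_gap a (e : R) : 0 < a -> 0 < e ->
  exists q : R, [/\ 0 < q, q <= 1 & q `^ a < e].
Proof.
move=> a0 e0; exists (Num.min 1 ((e / 2) `^ a^-1)).
have e20 : 0 < e / 2 by pos.
have m0 : 0 < Num.min 1 ((e / 2) `^ a^-1) by rewrite lt_min ltr01 /=; pos.
split; [by []|by rewrite ge_min lexx|].
apply: (@le_lt_trans _ _ (((e / 2) `^ a^-1) `^ a)).
  rewrite ge0_ler_powR ?nnegrE ?(ltW a0) ?(ltW m0) ?powR_ge0//.
  by rewrite ge_min lexx orbT.
by rewrite -powRrM mulVf ?gt_eqF// powRr1; lra.
Qed.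

Lemma powR_invr (x a : R) : 0 < x -> x^-1 `^ a = x `^ (- a).
Proof. by move=> x0; rewrite -powR_inv1 ?(ltW x0)// -powRrM mulN1r. Qed.

(** Comparing [r] with the two fixed points [r1] and [l] turns a lower power bound, whatever its
    exponent, into bounds on both sides away from 0. *)
Lemma lower_pow_bounds phi a : positive_on phi -> lower_pow l phi a ->
  forall r1, 0 < r1 -> r1 <= l -> exists b B : R, [/\ 0 < b, 0 < B &
     forall r, r1 <= r -> r <= l -> b <= phi r /\ phi r <= B].
Proof.
move=> phi0 [C C0 CP] r1 r10 r1l.
have q0 : 0 < r1 / l by pos.
have K0 : 0 < (l / r1) `^ `|a| by pos.
have b0 := phi0 _ r10 r1l; have B0 := phi0 _ l0 (lexx _).
exists (phi r1 / (C * (l / r1) `^ `|a|)), (C * (l / r1) `^ `|a| * phi l).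
split; [by pos|by pos|] => r r1r rl.
have r0 : 0 < r by exact: lt_le_trans r1r.
have pr0 := phi0 _ r0 rl.
have bnd (x y : R) : r1 <= x -> x <= y -> y <= l -> (x / y) `^ a <= (l / r1) `^ `|a|.
  move=> r1x xy yl.
  have x0 : 0 < x by exact: lt_le_trans r1x.
  have y0 : 0 < y by exact: lt_le_trans xy.
  rewrite -[x / y]invf_div powR_invr; last by pos.
  rewrite -(normrN a); apply: powR_le_norm; first by rewrite ler_pdivlMr// mul1r.
  rewrite ler_pdivlMr// mulrAC ler_pdivrMr//.
  by rewrite ler_pM// ltW.
split.
  rewrite ler_pdivrMr; last by pos.
  rewrite mulrC; apply: (le_trans (CP _ _ r10 r1r rl)).
  by rewrite ler_pM2r// ler_pM2l// bnd.
apply: (le_trans (CP _ _ r0 rl (lexx _))).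
by rewrite ler_pM2r// ler_pM2l// bnd.
Qed.

Lemma lower_pow_local phi a (t0 : R) : 0 < t0 -> t0 < 1 -> positive_on phi ->
  lower_pow l phi a -> exists2 c : R, 0 < c & forall s r, 0 < s -> s <= r ->
    r <= l -> t0 * r <= s -> phi s <= c * phi r.
Proof.
move=> t00 t01 phi0 [C C0 CP].
exists (C * t0^-1 `^ `|a|); first by pos.
move=> s r s0 sr rl t0rs; have r0 := lt_le_trans s0 sr.
have pr0 := phi0 _ r0 rl.
apply: (le_trans (CP _ _ s0 sr rl)); rewrite ler_pM2r// ler_pM2l//.
rewrite -[s / r]invf_div [_^-1 `^ a]powR_invr; last by pos.
rewrite -(normrN a); apply: powR_le_norm; first by rewrite ler_pdivlMr// mul1r.
by rewrite ler_pdivrMr// ler_pdivlMl.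
Qed.

(** The crude exponent [a'] supplies only local comparability and bounds away from 0; the final
    exponent is decided by the single ratio [t0]. *)
Lemma lower_pow_improve phi a' a (t0 r0 : R) : 0 < t0 -> t0 < 1 -> 0 < r0 ->
  positive_on phi -> lower_pow l phi a' ->
  (forall r, 0 < r -> r < r0 -> phi (t0 * r) <= t0 `^ a * phi r) ->
  lower_pow l phi a.
Proof.
move=> t00 t01 r00 phi0 lp H1.
have [c c0 cP] := lower_pow_local t00 t01 phi0 lp.
apply: (@one_scale_lower_pow _ l phi a t0 (Num.min r0 l) c) => //.
- by rewrite lt_min r00.
- by rewrite ge_min lexx orbT.
- by move=> r rr; rewrite lt_min => /andP[+ _]; exact: H1.
- move=> s r s0 sr; rewrite lt_min => /andP[_ /ltW rl]; exact: cP.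
- exact: lower_pow_bounds lp.
Qed.

(** The crude bound concerns [w], not its inverse. For [t0 * r <= s <= r] it gives 1 / w(s) <= c /
    w(t0 r), and the contraction hypothesis then compares w(t0 r) with w(r). *)
Lemma lower_pow_improve_inv w a' a (t0 r0 : R) : 0 < t0 -> t0 < 1 -> 0 < r0 ->
  positive_on w -> lower_pow l w a' ->
  (forall r, 0 < r -> r < r0 -> (w (t0 * r))^-1 <= t0 `^ a * (w r)^-1) ->
  lower_pow l (fun r => (w r)^-1) a.
Proof.
move=> t00 t01 r00 w0 lp H1.
have [c c0 cP] := lower_pow_local t00 t01 w0 lp.
apply: (@one_scale_lower_pow _ l _ a t0 (Num.min r0 l) (c * t0 `^ a)) => //.
- by rewrite lt_min r00.
- by rewrite ge_min lexx orbT.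
- by move=> r rr rl; rewrite invr_gt0 w0.
- by move=> r rr; rewrite lt_min => /andP[+ _]; exact: H1.
- move=> s r s0 sr; rewrite lt_min => /andP[rr0 /ltW rl] t0rs.
  have rr := lt_le_trans s0 sr; have sl := le_trans sr rl.
  have t0r : 0 < t0 * r by pos.
  have := cP _ _ t0r t0rs sl; rewrite ler_pM2l//.
  have := H1 _ rr rr0.
  have ws := w0 _ s0 sl; have wr := w0 _ rr rl.
  have wt := w0 _ t0r (le_trans t0rs sl).
  move=> h /(_ sr) h'.
  rewrite -mulrA; apply: (@le_trans _ _ (c * (w (t0 * r))^-1)); last by rewrite ler_pM2l.
  by rewrite -[leLHS]mul1r ler_pdivrMr// mulrAC ler_pdivlMr// mul1r.
- move=> r1 r10 r1l.
  have [b [B [b0 B0 bB]]] := lower_pow_bounds w0 lp r10 r1l.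
  exists B^-1, b^-1; split; [by pos|by pos|] => r r1r rl.
  have [h1 h2] := bB r r1r rl.
  have r_gt0 := lt_le_trans r10 r1r; have wr := w0 _ r_gt0 rl.
  by rewrite !lef_pV2 ?posrE.
Qed.

Lemma lower_pow_weaken phi a a' : positive_on phi -> a' <= a ->
  lower_pow l phi a -> lower_pow l phi a'.
Proof.
move=> phi0 aa' [C C0 CP]; exists C => // s r s0 sr rl.
have r0 := lt_le_trans s0 sr; have pr := phi0 _ r0 rl.
apply: (le_trans (CP _ _ s0 sr rl)); rewrite ler_pM2r// ler_pM2l//.
rewrite ger_powR//; apply/andP; split; first by pos.
by rewrite ler_pdivrMr// mul1r.
Qed.

Lemma lower_pow_eq phi psi a : (forall r, 0 < r -> r <= l -> phi r = psi r) ->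
  lower_pow l phi a -> lower_pow l psi a.
Proof.
move=> e [C C0 CP]; exists C => // s r s0 sr rl.
have r0 := lt_le_trans s0 sr.
by rewrite -!e//; [exact: CP|exact: le_trans rl].
Qed.

Lemma lower_pow_mul phi a b : lower_pow l phi a ->
  lower_pow l (fun r => r `^ b * phi r) (b + a).
Proof.
move=> [C C0 CP]; exists C => // s r s0 sr rl.
have r0 := lt_le_trans s0 sr.
have sr0 : 0 < s / r by pos.
rewrite powRD; last by rewrite (gt_eqF sr0) implybT.
have -> : s `^ b = (s / r) `^ b * r `^ b.
  by rewrite -powRM; [rewrite divfK// gt_eqF|pos|pos].
have -> : C * ((s / r) `^ b * (s / r) `^ a) * (r `^ b * phi r) =
  ((s / r) `^ b * r `^ b) * (C * (s / r) `^ a * phi r) by ring.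
by rewrite ler_wpM2l ?CP//; pos.
Qed.

Definition pow_between w lo hi :=
  [/\ positive_on w, lower_pow l w lo & lower_pow l (fun r => (w r)^-1) (- hi)].

Lemma pow_between_mul w lo hi b : pow_between w lo hi ->
  pow_between (fun r => r `^ b * w r) (b + lo) (b + hi).
Proof.
move=> [w0 wlo whi]; split.
- by move=> r r0 rl; rewrite mulr_gt0 ?w0//; pos.
- exact: lower_pow_mul.
- apply: (@lower_pow_eq (fun r => r `^ (- b) * (w r)^-1)).
    by move=> r r0 rl; rewrite invfM powRN.
  by rewrite opprD; exact: lower_pow_mul.
Qed.

Lemma pow_between_eq w w' lo hi : (forall r, 0 < r -> r <= l -> w r = w' r) ->
  pow_between w lo hi -> pow_between w' lo hi.
Proof.
move=> e [w0 wlo whi]; split.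
- by move=> r r0 rl; rewrite -e ?w0.
- exact: lower_pow_eq wlo.
- by apply: lower_pow_eq whi => r r0 rl; rewrite e.
Qed.

(** Comparing the points q l and l, the two bounds together give 1 <= C1 C2 q^(lo - hi), which fails
    for small q when [hi < lo]. *)
Lemma pow_between_le w lo hi : pow_between w lo hi -> lo <= hi.
Proof.
move=> [w0 [C1 C10 h1] [C2 C20 h2]]; rewrite leNgt; apply/negP => hilo.
have [q [q0 q1 qlt]] := @powR_gap (lo - hi) (C1 * C2)^-1
  (ltac:(lra)) (ltac:(pos)).
have ql0 : 0 < q * l by pos.
have qll : q * l <= l by rewrite ler_piMl// ltW.
have wl := w0 _ l0 (lexx _); have wq := w0 _ ql0 qll.
have := h1 _ _ ql0 qll (lexx _); have := h2 _ _ ql0 qll (lexx _).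
rewrite mulfK ?gt_eqF// => e2 e1.
have e2' : (C2 * q `^ (- hi))^-1 * w l <= w (q * l).
  move: e2; rewrite -lef_pV2 ?posrE; [|by pos|by pos].
  by rewrite invfM !invrK.
have := le_trans e2' e1.
rewrite ler_pM2r// invf_ple ?posrE; [|by pos|by pos].
apply/negP; rewrite -ltNge -[ltRHS]mul1r ltr_pdivlMr; last by pos.
have -> : C2 * q `^ (- hi) * (C1 * q `^ lo) = C1 * C2 * q `^ (lo - hi).
  by rewrite powRD ?(gt_eqF q0) ?implybT//; ring.
by rewrite -ltr_pdivlMl ?mulr1//; pos.
Qed.

Lemma class_Wt_pos w : class_Wt l w -> positive_on w.
Proof.
move=> [a [u [_ u0 _] ue]] r r0 rl; have := u0 r r0 rl.
by rewrite ue// pmulr_rgt0//; pos.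
Qed.

Lemma class_Wt_lower_pow w : class_Wt l w -> exists a, lower_pow l w a.
Proof.
move=> Ww; have w0 := class_Wt_pos Ww.
case: Ww => a [u [_ u0 [_ [C C0 CP]]] ue].
exists (- a), C => // s r s0 sr rl.
have r0 := lt_le_trans s0 sr; have sl := le_trans sr rl.
have := CP s r (ltW s0) sr rl; rewrite !ue//.
have sa : 0 < s `^ a by pos.
rewrite -ler_pdivlMl// => /le_trans; apply.
rewrite powRM ?invr_ge0 ?(ltW s0) ?(ltW r0)// powR_invr// opprK powRN.
by rewrite le_eqVlt; apply/orP; left; apply/eqP; ring.
Qed.

End lower_pow_theory.

(** * Indices *)

Section indices.
Context {R : realType}.
Implicit Types (l a b t s r : R) (phi w : R -> R).

Lemma at_right0_ex (V : set R) : 0^'+ V ->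
  exists2 d : R, 0 < d & forall h, 0 < h -> h < d -> V h.
Proof.
move=> [e /= e0 eV]; exists e => // h h0 he; apply: eV => //=.
by rewrite sub0r normrN gtr0_norm.
Qed.

Lemma near_at_right0 (V : set R) (d : R) : 0 < d ->
  (forall h, 0 < h -> h < d -> V h) -> 0^'+ V.
Proof.
move=> d0 dV; exists d => //= h; rewrite /= sub0r normrN => hd h0.
by apply: dV => //; rewrite gtr0_norm in hd.
Qed.

Lemma limf_esup_lt_ex (f : R -> \bar R) (y : \bar R) :
  (limf_esup f 0^'+ < y)%E ->
  exists2 d : R, 0 < d & forall h, 0 < h -> h < d -> (f h < y)%E.
Proof.
rewrite limf_esupE => /ereal_inf_lt[_ [V FV <-] Vy].
have [d d0 dV] := at_right0_ex FV; exists d => // h h0 hd.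
apply: le_lt_trans Vy; apply: ereal_sup_ubound.
by exists h => //; exact: dV.
Qed.

Lemma limf_einf_gt_ex (f : R -> \bar R) (y : \bar R) :
  (y < limf_einf f 0^'+)%E ->
  exists2 d : R, 0 < d & forall h, 0 < h -> h < d -> (y < f h)%E.
Proof.
rewrite limf_einfE => /ereal_sup_gt[_ [V FV <-] Vy].
have [d d0 dV] := at_right0_ex FV; exists d => // h h0 hd.
apply: (lt_le_trans Vy); apply: ereal_inf_lbound.
by exists h => //; exact: dV.
Qed.

Lemma limf_esup_le (f : R -> \bar R) (y : \bar R) (d : R) : 0 < d ->
  (forall h, 0 < h -> h < d -> (f h <= y)%E) -> (limf_esup f 0^'+ <= y)%E.
Proof.
move=> d0 dy; rewrite limf_esupE; apply: ge_ereal_inf.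
exists (ereal_sup (f @` [set h | 0 < h < d])).
  exists [set h | 0 < h < d] => //.
  by apply: (near_at_right0 d0) => h h0 hd /=; rewrite h0.
by apply: ge_ereal_sup => _ [h /= /andP[h0 hd] <-]; exact: dy.
Qed.

Lemma limf_einf_ge (f : R -> \bar R) (y : \bar R) (d : R) : 0 < d ->
  (forall h, 0 < h -> h < d -> (y <= f h)%E) -> (y <= limf_einf f 0^'+)%E.
Proof.
move=> d0 dy; rewrite limf_einfE; apply: le_ereal_sup_tmp.
exists (ereal_inf (f @` [set h | 0 < h < d])).
  exists [set h | 0 < h < d] => //.
  by apply: (near_at_right0 d0) => h h0 hd /=; rewrite h0.
by apply: le_ereal_inf_tmp => _ [h /= /andP[h0 hd] <-]; exact: dy.
Qed.

Lemma lne_mono (x y : \bar R) : (x <= y)%E -> (lne x <= lne y)%E.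
Proof.
move=> xy; have [x0|x0] := leP x 0%E; first by rewrite le0_lneNy// leNye.
by rewrite lee_lne// in_itv/= leey andbT ltW// (lt_le_trans x0).
Qed.

Lemma lne_powR (t a : R) : 0 < t -> lne (t `^ a)%:E = (a * ln t)%:E.
Proof. by move=> t0; rewrite lne_EFin ?ln_powR//; pos. Qed.

Lemma lne_gt_powR (x : \bar R) (t a : R) : 1 < t ->
  (a%:E < lne x * ((ln t)^-1)%:E)%E -> ((t `^ a)%:E < x)%E.
Proof.
move=> t1; have t0 : 0 < t by lra.
have lt0 : 0 < ln t by rewrite ln_gt0.
rewrite !ltNge; apply: contra => /lne_mono; rewrite lne_powR// => h.
by rewrite lee_pdivrMr.
Qed.

Lemma lne_lt_powR (x : \bar R) (t a : R) : 1 < t ->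
  (lne x * ((ln t)^-1)%:E < a%:E)%E -> (x < (t `^ a)%:E)%E.
Proof.
move=> t1; have t0 : 0 < t by lra.
have lt0 : 0 < ln t by rewrite ln_gt0.
rewrite !ltNge; apply: contra => /lne_mono; rewrite lne_powR// => h.
by rewrite lee_pdivlMr.
Qed.

(** An index above [a] exhibits one dilation t > 1 with w(h t) > t^a w(h) for all small h. Read
    backwards, this is a contraction at ratio 1/t, ready to be iterated. *)
Lemma lower_index_lower_pow l w a : 0 < l -> class_Wt l w ->
  (a%:E < lower_index w)%E -> lower_pow l w a.
Proof.
move=> l0 Ww; have w0 := class_Wt_pos Ww.
have [a' lp] := class_Wt_lower_pow Ww.
move=> /ereal_sup_gt[_ [t /= t1 <-]] /(lne_gt_powR t1).
move=> /limf_einf_gt_ex[d d0 dP].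
have t0 : 0 < t by lra.
apply: (@lower_pow_improve _ _ l0 w a' a t^-1 (Num.min (d * t) l)) => //.
- by pos.
- by rewrite invf_lt1.
- by rewrite lt_min l0 andbT; pos.
move=> r r0; rewrite lt_min => /andP[rd rl].
have h0 : 0 < t^-1 * r by pos.
have hl : t^-1 * r <= l.
  by rewrite (le_trans _ (ltW rl))// ler_piMl ?(ltW r0)// invf_le1// ltW.
have := dP _ h0; rewrite mulrC ltr_pdivrMr// => /(_ rd).
rewrite lte_fin divfK ?gt_eqF// ltr_pdivlMr; last by rewrite w0// mulrC.
rewrite powR_invr// powRN => /ltW h.
by rewrite ler_pdivlMl//; pos.
Qed.

Lemma upper_index_lower_pow l w a : 0 < l -> class_Wt l w ->
  (upper_index w < a%:E)%E -> lower_pow l (fun r => (w r)^-1) (- a).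
Proof.
move=> l0 Ww; have w0 := class_Wt_pos Ww.
have [a' lp] := class_Wt_lower_pow Ww.
move=> /ereal_inf_lt[_ [t /= t1 <-]] /(lne_lt_powR t1).
move=> /limf_esup_lt_ex[d d0 dP].
have t0 : 0 < t by lra.
apply: (@lower_pow_improve_inv _ _ l0 w a' (- a) t^-1 (Num.min (d * t) l)) => //.
- by pos.
- by rewrite invf_lt1.
- by rewrite lt_min l0 andbT; pos.
move=> r r0; rewrite lt_min => /andP[rd rl].
have h0 : 0 < t^-1 * r by pos.
have hl : t^-1 * r <= l.
  by rewrite (le_trans _ (ltW rl))// ler_piMl ?(ltW r0)// invf_le1// ltW.
have := dP _ h0; rewrite mulrC ltr_pdivrMr// => /(_ rd).
have wr := w0 _ r0 (ltW rl); have wh := w0 _ h0 hl.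
rewrite lte_fin divfK ?gt_eqF// ltr_pdivrMr; last by rewrite mulrC.
rewrite powR_invr// opprK => /ltW h.
rewrite -[leLHS]mul1r ler_pdivrMr; last by rewrite mulrC.
by rewrite mulrAC ler_pdivlMr// mul1r.
Qed.

(** Were the order reversed, there would be reals b < a between the indices, and [w] would satisfy
    the power bounds with [a] from below and [b] from above, against [pow_between_le]. *)
Lemma lower_index_le_upper_index l w : 0 < l -> class_Wt l w ->
  (lower_index w <= upper_index w)%E.
Proof.
move=> l0 Ww; rewrite leNgt; apply/negP => ul.
have [b ub bl] : exists2 b : R, (upper_index w < b%:E)%E & (b%:E < lower_index w)%E.
  move: ul; case: (upper_index w) (lower_index w) => [u| |] [v| |]//=.
  - by rewrite lte_fin => uv; exists ((u + v) / 2); rewrite lte_fin; lra.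
  - by move=> _; exists (u + 1); rewrite ?ltry// lte_fin; lra.
  - by move=> _; exists (v - 1); rewrite ?ltNyr// lte_fin; lra.
  - by move=> _; exists 0; rewrite ?ltry// ltNyr.
have [a ba al] : exists2 a : R, b < a & (a%:E < lower_index w)%E.
  move: bl; case: (lower_index w) => [v| |]//=.
  - by rewrite lte_fin => uv; exists ((b + v) / 2); rewrite ?lte_fin; lra.
  - by move=> _; exists (b + 1); rewrite ?ltry//; lra.
have : pow_between l w a b.
  split; [exact: class_Wt_pos|exact: lower_index_lower_pow|].
  exact: upper_index_lower_pow.
by move=> /(pow_between_le l0); rewrite leNgt ba.
Qed.

Lemma pow_between_lower_index l w lo hi : 0 < l -> pow_between l w lo hi ->
  (lo%:E <= lower_index w)%E.
Proof.
move=> l0 [w0 [C C0 CP] _]; apply/lee_addgt0Pr => e e0.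
(* The constant [C] shifts the quotient of logarithms by ln C / ln t. This dilation makes the shift
   at most [e], and the maximum with 1 keeps t > 1. *)
pose t := expR (Num.max 1 (ln C / e)).
have lt1 : 1 <= Num.max 1 (ln C / e) by rewrite le_max lexx.
have t1 : 1 < t by rewrite expR_gt1; lra.
have t0 : 0 < t by lra.
have lnt : ln t = Num.max 1 (ln C / e) by rewrite expRK.
have lnt0 : 0 < ln t by rewrite lnt; lra.
have h : ((t `^ lo / C)%:E <= limf_einf (fun h : R => (w (h * t) / w h)%:E) 0^'+)%E.
  apply: (@limf_einf_ge _ _ (l / t)); first by pos.
  move=> h h0 hl; have htl : h * t <= l by rewrite -ler_pdivlMr// ltW.
  have hht : h <= h * t by rewrite ler_peMr ?(ltW h0)// ltW.
  have := CP _ _ h0 hht htl; have wh := w0 _ h0 (le_trans hht htl).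
  rewrite invfM mulrA divff ?gt_eqF// mul1r powR_invr// powRN => hh.
  rewrite lee_fin ler_pdivrMr// mulrAC ler_pdivlMr//.
  by rewrite -ler_pdivlMl ?powR_gt0// (le_trans hh)// le_eqVlt; apply/orP; left; apply/eqP; ring.
rewrite -leeBlDr//; apply: le_ereal_sup_tmp.
exists (lne (limf_einf (fun h : R => (w (h * t) / w h)%:E) 0^'+) * ((ln t)^-1)%:E)%E.
  by exists t.
apply: (@le_trans _ _ (lne (t `^ lo / C)%:E * ((ln t)^-1)%:E)%E).
  rewrite lne_EFin; last by pos.
  rewrite -EFinB -EFinM lee_fin ler_pdivlMr// lnM ?posrE; [|by pos|by pos].
  rewrite ln_powR lnV ?posrE// mulrBl lerD2l lerN2.
  by rewrite -ler_pdivrMl// mulrC lnt le_max lexx orbT.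
by apply: lee_wpmul2r; [rewrite lee_fin; pos|exact: lne_mono].
Qed.

Lemma pow_between_upper_index l w lo hi : 0 < l -> pow_between l w lo hi ->
  (upper_index w <= hi%:E)%E.
Proof.
move=> l0 [w0 _ [C C0 CP]]; apply/lee_addgt0Pr => e e0.
pose t := expR (Num.max 1 (ln C / e)).
have lt1 : 1 <= Num.max 1 (ln C / e) by rewrite le_max lexx.
have t1 : 1 < t by rewrite expR_gt1; lra.
have t0 : 0 < t by lra.
have lnt : ln t = Num.max 1 (ln C / e) by rewrite expRK.
have lnt0 : 0 < ln t by rewrite lnt; lra.
have h : (limf_esup (fun h : R => (w (h * t) / w h)%:E) 0^'+ <= (C * t `^ hi)%:E)%E.
  apply: (@limf_esup_le _ _ (l / t)); first by pos.
  move=> h h0 hl; have htl : h * t <= l by rewrite -ler_pdivlMr// ltW.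
  have hht : h <= h * t by rewrite ler_peMr ?(ltW h0)// ltW.
  have := CP _ _ h0 hht htl; have wh := w0 _ h0 (le_trans hht htl).
  have wht := w0 _ (lt_le_trans h0 hht) htl.
  rewrite invfM mulrA divff ?gt_eqF// mul1r powR_invr// opprK => hh.
  rewrite lee_fin; move: hh; rewrite ler_pdivlMr//.
  by rewrite mulrC.
apply: ge_ereal_inf.
exists (lne (limf_esup (fun h : R => (w (h * t) / w h)%:E) 0^'+) * ((ln t)^-1)%:E)%E.
  by exists t.
apply: (@le_trans _ _ (lne (C * t `^ hi)%:E * ((ln t)^-1)%:E)%E).
  by apply: lee_wpmul2r; [rewrite lee_fin; pos|exact: lne_mono].
rewrite lne_EFin; last by pos.
rewrite -EFinD -EFinM lee_fin ler_pdivrMr// lnM ?posrE; [|by pos|by pos].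
rewrite ln_powR mulrDl addrC lerD2l.
by rewrite -ler_pdivrMl// mulrC lnt le_max lexx orbT.
Qed.

End indices.

(** * Zygmund conditions *)

Section power_integrals.
Context {R : realType}.
Implicit Types (a b c t : R) (F f : R -> R).

Lemma powR_continuous c t : 0 < t -> {for t, continuous (@powR R ^~ c)}.
Proof.
move=> t0; apply: differentiable_continuous; apply/derivable1_diffP.
by apply: derivable_powR; rewrite in_itv/= t0.
Qed.

Lemma integral_derivative F f a b : 0 < a -> a < b ->
  (forall t, 0 < t -> is_derive t 1 F (f t)) ->
  (forall t, 0 < t -> {for t, continuous f}) ->
  (\int[lebesgue_measure]_(t in `[a, b]) (f t)%:E = (F b - F a)%:E)%E.
Proof.
move=> a0 ab dF cf.
have cF t : 0 < t -> {for t, continuous F}.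
  move=> t0; apply: differentiable_continuous; apply/derivable1_diffP.
  exact: (@ex_derive _ _ _ _ _ _ _ (dF t t0)).
have b0 := lt_trans a0 ab.
rewrite (@continuous_FTC2 _ f F)//.
- apply/continuous_within_itvP => //; split.
  + by move=> t; rewrite in_itv/= => /andP[at_ _]; apply: cf; exact: lt_trans at_.
  + by apply: cvg_at_right_filter; exact: cf.
  + by apply: cvg_at_left_filter; exact: cf.
- split.
  + move=> t; rewrite in_itv/= => /andP[at_ _].
    exact: (@ex_derive _ _ _ _ _ _ _ (dF t (lt_trans a0 at_))).
  + by apply: cvg_at_right_filter; exact: cF.
  + by apply: cvg_at_left_filter; exact: cF.
- move=> t; rewrite in_itv/= => /andP[at_ _]; rewrite derive1E.
  exact: (@derive_val _ _ _ _ _ _ _ (dF t (lt_trans a0 at_))).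
Qed.

Lemma integral_powR c a b : c != 0 -> 0 < a -> a < b ->
  (\int[lebesgue_measure]_(t in `[a, b]) (t `^ (c - 1))%:E =
   ((b `^ c - a `^ c) / c)%:E)%E.
Proof.
move=> c0 a0 ab.
rewrite mulrBl ![_ / c]mulrC.
apply: (@integral_derivative (fun t => c^-1 * t `^ c)) => //.
- move=> t t0; have tI : t \in `]0, +oo[ by rewrite in_itv/= t0.
  have -> : t `^ (c - 1) = c^-1 *: (c * t `^ (c - 1)).
    by rewrite scalerA mulVf// scale1r.
  apply: is_deriveZ; apply: DeriveDef; first exact: derivable_powR.
  by rewrite -derive1E powR_derive1.
- by move=> t t0; exact: powR_continuous.
Qed.

Lemma integral_inv a b : 0 < a -> a < b ->
  (\int[lebesgue_measure]_(t in `[a, b]) (t^-1)%:E = (ln b - ln a)%:E)%E.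
Proof.
move=> a0 ab; apply: integral_derivative => //.
by move=> t t0; apply: inv_continuous; rewrite gt_eqF.
Qed.

Lemma integral_powR_at0 (e h : R) : 0 < e -> 0 < h ->
  (\int[lebesgue_measure]_(t in `]0%R, h]) (t `^ (e - 1))%:E
   <= (h `^ e / e)%:E)%E.
Proof.
move=> e0 h0.
have m n (D : set R) : measurable D -> measurable_fun D (fun t : R => (t `^ (n - 1))%:E).
  move=> mD; apply/measurable_EFinP.
  by apply: measurable_funTS; exact: measurable_powR.
(* The [+ 2] keeps each interval nondegenerate and away from 0, so that the explicit primitive
   applies on it. *)
have -> : `]0%R, h]%classic = \bigcup_n `[h / (n%:R + 2), h]%classic.
  apply/seteqP; split=> t /=.
    rewrite in_itv/= => /andP[t0 th].
    exists (Num.truncn (h / t)) => //=; rewrite in_itv/= th andbT.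
    rewrite ler_pdivrMr; last by pos.
    rewrite mulrC -ler_pdivrMr//.
    have := truncnS_gt (h / t); rewrite -natr1; lra.
  move=> [n _] /=; rewrite !in_itv/= => /andP[ht ->]; rewrite andbT.
  by apply: lt_le_trans ht; pos.
pose F n := `[h / (n%:R + 2), h]%classic : set R.
have Fsub i j : (i <= j)%N -> F i `<=` F j.
  move=> ij; apply: subset_itvr; rewrite bnd_simp ler_pM2l// lef_pV2 ?posrE; [|by pos|by pos].
  by rewrite lerD2r ler_nat.
have cv : (\int[lebesgue_measure]_(t in F n) (t `^ (e - 1))%:E)%E @[n --> \oo] -->
    (\int[lebesgue_measure]_(t in \bigcup_n F n) (t `^ (e - 1))%:E)%E.
  apply: ge0_nondecreasing_set_cvg_integral => //.
  - by move=> i j ij; apply/subsetPset; exact: Fsub.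
  - by move=> i; exact: measurable_itv.
  - by move=> i; apply: m; exact: measurable_itv.
  - by move=> i t _; rewrite lee_fin powR_ge0.
rewrite -(cvg_lim _ cv)//; apply: lime_le; first by apply/cvg_ex; eexists; exact: cv.
apply: nearW => n; rewrite integral_powR ?gt_eqF//; [|by pos|].
  rewrite lee_fin ler_pM2r ?invr_gt0// lerBlDr lerDl; pos.
rewrite ltr_pdivrMr; last by pos.
rewrite ltr_pMr//; have : 0 <= n%:R :> R by []; lra.
Qed.

End power_integrals.

Lemma measurable_inv_pos {R : realType} (D : set R) :
  (forall t, D t -> 0 < t) -> measurable_fun D (fun t : R => (t^-1)%:E).
Proof.
move=> D0; apply/measurable_EFinP.
apply: (@eq_measurable_fun _ _ _ _ _ (@powR R ^~ (-1))).
  by move=> t /set_mem/D0 t0; rewrite powR_inv1// ltW.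
by apply: measurable_funTS; exact: measurable_powR.
Qed.

Section Phi_class.
Context {R : realType} (l : R) (l0 : 0 < l).
Implicit Types (a b m t s r : R) (u w : R -> R).

Lemma class_W_measurable u (D : set R) b : class_W l u -> measurable D ->
  D `<=` `[0, l]%classic -> measurable_fun D (fun t => (u t / t `^ b)%:E).
Proof.
move=> [cu _ _] mD Dl; apply/measurable_EFinP; apply: measurable_funM.
  apply: (@measurable_funS _ _ _ _ `[0, l]%classic) => //.
  exact: subspace_continuous_measurable_fun.
rewrite (_ : (fun _ => _) = (fun t => t `^ (- b))).
  by apply: measurable_funTS; exact: measurable_powR.
by apply/funext => t; rewrite powRN.
Qed.

Lemma subset_integral_ge u b (k : R) (A : set R) x y : class_W l u ->
  measurable A -> A `<=` `[0, l]%classic -> `[x, y]%classic `<=` A ->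
  0 < x -> x < y -> 0 <= k ->
  (forall t, x <= t -> t <= y -> k * t^-1 <= u t / t `^ b) ->
  ((k * ln (y / x))%:E <= \int[lebesgue_measure]_(t in A) (u t / t `^ b)%:E)%E.
Proof.
move=> Wu mA Al xyA x0 xy k0 hk.
have mf := class_W_measurable b Wu mA Al.
have u0 t : A t -> (0 <= (u t / t `^ b)%:E)%E.
  move=> /Al/=; rewrite in_itv/= => /andP[t0 tl].
  case: Wu => _ _ [uge0 _]; rewrite lee_fin; apply: mulr_ge0; first exact: uge0.
  by pos.
apply: (@le_trans _ _ (\int[lebesgue_measure]_(t in `[x, y]) (u t / t `^ b)%:E)%E);
  last exact: ge0_subset_integral.
rewrite ln_div ?posrE//; last exact: lt_trans xy.
have xyp t : `[x, y]%classic t -> 0 < t.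
  by rewrite /= in_itv/= => /andP[xt _]; exact: lt_le_trans xt.
rewrite EFinM -integral_inv// -ge0_integralZl_EFin//.
- apply: ge0_le_integral => //.
  + move=> t; rewrite /= in_itv/= => /andP[xt _]; rewrite lee_fin.
    by apply: mulr_ge0 => //; rewrite invr_ge0; lra.
  + apply: measurable_funeM; exact: measurable_inv_pos.
  + exact: measurable_funS mf.
  + move=> t; rewrite /= in_itv/= => /andP[xt ty]; rewrite lee_fin.
    exact: hk.
- by move=> t; rewrite /= in_itv/= => /andP[xt _]; rewrite lee_fin invr_ge0; lra.
- exact: measurable_inv_pos.
Qed.


(** On [t0 r, r] almost monotonicity bounds u below by u(t0 r) / C, so the integral condition gives
    u(t0 r) ln(1/t0) <= c C u(r). The ratio is chosen to make ln(1/t0) equal to 2 c C. *)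
Lemma class_Zup_half u : class_W l u -> class_Zup 0 l u ->
  exists t0 : R, [/\ 0 < t0, t0 < 1 &
    forall r, 0 < r -> r <= l -> u (t0 * r) <= 2^-1 * u r].
Proof.
move=> Wu [_ [c c0 cP]]; case: (Wu) => _ u0 [uge0 [C C0 CP]].
pose t0 : R := expR (- (2 * c * C)).
have t00 : 0 < t0 := expR_gt0 _.
have t01 : t0 < 1 by rewrite expR_lt1 oppr_lt0; pos.
exists t0; split => // r r0 rl.
have x0 : 0 < t0 * r by pos.
have xr : t0 * r < r by rewrite gtr_pMl.
have ux := u0 _ x0 (le_trans (ltW xr) rl).
have := cP r r0 rl; rewrite powRr0 divr1.
have h : ((u (t0 * r) / C * ln (r / (t0 * r)))%:E <=
  \int[lebesgue_measure]_(t in `]0%R, r]) (u t / t `^ (1 + 0))%:E)%E.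
  apply: subset_integral_ge => //.
  - by move=> t /=; rewrite !in_itv/= => /andP[/ltW -> tr]; exact: le_trans rl.
  - move=> t /=; rewrite !in_itv/= => /andP[xt ->]; rewrite andbT.
    exact: lt_le_trans xt.
  - by pos.
  - move=> t xt tr; have t_gt0 : 0 < t by exact: lt_le_trans xt.
    rewrite addr0 powRr1 ?(ltW t_gt0)// ler_pM2r ?invr_gt0//.
    by rewrite ler_pdivrMr// [leRHS]mulrC; apply: CP => //; [exact: ltW|exact: le_trans rl].
move=> /(le_trans h); rewrite lee_fin.
have -> : r / (t0 * r) = expR (2 * c * C).
  by rewrite invfM mulrCA divff ?gt_eqF// mulr1 /t0 expRN invrK.
rewrite expRK.
have -> : u (t0 * r) / C * (2 * c * C) = 2 * c * u (t0 * r).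
  by field; rewrite gt_eqF.
rewrite -mulrA mulrCA ler_pM2l//; lra.
Qed.

(** The integral condition is used twice on v(t) = u(t) / t^m. Integrating over [r, 2r] shows that v
    is almost decreasing; integrating over [t0 r, r] then amplifies this to a factor 2. The first
    use needs 2r <= l, hence the restriction on [r]. *)
Lemma class_Zlow_double u m : class_Zlow m l u ->
  exists t0 : R, [/\ 0 < t0, t0 < 1 & forall r, 0 < r -> r < l / 2 ->
    2 * (u r / r `^ m) <= u (t0 * r) / (t0 * r) `^ m].
Proof.
move=> [Wu [c c0 cP]]; case: (Wu) => _ u0 [uge0 [C C0 CP]].
pose v t := u t / t `^ m.
have v0 r : 0 < r -> r <= l -> 0 < v r by move=> r0 rl; have := u0 r r0 rl; rewrite /v => ?; pos.
have ln20 : 0 < ln 2 :> R by rewrite ln_gt0//; lra.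
pose C1 := c * C * 2 `^ `|m| / ln 2.
have C10 : 0 < C1 by rewrite /C1; pos.
have vdec h r : 0 < h -> h <= r -> r <= l / 2 -> v r <= C1 * v h.
  move=> h0 hr rl2; have r0 := lt_le_trans h0 hr.
  have rl : r <= l by lra.
  have ur := u0 _ r0 rl; have vr := v0 _ r0 rl.
  have := cP h h0 (le_trans hr rl).
  have H : ((v r / (C * 2 `^ `|m|) * ln (2 * r / r))%:E <=
    \int[lebesgue_measure]_(t in `[h, l]) (u t / t `^ (1 + m))%:E)%E.
    apply: subset_integral_ge => //.
    - by move=> t /=; rewrite !in_itv/= => /andP[ht ->]; rewrite andbT; lra.
    - move=> t /=; rewrite !in_itv/= => /andP[rt tr]; apply/andP; split; lra.
    - lra.
    - by pos.
    - move=> t rt t2r; have t_gt0 : 0 < t by exact: lt_le_trans rt.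
      have ut : u r <= C * u t by apply: CP => //; lra.
      rewrite powRD; last by rewrite (gt_eqF t_gt0) implybT.
      rewrite powRr1 ?(ltW t_gt0)//.
      have -> : u t / (t * t `^ m) = u t / t `^ m / t by rewrite invfM mulrA mulrAC.
      rewrite ler_pM2r ?invr_gt0//.
      rewrite ler_pdivrMr; last by pos.
      rewrite /v ler_pdivrMr; last by pos.
      have tr : (t / r) `^ m <= 2 `^ `|m|.
        apply: powR_le_norm; first by rewrite ler_pdivlMr// mul1r.
        by rewrite ler_pdivrMr.
      have e : t `^ m = (t / r) `^ m * r `^ m.
        by rewrite -powRM; [rewrite divfK// gt_eqF|pos|pos].
      have tm : t `^ m <= 2 `^ `|m| * r `^ m by rewrite e ler_pM2r//; pos.
      apply: (le_trans ut).
      have -> : u t / t `^ m * (C * 2 `^ `|m|) * r `^ m =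
         C * u t * (2 `^ `|m| * r `^ m / t `^ m) by ring.
      have utp : 0 < u t by apply: u0 => //; lra.
      rewrite ler_peMr//; first by pos.
      by rewrite ler_pdivlMr ?mul1r//; pos.
  move=> /(le_trans H); rewrite lee_fin mulfK ?gt_eqF// -/(v h).
  rewrite mulrAC ler_pdivrMr; last by pos.
  rewrite -ler_pdivlMr// => /le_trans; apply.
  by rewrite /C1 le_eqVlt; apply/orP; left; apply/eqP; ring.
pose t0 : R := expR (- (2 * c * C1)).
have t00 : 0 < t0 := expR_gt0 _.
have t01 : t0 < 1 by rewrite expR_lt1 oppr_lt0; pos.
exists t0; split => // r r0 rl2; have rl : r <= l by lra.
have x0 : 0 < t0 * r by pos.
have xr : t0 * r < r by rewrite gtr_pMl.
have xl : t0 * r <= l by lra.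
have := cP _ x0 xl.
have vr := v0 _ r0 rl.
have H : ((v r / C1 * ln (r / (t0 * r)))%:E <=
    \int[lebesgue_measure]_(t in `[(t0 * r)%R, l]) (u t / t `^ (1 + m))%:E)%E.
  apply: subset_integral_ge => //.
  - by move=> t /=; rewrite !in_itv/= => /andP[ht ->]; rewrite andbT; lra.
  - move=> t /=; rewrite !in_itv/= => /andP[rt tr]; apply/andP; split; lra.
  - by pos.
  - move=> t rt tr; have t_gt0 : 0 < t by exact: lt_le_trans rt.
    rewrite powRD; last by rewrite (gt_eqF t_gt0) implybT.
    rewrite powRr1 ?(ltW t_gt0)//.
    have -> : u t / (t * t `^ m) = u t / t `^ m / t by rewrite invfM mulrA mulrAC.
    rewrite ler_pM2r ?invr_gt0//.
    rewrite ler_pdivrMr// [leRHS]mulrC; apply: vdec => //; lra.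
move=> /(le_trans H); rewrite lee_fin.
have -> : r / (t0 * r) = expR (2 * c * C1).
  by rewrite invfM mulrCA divff ?gt_eqF// mulr1 /t0 expRN invrK.
rewrite expRK.
have -> : v r / C1 * (2 * c * C1) = c * (2 * v r) by field; rewrite gt_eqF.
by rewrite ler_pM2l.
Qed.

(** A factor 1/2 at ratio [t0] is the power t0^e with e = ln(1/2) / ln t0. This is how each integral
    condition turns into a strictly positive margin in the exponent. *)
Lemma class_Phi_pow_between u m : class_Phi 0 m l u ->
  exists2 e : R, 0 < e & pow_between l u e (m - e).
Proof.
move=> [Zu Zl]; have [Wu _] := Zl; have Wtu := Zu.1.
have u0 := class_Wt_pos Wtu; have [a' lp] := class_Wt_lower_pow Wtu.
have half (t0 : R) : 0 < t0 -> t0 < 1 -> exists2 e : R, 0 < e & t0 `^ e = 2^-1.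
  move=> t00 t01; exists (ln 2^-1 / ln t0).
    by rewrite nmulr_rgt0 ?invr_lt0 ln_lt0 ?t00//; apply/andP; split; lra.
  rewrite /powR gt_eqF// divfK ?lnK ?posrE ?invr_gt0//.
  by rewrite lt_eqF// ln_lt0 ?t00.
have [t1 [t10 t11 H1]] := class_Zup_half Wu Zu.
have [t2 [t20 t21 H2]] := class_Zlow_double Zl.
have [e1 e10 te1] := half _ t10 t11; have [e2 e20 te2] := half _ t20 t21.
exists (Num.min e1 e2); first by rewrite lt_min e10.
split => //.
  apply: (@lower_pow_weaken _ _ _ e1) => //; first by rewrite ge_min lexx.
  apply: (@lower_pow_improve _ _ l0 u a' e1 t1 l) => // r r0 rl.
  by rewrite te1; apply: H1 => //; exact: ltW.
apply: (@lower_pow_weaken _ _ _ (e2 - m)).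
- by move=> r r0 rl; rewrite invr_gt0 u0.
- by rewrite opprB lerD2r ge_min lexx orbT.
apply: (@lower_pow_improve_inv _ _ l0 u a' _ t2 (l / 2)) => //; first by pos.
move=> r r0 rl; have := H2 r r0 rl.
have rl' : r <= l by lra.
have t2r : 0 < t2 * r by pos.
have ur := u0 _ r0 rl'.
have ut : 0 < u (t2 * r).
  by apply: u0 => //; rewrite (le_trans _ rl')// ler_piMl// ltW.
rewrite powRD; last by rewrite (gt_eqF t20) implybT.
rewrite te2 powRN (powRM _ (ltW t20) (ltW r0)).
rewrite ler_pdivlMr; last by pos.
have -> : 2 * (u r / r `^ m) * (t2 `^ m * r `^ m) = 2 * t2 `^ m * u r.
  by field; rewrite gt_eqF//; pos.
move=> h; have -> : 2^-1 / t2 `^ m / u r = (2 * t2 `^ m * u r)^-1 by rewrite !invfM.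
by rewrite lef_pV2 ?posrE//; pos.
Qed.

End Phi_class.

(** * Equivalence of the integral conditions and the index conditions *)

Section Phi_equiv.
Context {R : realType} (l : R) (l0 : 0 < l).
Implicit Types (a b m t s r : R) (u w : R -> R).

Lemma class_Wt_continuous w b : class_Wt l w ->
  (forall t, 0 < t -> t < l -> {for t, continuous (fun r => r `^ b * w r)}) /\
  (fun r => r `^ b * w r) @ l^'- --> l `^ b * w l.
Proof.
move=> [a [U [cU _ _] UE]].
have [cU1 cU2 cU3] := (continuous_within_itvP _ l0).1 cU.
have e t : 0 < t -> t <= l -> t `^ b * w t = t `^ (b - a) * U t.
  move=> t0 tl; rewrite UE// mulrA -powRD ?subrK//.
  by rewrite (gt_eqF t0) implybT.
split.
  move=> t t0 tl; change ((fun r => r `^ b * w r) @ t --> t `^ b * w t).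
  rewrite (e t t0 (ltW tl)).
  have tI : t \in `]0, l[ by rewrite in_itv/= t0.
  have cM : (fun r => r `^ (b - a) * U r) @ t --> t `^ (b - a) * U t.
    by apply: cvgM; [exact: powR_continuous|exact: cU1].
  apply: (@cvg_trans _ ((fun r => r `^ (b - a) * U r) @ t)).
    apply: near_eq_cvg; near=> x.
    rewrite e//; [near: x; exact: lt_nbhsr|apply: ltW; near: x].
    exact: lt_nbhsl.
  exact: cM.
rewrite e//; apply: (@cvg_trans _ ((fun r => r `^ (b - a) * U r) @ l^'-)).
  apply: near_eq_cvg; near=> x; rewrite e//.
by apply: cvgM => //; apply: cvg_at_left_filter; exact: powR_continuous.
Unshelve. all: by end_near.
Qed.

Lemma pow_between_class_W w b e hi : class_Wt l w -> b != 0 -> 0 < e ->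
  pow_between l (fun r => r `^ b * w r) e hi ->
  class_W l (fun r => r `^ b * w r).
Proof.
move=> Ww b0 e0 [u0 [C C0 CP] _].
have [c1 c2] := class_Wt_continuous b Ww.
have ul := u0 _ l0 (lexx _).
split => //.
- apply/continuous_within_itvP => //; split.
  + by move=> t; rewrite in_itv/= => /andP[t0 tl]; exact: c1.
  (* Since [b != 0], the power [b] of 0 is 0, so the product vanishes at the origin whatever [w 0]
     is. The positive lower exponent [e] makes the limit agree with that value. *)
  + rewrite powR0// mul0r.
    apply: (@squeeze_cvgr _ _ _ _ (fun=> 0)
      (fun t => C * (l^-1 `^ e * t `^ e) * (l `^ b * w l))).
    * near=> t.
      have t0 : 0 < t by near: t; exact: nbhs_right_gt.
      have tl : t <= l by apply: ltW; near: t; exact: nbhs_right_lt.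
      have ut := u0 _ t0 tl; rewrite (ltW ut)/=.
      have := CP _ _ t0 tl (lexx _).
      have -> : t / l = l^-1 * t by rewrite mulrC.
      by rewrite powRM ?invr_ge0 ?(ltW l0) ?(ltW t0).
    * exact: cvg_cst.
    * rewrite -[X in _ --> X](_ : C * (l^-1 `^ e * 0) * (l `^ b * w l) = 0); last by ring.
      apply: cvgM; last exact: cvg_cst.
      apply: cvgM; first exact: cvg_cst.
      by apply: cvgM; [exact: cvg_cst|exact: powR_cvg0].
  + exact: c2.
- split.
    move=> t; rewrite le_eqVlt => /orP[/eqP <- _|t0 tl].
      by rewrite powR0// mul0r.
    exact: ltW (u0 _ t0 tl).
  exists C => // s t; rewrite le_eqVlt => /orP[/eqP <- t0 tl|s0 st tl].
    rewrite powR0// mul0r; move: t0; rewrite le_eqVlt => /orP[/eqP <-|t0].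
      by rewrite powR0// mul0r mulr0.
    by rewrite mulr_ge0 ?(ltW C0)// (ltW (u0 _ t0 tl)).
  have t0 := lt_le_trans s0 st; have ut := u0 _ t0 tl.
  apply: (le_trans (CP _ _ s0 st tl)); rewrite ler_pM2r// ler_piMr ?(ltW C0)//.
  rewrite -(powRr0 (s / t)) ger_powR ?(ltW e0)//.
  by apply/andP; split; [pos|rewrite ler_pdivrMr// mul1r].
Unshelve. all: by end_near.
Qed.

(** Up to constants the two integrands are at most t^(e-1) and t^(-e-1), and the integrals of these
    powers are governed by the endpoint [h]. *)
Lemma pow_between_class_Phi w b m e : class_Wt l w -> b != 0 -> 0 < e ->
  pow_between l (fun r => r `^ b * w r) e (m - e) ->
  class_Phi 0 m l (fun r => r `^ b * w r).
Proof.
move=> Ww b0 e0 pb; have Wu := pow_between_class_W Ww b0 e0 pb.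
move: pb Wu; set u := fun r => r `^ b * w r => -[u0 [C C0 CP] [C' C'0 CP']] Wu.
have Wtu : class_Wt l u by exists 0, u => // t t0 _; rewrite powRr0 mul1r.
split; split => //.
  exists (C / e); first by pos.
  move=> h h0 hl; have uh := u0 _ h0 hl.
  rewrite powRr0 divr1.
  have k0 : 0 <= C * u h * (h `^ e)^-1 by pos.
  apply: (@le_trans _ _ (\int[lebesgue_measure]_(t in `]0%R, h])
     ((C * u h * (h `^ e)^-1)%:E * (t `^ (e - 1))%:E))%E).
    apply: ge0_le_integral => //.
    - move=> t; rewrite /= in_itv/= => /andP[t0 th]; rewrite lee_fin.
      by have := u0 _ t0 (le_trans th hl) => ?; pos.
    - apply: (@class_W_measurable _ l) => // t; rewrite /= !in_itv/= => /andP[/ltW -> th].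
      exact: le_trans hl.
    - apply: measurable_funeM; apply/measurable_EFinP.
      by apply: measurable_funTS; exact: measurable_powR.
    - move=> t; rewrite /= in_itv/= => /andP[t0 th]; rewrite -EFinM lee_fin.
      rewrite addr0 powRr1 ?(ltW t0)// ler_pdivrMr//.
      apply: (le_trans (CP _ _ t0 th hl)).
      have te : (t : R) `^ (e - 1) * (t : R) = (t : R) `^ e.
        by rewrite mulrC mulr_powRB1// ltW.
      rewrite -[leRHS]mulrA te.
      rewrite powRM ?invr_ge0 ?(ltW h0) ?(ltW t0)// powR_invr// powRN.
      by rewrite le_eqVlt; apply/orP; left; apply/eqP; ring.
  rewrite ge0_integralZl_EFin//.
  - apply: (@le_trans _ _ ((C * u h * (h `^ e)^-1)%:E * (h `^ e / e)%:E)%E).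
      by apply: lee_wpmul2l; [rewrite lee_fin|exact: integral_powR_at0].
    rewrite -EFinM lee_fin le_eqVlt; apply/orP; left; apply/eqP.
    by field; rewrite (gt_eqF e0) gt_eqF//; pos.
  - by move=> t _; rewrite lee_fin powR_ge0.
  - apply/measurable_EFinP.
    by apply: measurable_funTS; exact: measurable_powR.
exists (C' / e); first by pos.
move=> h h0 hl; have uh := u0 _ h0 hl.
move: hl; rewrite le_eqVlt => /orP[/eqP ehl|hl].
  rewrite -ehl set_itv1 integral_set1 lee_fin; pos.
pose k := C' * u h * (h `^ (m - e))^-1.
have k0 : 0 <= k by rewrite /k; pos.
have key t : h <= t -> t <= l -> u t / t `^ (1 + m) <= k * t `^ (- e - 1).
  move=> ht tl.
  have t0 : 0 < t by exact: lt_le_trans ht.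
  have ut := u0 _ t0 tl.
  have := CP' _ _ h0 ht tl; rewrite ler_pdivlMr// ler_pdivrMl// => hh.
  rewrite ler_pdivrMr; last by pos.
  apply: (le_trans hh).
  rewrite -/k -[leRHS]mulrA -powRD; last by rewrite (gt_eqF t0) implybT.
  have -> : - e - 1 + (1 + m) = m - e by ring.
  rewrite /k.
  rewrite powRM ?invr_ge0 ?(ltW h0) ?(ltW t0)// powR_invr// opprK powRN.
  by rewrite le_eqVlt; apply/orP; left; apply/eqP; ring.
apply: (@le_trans _ _ (\int[lebesgue_measure]_(t in `[h, l])
     (k%:E * (t `^ (- e - 1))%:E))%E).
  apply: ge0_le_integral => //.
  - move=> t; rewrite /= in_itv/= => /andP[ht tl]; rewrite lee_fin.
    by have := u0 _ (lt_le_trans h0 ht) tl => ?; pos.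
  - apply: (@class_W_measurable _ l) => // t; rewrite /= !in_itv/= => /andP[ht ->].
    by rewrite andbT (le_trans (ltW h0)).
  - apply: measurable_funeM; apply/measurable_EFinP.
    by apply: measurable_funTS; exact: measurable_powR.
  - move=> t; rewrite /= in_itv/= => /andP[ht tl]; rewrite -EFinM lee_fin.
    exact: key.
rewrite ge0_integralZl_EFin//.
- rewrite integral_powR ?oppr_eq0 ?gt_eqF//.
  rewrite -EFinM lee_fin /k.
  have -> : (l `^ (- e) - h `^ (- e)) / - e = (h `^ (- e) - l `^ (- e)) / e.
    by field; rewrite gt_eqF.
  apply: (@le_trans _ _ (C' * u h / h `^ (m - e) * (h `^ (- e) / e))).
    rewrite ler_wpM2l// ler_pM2r ?invr_gt0// lerBlDr lerDl; pos.
  rewrite powRB ?(gt_eqF h0) ?implybT// powRN.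
  rewrite le_eqVlt; apply/orP; left; apply/eqP.
  by field; rewrite !gt_eqF//; pos.
- by move=> t _; rewrite lee_fin powR_ge0.
- apply/measurable_EFinP.
  by apply: measurable_funTS; exact: measurable_powR.
Qed.

Lemma class_Wt_mul u b w : (forall t, 0 < t -> t <= l -> u t = t `^ b * w t) ->
  class_Wt l u -> class_Wt l w.
Proof.
move=> ue [a [U WU Ue]]; exists (a + b), U => // t t0 tl.
by rewrite Ue// ue// mulrA powRD// (gt_eqF t0) implybT.
Qed.

(** Positivity of [m] is forced by e <= m - e. It matters beyond this point: it certifies that the
    limit defining the index of the measure exists. *)
Lemma class_Phi_weight w b m : class_Phi 0 m l (fun r => r `^ b * w r) ->
  0 < m /\ exists2 e, 0 < e & pow_between l w (- b + e) (m - b - e).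
Proof.
move=> /(class_Phi_pow_between l0)[e e0 pb]; split.
  by have := pow_between_le l0 pb; lra.
exists e => //; have := pow_between_mul (- b) pb.
have -> : - b + (m - e) = m - b - e by ring.
apply: pow_between_eq => r r0 rl; rewrite mulrA -powRD ?addNr ?powRr0 ?mul1r//.
by rewrite (gt_eqF r0) implybT.
Qed.

Lemma class_Phi_index w q m : 1 < q ->
  class_Phi 0 m l (fun r => r `^ (m / q) * w r) <->
  [/\ class_Wt l w, ((- (m / q))%:E < lower_index w)%E,
      (lower_index w <= upper_index w)%E
    & (upper_index w < (m / (q / (q - 1)))%:E)%E].
Proof.
move=> q1; have q0 : 0 < q by lra.
have qE : m / (q / (q - 1)) = m - m / q by field; rewrite gt_eqF//= gt_eqF//; lra.
split=> [P|[Ww lo _ hi]].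
  have Ww : class_Wt l w by apply: class_Wt_mul P.1.1.
  have [m0 [e e0 pb]] := class_Phi_weight P.
  split => //.
  - by apply: lt_le_trans (pow_between_lower_index l0 pb); rewrite lte_fin; lra.
  - exact: (lower_index_le_upper_index l0).
  - apply: (le_lt_trans (pow_between_upper_index l0 pb)).
    by rewrite qE lte_fin; lra.
have w0 := class_Wt_pos Ww.
have [a a1 a2] : exists2 a : R, - (m / q) < a & (a%:E < lower_index w)%E.
  move: lo; case: (lower_index w) => [v| |]//=.
  - by rewrite lte_fin => uv; exists ((- (m / q) + v) / 2); rewrite ?lte_fin; lra.
  - by move=> _; exists (- (m / q) + 1); rewrite ?ltry//; lra.
have [b b1 b2] : exists2 b : R, b < m - m / q & (upper_index w < b%:E)%E.
  move: hi; rewrite qE; case: (upper_index w) => [v| |]//=.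
  - by rewrite lte_fin => uv; exists ((m - m / q + v) / 2); rewrite ?lte_fin; lra.
  - by move=> _; exists (m - m / q - 1); rewrite ?ltNyr//; lra.
have pb : pow_between l w a b.
  split => //; [exact: lower_index_lower_pow|exact: upper_index_lower_pow].
have ab := pow_between_le l0 pb.
have m0 : 0 < m by lra.
(* The smaller of the two margins left by the strict index inequalities. *)
pose e := Num.min (a + m / q) (m - m / q - b).
have e0 : 0 < e by rewrite /e lt_min; apply/andP; split; lra.
have e1 : e <= a + m / q by rewrite /e ge_min lexx.
have e2 : e <= m - m / q - b by rewrite /e ge_min lexx orbT.
apply: (@pow_between_class_Phi _ _ _ e) => //.
  by rewrite gt_eqF//; pos.
have [u0 ulo uhi] := pow_between_mul (m / q) pb.
split => //.
  by apply: (lower_pow_weaken u0) ulo; lra.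
apply: (@lower_pow_weaken _ _ _ (- (m / q + b))) => //; last by lra.
by move=> r r0 rl; rewrite invr_gt0 u0.
Qed.

End Phi_equiv.

(** * Measures of balls *)

Section ball_mass.
Context {R : realType} {disp : measure_display} {X : measurableType disp}.
Implicit Types (dist : X -> X -> R) (mu : {measure set X -> \bar R}).

Definition mass dist mu x r : R := fine (mu (qball dist x r)).

Record bounded_doubling dist mu (D c0 Cd : R) : Prop := BoundedDoubling {
  bd_quasi : is_quasimetric dist ;
  bd_c0 : 1 <= c0 ;
  bd_triangle : forall x y z, dist x y <= c0 * (dist x z + dist z y) ;
  bd_D : 0 < D ;
  bd_lt : forall x y, dist x y < D ;
  bd_measurable : forall x (r : R), measurable (qball dist x r) ;
  bd_massE : forall x (r : R), (mass dist mu x r)%:E = mu (qball dist x r) ;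
  bd_mass_gt0 : forall x (r : R), 0 < r -> 0 < mass dist mu x r ;
  bd_Cd : 1 <= Cd ;
  bd_doubling : forall x (r : R), 0 < r ->
    mass dist mu x (2 * r) <= Cd * mass dist mu x r }.

Lemma doubling_space_bounded dist mu :
  is_doubling_space dist mu -> (diam dist < +oo)%E -> 0 < fine (diam dist) ->
  exists D c0 Cd, bounded_doubling dist mu D c0 Cd /\
    forall x y, dist x y <= fine (diam dist).
Proof.
move=> [[d0 d1 dC [c0 c01 dtri]] _ mB B0 By [C C0 CP]] dy l0.
have dl x y : dist x y <= fine (diam dist).
  rewrite -lee_fin fineK; last first.
    by move: dy l0; case: (diam dist) => //=; rewrite ltxx.
  by apply: ereal_sup_ubound; exists (x, y).
have mE x r : measurable (qball dist x r).
  have [r0|r0] := ltP 0 r; first exact: mB.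
  rewrite (_ : qball _ _ _ = set0)//; apply/seteqP; split=> // y /=.
  by rewrite /qball/= => h; have := d0 x y; lra.
have fE x r : (mass dist mu x r)%:E = mu (qball dist x r).
  rewrite /mass fineK//; have [r0|r0] := ltP 0 r.
    by rewrite ge0_fin_numE// By.
  rewrite (_ : qball _ _ _ = set0) ?measure0//; apply/seteqP; split=> // y /=.
  by rewrite /qball/= => h; have := d0 x y; lra.
have m0 x r : 0 < r -> 0 < mass dist mu x r.
  by move=> r0; rewrite -lte_fin fE B0.
(* The diameter may be attained; adding 1 makes every open ball of radius [D] the whole space. *)
exists (fine (diam dist) + 1), c0, (Num.max 1 C); split => //; split => //.
- by split => //; exists c0.
- by lra.
- by move=> x y; have := dl x y; lra.
- by rewrite le_max lexx.
- move=> x r r0; rewrite -lee_fin EFinM !fE.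
  apply: (le_trans (CP x r r0)); rewrite lee_wpmul2r// lee_fin.
  by rewrite le_max lexx orbT.
Qed.

Section theory.
Context dist mu (D c0 Cd : R) (H : bounded_doubling dist mu D c0 Cd).
Local Notation B := (qball dist).
Local Notation bm := (mass dist mu).

Let c00 : 0 < c0. Proof. by have := bd_c0 H; lra. Qed.
Let Cd0 : 0 < Cd. Proof. by have := bd_Cd H; lra. Qed.
Let d0 x y : 0 <= dist x y. Proof. exact: qdist_ge0 (bd_quasi H) x y. Qed.
Let dC x y : dist x y = dist y x. Proof. exact: qdistC (bd_quasi H) x y. Qed.

Lemma mass_subset x y r s : B x r `<=` B y s -> bm x r <= bm y s.
Proof.
move=> sub; rewrite -lee_fin !(bd_massE H).
by apply: le_measure; rewrite ?inE; [exact: bd_measurable H _ _|exact: bd_measurable H _ _|].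
Qed.

Lemma mass_ge0 x r : 0 <= bm x r.
Proof. by rewrite -lee_fin (bd_massE H). Qed.

Lemma mass_le x r s : r <= s -> bm x r <= bm x s.
Proof. by move=> rs; apply: mass_subset => y /=; rewrite /qball/= => h; lra. Qed.

Lemma mass_exp x r n : 0 < r -> bm x (2 ^+ n * r) <= Cd ^+ n * bm x r.
Proof.
move=> r0; elim: n => [|n IH]; first by rewrite !expr0 !mul1r.
rewrite !exprS -!mulrA; apply: (le_trans (bd_doubling H _ _)); first by pos.
by rewrite ler_pM2l.
Qed.

Lemma mass_scale (k : R) : exists2 K : R, 0 < K &
  forall x r, 0 < r -> bm x (k * r) <= K * bm x r.
Proof.
have [n kn] : exists n, k <= 2 ^+ n.
  exists (Num.truncn k).+1.
  apply: (le_trans (ltW (truncnS_gt k))).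
  by rewrite -natrX ler_nat ltnW// ltn_expl.
exists (Cd ^+ n); first by pos.
move=> x r r0; apply: le_trans (mass_exp x n r0).
by apply: mass_le; rewrite ler_pM2r.
Qed.

Lemma ball_full x : B x D = setT.
Proof. by apply/seteqP; split=> // y _; exact: bd_lt H x y. Qed.

Lemma mass_full x y : bm x D = bm y D.
Proof. by rewrite /mass !ball_full. Qed.

Lemma mass_dyadic x y n : bm y D <= Cd ^+ n * bm x (D / 2 ^+ n).
Proof.
rewrite (mass_full y x); have := @mass_exp x (D / 2 ^+ n) n.
rewrite [_ * (D / _)]mulrC divfK; last by rewrite expf_eq0/= pnatr_eq0 andbF.
by apply; have := bd_D H => ?; pos.
Qed.

Lemma mass_le_full x y r : bm x r <= bm y D.
Proof. by apply: mass_subset; rewrite ball_full. Qed.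

(* [m] is only nonzero when the limit defining it exists, so no existence
   proof for that limit is needed. *)
Lemma mass_lower_pow (a : R) x L : 0 < L -> 0 < lower_index_measure dist mu ->
  a < lower_index_measure dist mu -> lower_pow L (bm x) a.
Proof.
move=> L0; rewrite /lower_index_measure.
set F := (F in lim (F @ _)) => m0 am.
have Fcvg : cvg (F @ 0^'+).
  apply: contrapT => /dvgP lE; move: m0; rewrite lE.
  by rewrite (_ : point = 0%E)//= ltxx.
set ll := lim (F @ 0^'+) in m0 am Fcvg.
have llE : ll = (fine ll)%:E by move: m0; case: (ll) => //=; rewrite ltxx.
have /fine_cvgP[near1 near2] : F x @[x --> 0^'+] --> (fine ll)%:E by rewrite -llE.
have [t0 [t00 t01 Ft0]] : exists t0, [/\ 0 < t0, t0 < 1 & (a%:E < F t0)%E].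
  have n3 : \forall t \near 0^'+, a < (fine \o F) t by exact: (cvgr_gt _ near2).

  have [d d0' dP] := at_right0_ex (filterI near1 n3).
  have m1 : 0 < Num.min d 1 by rewrite lt_min d0' ltr01.
  have md : Num.min d 1 <= d by rewrite ge_min lexx.
  have m1' : Num.min d 1 <= 1 by rewrite ge_min lexx orbT.
  exists (Num.min d 1 / 2); split; [by lra|by lra|].
  have [|h1 h2] := dP (Num.min d 1 / 2) ltac:(lra); first by lra.
  by rewrite -(fineK h1) lte_fin.
(* Dividing by this negative logarithm reverses inequalities, so a lower bound on the quotient
   becomes an upper bound on the limit superior. *)
have lnt0 : ln t0 < 0 by rewrite ln_lt0// t00.
have : (limf_esup (fun r : R => ereal_sup [set (ball_ratio dist mu x r t0)%:E | x in setT]) 0^'+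
   < (t0 `^ a)%:E)%E.
  rewrite ltNge; apply/negP => /lne_mono; rewrite lne_powR// => h.
  move: Ft0; rewrite ltNge => /negP; apply; rewrite /F.
  have -> : a%:E = ((a * ln t0)%:E * ((ln t0)^-1)%:E)%E.
    by rewrite -EFinM mulfK// lt_eqF.
  by rewrite leNgt lte_nmul2r// ?lte_fin ?invr_lt0// -leNgt.
move=> /limf_esup_lt_ex[d d0' dP].
have b0 : positive_on L (bm x) by move=> r r0 _; exact: bd_mass_gt0 H _ _ r0.
(* Monotonicity of the measure is the crude bound, with exponent 0. *)
apply: (@lower_pow_improve _ _ L0 (bm x) 0 a t0 d) => //.
  exists 1 => // s r s0 sr rL; rewrite powRr0 !mul1r; exact: mass_le.
move=> r r0 rd.
have := dP r r0 rd.
have h : ((ball_ratio dist mu x r t0)%:E <=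
  ereal_sup [set (ball_ratio dist mu x0 r t0)%:E | x0 in setT])%E.
  by apply: ereal_sup_ubound; exists x.
move=> /(le_lt_trans h); rewrite lte_fin /ball_ratio -/(bm x r) -/(bm x (r * t0)).
by rewrite ltr_pdivrMr ?(bd_mass_gt0 H)// (mulrC r) => /ltW.
Qed.

Lemma measurable_point x : measurable ([set x] : set X).
Proof.
rewrite (_ : [set x] = \bigcap_n B x (n.+1%:R^-1)).
  by apply: bigcap_measurable => // n _; exact: bd_measurable H _ _.
apply/seteqP; split=> [y -> n _|y yB] /=.
  by rewrite /qball/= (qdist_eq0 (bd_quasi H) x x).2// invr_gt0.
apply/esym/(qdist_eq0 (bd_quasi H)); apply/eqP; rewrite eq_le d0 andbT.
rewrite leNgt; apply/negP => dxy.
have := yB (Num.truncn ((dist x y)^-1)) I; rewrite /qball/= ltNge => /negP; apply.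
rewrite invf_ple ?posrE// ltW//; exact: truncnS_gt.
Qed.

Lemma mass_point x (a L : R) : 0 < a -> 0 < L -> lower_pow L (bm x) a ->
  mu [set x] = 0%E.
Proof.
move=> a0 L0 [C C0 CP].
have mx := measurable_point x.
have x_in r : 0 < r -> (mu [set x] <= (bm x r)%:E)%E.
  move=> r0; rewrite (bd_massE H); apply: le_measure; rewrite ?inE//.
    exact: bd_measurable H _ _.
  by move=> y -> /=; rewrite /qball/= (qdist_eq0 (bd_quasi H) x x).2.
apply/eqP; rewrite eq_le measure_ge0 andbT; apply/lee_addgt0Pr => e e0; rewrite add0e.
have bL := bd_mass_gt0 H x L0.
have [q [q0 q1 qe]] := @powR_gap R a (e / (C * bm x L)) a0 ltac:(pos).
apply: (le_trans (x_in (q * L) ltac:(pos))); rewrite lee_fin.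
apply: (le_trans (CP _ _ _ _ (lexx _))); first by pos.
  by rewrite ler_piMl// ltW.
rewrite mulfK ?gt_eqF// mulrAC mulrC -ler_pdivlMr ?ltW//; pos.
Qed.

End theory.
End ball_mass.

(** * The maximal theorem for a constant exponent *)

Lemma measurable_powR2 {R : realType} {disp : measure_display}
  {X : measurableType disp} (f p : X -> R) :
  measurable_fun setT f -> measurable_fun setT p ->
  measurable_fun setT (fun x => f x `^ p x).
Proof.
move=> mf mp; rewrite /powR.
have meq (g : X -> R) : measurable_fun setT g -> measurable_fun setT (fun x => g x == 0).
  by move=> mg; apply: measurable_fun_eqr => //.
apply: measurable_fun_ifT; first exact: meq.
  rewrite (_ : (fun _ => _) = fun x => if p x == 0 then 1 else 0).
    by apply: measurable_fun_ifT => //; exact: meq.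
  by apply/funext => x; case: eqP.
apply: measurableT_comp; first exact: measurable_expR.
apply: measurable_funM => //; apply: measurableT_comp mf; exact: measurable_ln.
Qed.

Section maximal.
Context {R : realType} {disp : measure_display} {X : measurableType disp}.
Context (dist : X -> X -> R) (mu : {measure set X -> \bar R}) (D c0 Cd : R)
  (H : bounded_doubling dist mu D c0 Cd).
Local Notation B := (qball dist).
Local Notation bm := (mass dist mu).

Let c01 : 1 <= c0. Proof. exact: bd_c0 H. Qed.
Let c00 : 0 < c0. Proof. by have := bd_c0 H; lra. Qed.
Let d0 x y : 0 <= dist x y. Proof. exact: qdist_ge0 (bd_quasi H) x y. Qed.
Let dC x y : dist x y = dist y x. Proof. exact: qdistC (bd_quasi H) x y. Qed.
Let dxx x : dist x x = 0. Proof. exact: (qdist_eq0 (bd_quasi H) x x).2. Qed.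
Let tri := bd_triangle H.
Let mB := bd_measurable H.

Definition disj (A A' : set X) : bool := A `&` A' == set0.

Lemma disjoint_balls_integral (s : seq (X * R)) (f : X -> \bar R) :
  measurable_fun setT f -> (forall x, 0 <= f x)%E ->
  pairwise (fun a b => disj (B a.1 a.2) (B b.1 b.2)) s ->
  (\sum_(a <- s) \int[mu]_(x in B a.1 a.2) f x <= \int[mu]_x f x)%E.
Proof.
move=> mf f0 ps.
(* The union is carried along with the fact that a set disjoint from every ball is disjoint from it;
   the induction needs this to add one more ball. *)
have [U [mU UE ->]] : exists U : set X, [/\ measurable U,
    (forall C, {in s, forall a, disj C (B a.1 a.2)} -> disj C U) &
    (\sum_(a <- s) \int[mu]_(x in B a.1 a.2) f x = \int[mu]_(x in U) f x)%E].
  elim: s ps => [_|a s IH /= /andP[/allP sa /IH[U [mU UE e]]]].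
    exists set0; split => //; first by move=> C _; rewrite /disj setI0.
    by rewrite big_nil integral_set0.
  exists (B a.1 a.2 `|` U); split; first exact: measurableU.
    move=> C Ca; rewrite /disj setIUr; apply/eqP; rewrite (eqP (Ca a (mem_head _ _))) set0U.
    by apply/eqP/UE => b bs; apply: Ca; rewrite in_cons bs orbT.
  rewrite big_cons e ge0_integral_setU//.
    by apply: measurable_funTS.
  by apply: UE => b bs; exact: sa.
exact: ge0_subset_integral.
Qed.

(** A packing argument. Points at mutual distance at least r have disjoint balls of radius r / (2
    c0), each carrying at least a fixed fraction of the total mass, so their number is bounded. *)
Lemma finite_net (r : R) : 0 < r ->
  exists s : seq X, forall x, exists2 z, z \in s & dist x z < r.
Proof.
move=> r0.
pose sep (s : seq X) := pairwise (fun a b => r <= dist a b) s.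
apply: contrapT => nos.
have ex k : exists s, sep s /\ size s = k.
  elim: k => [|k [s [ss sk]]]; first by exists [::].
  have [x xs] : exists x, forall z, z \in s -> r <= dist x z.
    apply: contrapT => h; apply: nos; exists s => x.
    apply: contrapT => h'; apply: h; exists x => z zs.
    by rewrite leNgt; apply/negP => dr; apply: h'; exists z.
  exists (x :: s); split; last by rewrite /= sk.
  by rewrite /sep /= -/(sep s) ss andbT; apply/allP => z /xs.
pose rho := r / (2 * c0).
have rho0 : 0 < rho by rewrite /rho; pos.
have x0 : X by exact: point.
have [K K0 KP] := mass_scale H (D / rho).
have low x : bm x0 D / K <= bm x rho.
  rewrite ler_pdivrMr// mulrC (mass_full H x0 x).
  by have := KP x rho rho0; rewrite divfK// gt_eqF.
have bnd s : sep s -> (size s)%:R * (bm x0 D / K) <= bm x0 D.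
  move=> ss.
  have := @disjoint_balls_integral [seq (z, rho) | z <- s] (cst 1%E).
  have -> : (\int[mu]_x cst 1 x = (bm x0 D)%:E)%E.
    by rewrite integral_cst// mul1e (bd_massE H) (ball_full H).
  rewrite big_map /=.
  under eq_bigr do rewrite integral_cst// mul1e -(bd_massE H).
  rewrite sumEFin lee_fin => h.
  apply: (@le_trans _ _ (\sum_(z <- s) bm z rho)); last first.
    rewrite -lee_fin; apply: h => //.
    rewrite pairwise_map; apply: sub_pairwise ss => a b /= rab.
    apply/eqP; apply/seteqP; split=> // y [/=]; rewrite /qball/= => ay by_.
    have := tri a b y; rewrite (dC y b) => h'.
    have : c0 * (dist a y + dist b y) < c0 * (rho + rho) by rewrite ltr_pM2l//; lra.
    have -> : c0 * (rho + rho) = r by rewrite /rho; field; rewrite gt_eqF.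
    lra.
  have -> : (size s)%:R * (bm x0 D / K) = \sum_(z <- s) (bm x0 D / K).
    by rewrite big_const_seq count_predT iter_addr_0 mulr_natl.
  exact: ler_sum.
have M0 := bd_mass_gt0 H x0 (bd_D H).
have [s [ss sk]] := ex (Num.truncn K).+1.
have := bnd s ss; rewrite sk mulrA ler_pdivrMr// mulrC ler_pM2l//.
by rewrite leNgt truncnS_gt.
Qed.

(** Every ball is replaced by one of a countable family at the price of a constant in the mass.
    Level sets then are countable unions of measurable balls, although the maximal function itself
    may not be measurable. *)
Lemma countable_balls : exists (b : nat -> X * R) (C : R), [/\ 0 < C,
  forall j, 0 < (b j).2 &
  forall x r, 0 < r -> exists j, B x r `<=` B (b j).1 (b j).2 /\
    bm (b j).1 (b j).2 <= C * bm x r].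
Proof.
have D0 := bd_D H.
pose rr n : R := D / 2 ^+ n.
have rr0 n : 0 < rr n by rewrite /rr; pos.
have [net netP] := choice (fun n => finite_net (rr0 n)).
pose b j := if @unpickle (nat * nat)%type j is Some (n, i)
  then (nth point (net n) i, 2 * c0 * rr n) else (point, D).
have [K K0 KP] := mass_scale H (2 * (2 * c0 * (1 + 2 * c0))).
exists b, (K + 1); split; first by pos.
  by move=> j; rewrite /b; case: unpickle => [[n i]|]//=; have := rr0 n => ?; pos.
move=> x r r0.
have [n [nr1 nr2]] : exists n, (r <= rr n \/ n = 0%N) /\ rr n.+1 < r.
  have [Dr|rD] := leP D r.
    exists 0%N; split; [by right|].
    rewrite /rr expr1; lra.
  have [n [h1 h2]] := geometric_bracket (ltac:(lra) : 0 < 2^-1 :> R)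
    (ltac:(lra) : 2^-1 < 1 :> R) r0 (ltW rD).
  exists n; split.
    by left; move: h2; rewrite exprVn mulrC.
  by move: h1; rewrite exprVn mulrC.
have [z zs dxz] := netP n x.
exists (pickle (n, index z (net n))).
rewrite /b pickleK nth_index//=.
have cr : 0 < c0 * rr n by have := rr0 n => ?; pos.
split.
  move=> y /=; rewrite /qball/= => dxy.
  have : dist x y < rr n.
    case: nr1 => [h|n0]; first by lra.
    by rewrite n0 /rr expr0 divr1; exact: bd_lt H x y.
  move=> dxy'; apply: (le_lt_trans (tri z y x)).
  have -> : 2 * c0 * rr n = c0 * (rr n + rr n) by ring.
  by rewrite ltr_pM2l// ltrD// dC.
have rn : rr n = 2 * rr n.+1 by rewrite /rr exprS; field; rewrite expf_eq0/= pnatr_eq0 andbF.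
apply: (@le_trans _ _ (K * bm x r)); last first.
  by rewrite ler_pM2r ?(bd_mass_gt0 H)//; lra.
apply: le_trans (KP x r r0).
apply: (mass_subset H) => y; rewrite /qball/= => dzy.
apply: (le_lt_trans (tri x y z)).
have rnr : rr n < 2 * r by rewrite rn ltr_pM2l.
apply: (@lt_trans _ _ (c0 * (rr n + 2 * c0 * rr n))).
  by rewrite ltr_pM2l// ltrD.
have -> : c0 * (rr n + 2 * c0 * rr n) = (c0 * (1 + 2 * c0)) * rr n by ring.
have cc : 0 < c0 * (1 + 2 * c0) by pos.
apply: (@lt_le_trans _ _ ((c0 * (1 + 2 * c0)) * (2 * r))); first by rewrite ltr_pM2l.
have -> : 2 * (2 * c0 * (1 + 2 * c0)) * r = 2 * ((c0 * (1 + 2 * c0)) * (2 * r)) by ring.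
rewrite ler_peMl//; first by pos.
lra.
Qed.

(** Greedy selection by largest radius. If b meets a ball a of no smaller radius, two triangle
    inequalities place the points of b within c0 a + 2 c0^2 a of the centre of a (writing a for its
    radius), which is the origin of the factor 3 c0^2. *)
Lemma vitali_seq (s : seq (X * R)) : (forall a, a \in s -> 0 < a.2) ->
  exists t : seq (X * R), [/\ {subset t <= s},
    pairwise (fun a b => disj (B a.1 a.2) (B b.1 b.2)) t &
    forall b, b \in s -> exists2 a, a \in t & B b.1 b.2 `<=` B a.1 (3 * c0 * c0 * a.2)].
Proof.
have [n] := ubnP (size s); elim: n s => // n IH s; rewrite ltnS => sn s0.
case: (eqVneq s [::]) => [->|sN]; first by exists [::].
have [a [as_ amax]] : exists a, a \in s /\ forall b, b \in s -> b.2 <= a.2.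
  elim: {sn s0} s sN => // c s IHs _.
  have [->|/IHs[a [as_ amax]]] := eqVneq s [::].
    by exists c; rewrite mem_head; split => // b; rewrite inE => /eqP ->.
  have [ca|ac] := leP c.2 a.2.
    exists a; rewrite in_cons as_ orbT; split => // b; rewrite in_cons.
    by move=> /orP[/eqP ->//|]; exact: amax.
  exists c; rewrite mem_head; split => // b; rewrite in_cons.
  by move=> /orP[/eqP ->//|/amax h]; rewrite (le_trans h)// ltW.
pose s' := [seq b <- s | disj (B a.1 a.2) (B b.1 b.2)].
have a0 := s0 _ as_.
have selfN : ~~ disj (B a.1 a.2) (B a.1 a.2).
  apply/negP => /eqP/seteqP[/(_ a.1) h _]; apply: h.
  by split; rewrite /= /qball/= dxx.
have ss' : (size s' < n)%N.
  apply: leq_trans sn; rewrite size_filter -(count_predC (fun b => disj (B a.1 a.2) (B b.1 b.2)) s).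
  rewrite -[ltnLHS]addn0 ltn_add2l -has_count; apply/hasP; exists a => //.
have [b bs'|t [ts' pt cov]] := IH s' ss'.
  by apply: s0; move: bs'; rewrite mem_filter => /andP[].
exists (a :: t); split.
- move=> b; rewrite in_cons => /orP[/eqP ->//|/ts']; by rewrite mem_filter => /andP[].
- rewrite /= pt andbT; apply/allP => b /ts'; by rewrite mem_filter => /andP[].
move=> b bs; have [db|] := boolP (disj (B a.1 a.2) (B b.1 b.2)).
  have [|c ct sub] := cov b; first by rewrite mem_filter db.
  by exists c => //; rewrite in_cons ct orbT.
move=> /eqP/eqP/set0P[w [/= aw bw]].
exists a; first exact: mem_head.
have ba := amax b bs; have b0 := s0 b bs.
move=> y; rewrite /qball/= => dby; move: aw bw; rewrite /qball/= => aw bw.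
have h1 := tri a.1 y w; have h2 := tri w y b.1.
rewrite (dC w b.1) in h2.
have h3 : dist w y < c0 * (2 * a.2).
  by apply: (le_lt_trans h2); rewrite ltr_pM2l//; lra.
apply: (le_lt_trans h1).
have -> : 3 * c0 * c0 * a.2 = c0 * (c0 * a.2 + c0 * (2 * a.2)) by ring.
rewrite ltr_pM2l//.
have : a.2 <= c0 * a.2 by rewrite ler_peMl// ltW.
lra.
Qed.

(** A countable stand-in for the set where the maximal function of [h] exceeds [lam]: only the balls
    of the family [b] are tested. *)
Definition level_set (b : nat -> X * R) (h : X -> R) (lam : R) : set X :=
  \bigcup_(j in [set j | ((lam * bm (b j).1 (b j).2)%:E <
    \int[mu]_(x in B (b j).1 (b j).2) (h x)%:E)%E]) B (b j).1 (b j).2.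

Lemma level_set_measurable b h lam : measurable (level_set b h lam).
Proof. by apply: bigcup_measurable => j _; exact: mB. Qed.

(** The selection lemma handles finitely many balls; continuity of the measure along the increasing
    unions [F n] reaches the whole level set. *)
Lemma weak_type : exists2 K : R, 0 < K & forall (b : nat -> X * R) (h : X -> R) lam,
  (forall j, 0 < (b j).2) -> measurable_fun setT h -> (forall x, 0 <= h x) ->
  0 < lam ->
  (mu (level_set b h lam) <= (K / lam)%:E * \int[mu]_x (h x)%:E)%E.
Proof.
have [K K0 KP] := mass_scale H (3 * c0 * c0); exists K => //.
move=> b h lam b0 mh h0 lam0.
have mhE : measurable_fun setT (fun x => (h x)%:E) by exact/measurable_EFinP.
have hE0 x : (0 <= (h x)%:E)%E by rewrite lee_fin.
pose P j := ((lam * bm (b j).1 (b j).2)%:E <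
    \int[mu]_(x in B (b j).1 (b j).2) (h x)%:E)%E.
pose F n := \bigcup_(j in [set j | P j /\ (j < n)%N]) B (b j).1 (b j).2.
have mF n : measurable (F n) by apply: bigcup_measurable => j _; exact: mB.
have FE : level_set b h lam = \bigcup_n F n.
  apply/seteqP; split=> [x [j /= Pj xj]|x [n _ [j /= [Pj _] xj]]].
    by exists j.+1 => //; exists j => //=; rewrite ltnSn.
  by exists j.
have cvF : mu \o F @ \oo --> mu (\bigcup_n F n).
  apply: nondecreasing_cvg_mu => //; first exact: bigcup_measurable.
  move=> i j ij; apply/subsetPset => x [k /= [Pk ki] xk].
  by exists k => //=; rewrite (leq_trans ki).
rewrite FE -(cvg_lim _ cvF)//; apply: lime_le; first by apply/cvg_ex; eexists; exact: cvF.
apply: nearW => n /=.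
pose s := [seq b j | j <- iota 0 n & P j].
have [|t [ts pt cov]] := @vitali_seq s.
  by move=> a /mapP[j _ ->]; exact: b0.
have tP a : a \in t -> 0 < a.2 /\ ((lam * bm a.1 a.2)%:E <= \int[mu]_(x in B a.1 a.2) (h x)%:E)%E.
  move=> /ts/mapP[j]; rewrite mem_filter => /andP[Pj _] ->.
  by split; [exact: b0|exact: ltW].
apply: (@le_trans _ _ (\sum_(a <- t) mu (B a.1 (3 * c0 * c0 * a.2)))%E).
  have sub : F n `<=` \big[setU/set0]_(a <- t) B a.1 (3 * c0 * c0 * a.2).
    move=> x [j /= [Pj jn] xj].
    have bs : b j \in s.
      by apply: map_f; rewrite mem_filter mem_iota add0n jn Pj.
    have [a at_ /(_ x xj) xa] := cov _ bs.
    by rewrite -bigcup_seq; exists a.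
  elim: {pt cov tP ts} t (F n) (mF n) sub => [|a t IH] E mE.
    by rewrite !big_nil => sub; rewrite (_ : E = set0) ?measure0//; apply/seteqP; split.
  rewrite !big_cons => sub.
  have mA := mB a.1 (3 * c0 * c0 * a.2).
  apply: (@le_trans _ _ (mu (B a.1 (3 * c0 * c0 * a.2)) + mu (E `\` B a.1 (3 * c0 * c0 * a.2)))%E).
    apply: (@le_trans _ _ (mu (B a.1 (3 * c0 * c0 * a.2) `|` (E `\` B a.1 (3 * c0 * c0 * a.2))))).
      apply: le_measure; rewrite ?inE//; first by apply: measurableU => //; exact: measurableD.
      by move=> x Ex; case: (pselect (B a.1 (3 * c0 * c0 * a.2) x)); [left|right].
    by apply: measureU2 => //; exact: measurableD.
  apply: leeD2l; apply: IH; first exact: measurableD.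
  by move=> x [/sub[]].
apply: (@le_trans _ _ (\sum_(a <- t) (K / lam)%:E * \int[mu]_(x in B a.1 a.2) (h x)%:E)%E).
  rewrite big_seq [in leRHS]big_seq; apply: lee_sum => a /tP[a0 aP].
  rewrite -(bd_massE H); apply: (@le_trans _ _ ((K / lam)%:E * (lam * bm a.1 a.2)%:E)%E).
    rewrite -EFinM lee_fin mulrA divfK ?gt_eqF//; exact: KP.
  by apply: lee_wpmul2l => //; rewrite lee_fin; pos.
rewrite -ge0_sume_distrr; last by move=> a _; apply: integral_ge0.
apply: lee_wpmul2l; first by rewrite lee_fin; pos.
exact: disjoint_balls_integral.
Qed.

(** Discrete form of integrating lam^(q-2) t over 1 <= lam < 2t in a layer-cake argument. The terms
    grow geometrically until the cutoff, so the last nonzero one dominates and is of order t^q. *)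
Lemma geometric_cutoff_sum (q : R) : 1 < q -> exists2 K : R, 0 < K &
  forall (t : R) n, 0 <= t ->
    \sum_(k < n) ((2 `^ (q - 1)) ^+ k * (if 2 ^+ k < 2 * t then t else 0)) <= K * t `^ q.
Proof.
move=> q1; pose a : R := 2 `^ (q - 1).
have a1 : 1 < a by rewrite /a /powR pnatr_eq0/= expR_gt1 mulr_gt0 ?ln_gt0//; lra.
pose K1 : R := a / (a - 1).
have K10 : 0 < K1 by rewrite /K1 divr_gt0//; lra.
have aM1 : a - 1 != 0 by rewrite gt_eqF//; lra.
have K20 : 0 < K1 * 2 `^ (q - 1) by pos.
exists (K1 * 2 `^ (q - 1)) => // t n t0; rewrite -/a.
have [->|tn0] := eqVneq t 0.
  rewrite big1; first by pos.
  by move=> i _; rewrite mulr0 ifF ?mulr0//; apply/negbTE; rewrite -leNgt exprn_ge0.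
have t_gt0 : 0 < t by rewrite lt_neqAle eq_sym tn0.
have tq : t `^ q = t `^ (q - 1) * t.
  by rewrite mulrC mulr_powRB1//; lra.
elim: n => [|n IH]; first by rewrite big_ord0; pos.
rewrite big_ord_recr/=; case: ifPn => [h|_]; last by rewrite mulr0 addr0.
have geo m : \sum_(k < m) (a ^+ k * (if 2 ^+ k < 2 * t then t else 0)) <= (a ^+ m - 1) / (a - 1) * t.
  elim: m => [|m IHm]; first by rewrite big_ord0 expr0 subrr !mul0r.
  rewrite big_ord_recr/=.
  have e : (a ^+ m.+1 - 1) / (a - 1) * t = (a ^+ m - 1) / (a - 1) * t + a ^+ m * t.
    by rewrite exprS; field.
  rewrite e lerD// ler_wpM2l//; first by pos.
  by case: ifPn => // _; exact: ltW.
apply: (@le_trans _ _ ((a ^+ n.+1 - 1) / (a - 1) * t)).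
  by have := geo n.+1; rewrite big_ord_recr/= h.
rewrite tq mulrA ler_wpM2r ?(ltW t_gt0)//.
apply: (@le_trans _ _ (K1 * a ^+ n)).
  rewrite /K1 exprS ler_pdivrMr; last by lra.
  by rewrite mulrAC divfK//; lra.
rewrite -mulrA ler_pM2l// -powRM ?(ltW t_gt0)//.
rewrite /a -powR_mulrn ?powR_ge0// -powRrM mulrC powRrM powR_mulrn//.
rewrite ge0_ler_powR ?nnegrE ?(ltW h)//; first by lra.
by pos.
Qed.

(** Marcinkiewicz interpolation between the weak type bound and the trivial bound for bounded
    functions, at dyadic levels. The measurable [Psi] stands for the q-th power of the maximal
    function. Only the levels 2^k with k >= 0 are used, and averages below 1 are absorbed by the
    added 1. *)
Lemma maximal_strong_type (q : R) : 1 < q -> exists2 K : R, 0 < K &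
  forall h : X -> R, measurable_fun setT h -> (forall x, 0 <= h x) ->
  (\int[mu]_x (h x)%:E < +oo)%E ->
  exists Psi : X -> \bar R, [/\ measurable_fun setT Psi,
    (forall x, 0 <= Psi x)%E,
    (\int[mu]_x Psi x <= K%:E * \int[mu]_x ((h x) `^ q)%:E)%E &
    forall x r, 0 < r ->
     (((fine (\int[mu]_(y in B x r) (h y)%:E) / bm x r) `^ q)%:E <=
        K%:E * (1 + Psi x))%E].
Proof.
move=> q1; have [b [C [C0 b0 bP]]] := countable_balls.
have [K1 K10 weak] := weak_type; have [K2 K20 geo] := geometric_cutoff_sum q1.
have [q0 qn0] : 0 < q /\ q != 0 by split; [lra|rewrite gt_eqF//; lra].
pose K3 := 2 `^ q * (K1 * 2) * K2.
have K30 : 0 < K3 by rewrite /K3; pos.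
exists (K3 + C `^ q); first by pos.
move=> h mh h0 hy.
have mhE : measurable_fun setT (fun x => (h x)%:E) by exact/measurable_EFinP.
have hE0 x : (0 <= (h x)%:E)%E by rewrite lee_fin.
pose E k := level_set b h (2 ^+ k).
have mE k : measurable (E k) by exact: level_set_measurable.
pose c k : R := (2 ^+ k.+1) `^ q.
have c_ge0 k : 0 <= c k by exact: powR_ge0.
pose Psi x := (\sum_(0 <= k <oo) (c k * \1_(E k) x)%:E)%E.
have m1 k : measurable_fun setT (fun x => (c k * \1_(E k) x)%:E).
  apply/measurable_EFinP; apply: measurable_funM => //.
have p1 k x : (0 <= (c k * \1_(E k) x)%:E)%E by rewrite lee_fin mulr_ge0.
pose hk k x := if 2 ^+ k < 2 * h x then h x else 0.
have mhk k : measurable_fun setT (hk k).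
  apply: measurable_fun_ifT => //.
  by apply: measurable_fun_ltr => //; exact: measurable_funM.
have hk0 k x : 0 <= hk k x by rewrite /hk; case: ifP.
(* Since h is at most its truncation plus 2^k / 2, a ball on which h has average above 2^k leaves
   the truncation an average above 2^k / 2. *)
have Ek k : (mu (E k) <= (K1 * 2 / 2 ^+ k)%:E * \int[mu]_x (hk k x)%:E)%E.
  have sub : E k `<=` level_set b (hk k) (2 ^+ k / 2).
    move=> x [j /= Pj xj]; exists j => //=.
    have := bd_massE H (b j).1 (b j).2.
    set Bj := B _ _ in Pj *; set mj := bm _ _ in Pj * => mjE.
    have mBj : measurable Bj by exact: mB.
    have : (\int[mu]_(x in Bj) (h x)%:E <=
        \int[mu]_(x in Bj) ((hk k x)%:E + (2 ^+ k / 2)%:E))%E.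
      apply: ge0_le_integral => //.
      - by apply: measurable_funTS.
      - by apply: measurable_funTS; apply: emeasurable_funD => //; exact/measurable_EFinP.
      - move=> y _; rewrite -EFinD lee_fin /hk; case: ifPn => [_|]; first by rewrite lerDl; pos.
        by rewrite -leNgt add0r => hh; rewrite ler_pdivlMr// mulrC.
    rewrite ge0_integralD//; first last.
    - by apply: measurable_funTS; exact/measurable_EFinP.
    - by move=> y _; rewrite lee_fin.
    rewrite integral_cst// -mjE => le1.
    have := lt_le_trans Pj le1.
    have -> : ((2 ^+ k * mj)%:E = (2 ^+ k / 2 * mj)%:E + (2 ^+ k / 2 * mj)%:E)%E.
      by rewrite -EFinD; congr EFin; field.
    by rewrite -EFinM lteD2rE.
  apply: (@le_trans _ _ (mu (level_set b (hk k) (2 ^+ k / 2)))).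
    by apply: le_measure; rewrite ?inE//; exact: level_set_measurable.
  have -> : K1 * 2 / 2 ^+ k = K1 / (2 ^+ k / 2).
    by field; rewrite expf_eq0/= pnatr_eq0 andbF.
  apply: weak => //; pos.
exists Psi; split.
- apply: (@ge0_emeasurable_sum _ _ _ _ _ xpredT) => //.
- by move=> x; apply: nneseries_ge0.
- rewrite integral_nneseries//.
  apply: (@le_trans _ _ (K3%:E * \int[mu]_x ((h x) `^ q)%:E)%E); last first.
    apply: lee_wpmul2r; last by rewrite lee_fin lerDl; pos.
    by apply: integral_ge0 => x _; rewrite lee_fin powR_ge0.
  have step k : (\int[mu]_x (c k * \1_(E k) x)%:E <=
      \int[mu]_x (2 `^ q * (K1 * 2) * ((2 `^ (q - 1)) ^+ k * hk k x))%:E)%E.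
    under eq_integral do rewrite EFinM.
    rewrite ge0_integralZl_EFin//; last exact/measurable_EFinP.
    rewrite integral_indic// setIT.
    under [leRHS]eq_integral do rewrite mulrA EFinM.
    rewrite ge0_integralZl_EFin//; last 3 first.
    + by move=> x _; rewrite lee_fin.
    + exact/measurable_EFinP.
    + by pos.
    apply: (@le_trans _ _ ((c k)%:E * ((K1 * 2 / 2 ^+ k)%:E * \int[mu]_x (hk k x)%:E))%E).
      by apply: lee_wpmul2l; [rewrite lee_fin|exact: Ek].
    rewrite muleA -EFinM; apply: lee_wpmul2r.
      by apply: integral_ge0 => x _; rewrite lee_fin.
    rewrite lee_fin le_eqVlt; apply/orP; left; apply/eqP.
    have tk : (2 ^+ k : R) != 0 by rewrite expf_eq0/= pnatr_eq0 andbF.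
    rewrite /c exprS powRM ?exprn_ge0//.
    rewrite -[(2 `^ (q - 1)) ^+ k]powR_mulrn ?powR_ge0// -powRrM (mulrC (q - 1)).
    rewrite powRrM powR_mulrn// powRB; last by rewrite tk implybT.
    rewrite powRr1 ?exprn_ge0//.
    by field.
  apply: le_trans (_ : (\sum_(0 <= k <oo) \int[mu]_x
      (2 `^ q * (K1 * 2) * ((2 `^ (q - 1)) ^+ k * hk k x))%:E <= _)%E).
    by apply: lee_nneseries => [k _ _|k _]; [exact: integral_ge0|exact: step].
  have m2 k : measurable_fun setT (fun x =>
      (2 `^ q * (K1 * 2) * ((2 `^ (q - 1)) ^+ k * hk k x))%:E).
    by apply/measurable_EFinP; apply: measurable_funM => //; exact: measurable_funM.
  have p2 k x : (0 <= (2 `^ q * (K1 * 2) * ((2 `^ (q - 1)) ^+ k * hk k x))%:E)%E.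
    by rewrite lee_fin; have := hk0 k x => ?; pos.
  rewrite -integral_nneseries//.
  rewrite -ge0_integralZl_EFin ?(ltW K30)//; first last.
  + apply/measurable_EFinP; exact: measurable_powR2.
  + by move=> x _; rewrite lee_fin powR_ge0.
  apply: ge0_le_integral => //.
  + by move=> x _; apply: nneseries_ge0.
  + exact: (@ge0_emeasurable_sum _ _ _ _ _ xpredT).
  + apply: measurable_funeM; apply/measurable_EFinP; exact: measurable_powR2.
  move=> x _; apply: lime_le; first by apply: is_cvg_nneseries.
  apply: nearW => n; rewrite sumEFin lee_fin big_mkord -mulr_sumr.
  rewrite /K3 -[leRHS]mulrA ler_wpM2l//; first by pos.
  exact: geo.
move=> x r r0; have [j [sub bj]] := bP x r r0.
set mj := bm (b j).1 (b j).2 in bj; set Bj := B (b j).1 (b j).2 in sub.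
have mj0 : 0 < mj by apply: (bd_mass_gt0 H); exact: b0.
have mr0 := bd_mass_gt0 H x r0.
have mBj : measurable Bj by exact: mB.
have fin S : measurable S -> (\int[mu]_(y in S) (h y)%:E)%E \is a fin_num.
  move=> mS; rewrite ge0_fin_numE; last by apply: integral_ge0.
  by apply: le_lt_trans hy; apply: ge0_subset_integral.
pose a := fine (\int[mu]_(y in Bj) (h y)%:E) / mj.
have a0 : 0 <= a by rewrite /a divr_ge0 ?(ltW mj0)//; apply: fine_ge0; apply: integral_ge0.
have avg : fine (\int[mu]_(y in B x r) (h y)%:E) / bm x r <= C * a.
  rewrite ler_pdivrMr// /a.
  apply: (@le_trans _ _ (fine (\int[mu]_(y in Bj) (h y)%:E))).
    apply: fine_le; [exact: fin|exact: fin|].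
    by apply: ge0_subset_integral => //; exact: measurable_funTS.
  have -> : C * (fine (\int[mu]_(y in Bj) (h y)%:E) / mj) * bm x r =
    fine (\int[mu]_(y in Bj) (h y)%:E) * (C * bm x r / mj) by ring.
  apply: ler_peMr; first by apply: fine_ge0; apply: integral_ge0.
  by rewrite ler_pdivlMr// mul1r.
apply: (@le_trans _ _ ((C `^ q * a `^ q)%:E)).
  rewrite lee_fin -powRM ?(ltW C0)// ge0_ler_powR ?nnegrE ?(ltW q0)//.
  + by rewrite divr_ge0 ?(ltW mr0)//; apply: fine_ge0; apply: integral_ge0.
  + by pos.
rewrite EFinM; apply: (@le_trans _ _ ((C `^ q)%:E * (1 + Psi x))%E); last first.
  apply: lee_wpmul2r; last by rewrite lee_fin; lra.
  by apply: adde_ge0 => //; apply: nneseries_ge0.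
apply: lee_wpmul2l; first by rewrite lee_fin powR_ge0.
have [a1|a1] := leP a 1.
  apply: (@le_trans _ _ 1%E); last by rewrite leeDl//; apply: nneseries_ge0.
  rewrite lee_fin; have := @ge0_ler_powR R q (ltW q0) a 1.
  by rewrite powR1 !nnegrE; apply.
(* The dyadic level just below the average [a]. The point [x] lies in [E k], so [Psi x] contains the
   term (2^(k+1))^q, which is at least a^q. *)
have [k [k1 k2]] : exists k, 2 ^+ k < a /\ a <= 2 ^+ k.+1.
  have exP : exists k, a <= 2 ^+ k.
    exists (Num.truncn a).+1; apply: (le_trans (ltW (truncnS_gt a))).
    by rewrite -natrX ler_nat ltnW// ltn_expl.
  case: (ex_minnP exP) => -[|k] ak kmin.
    by move: ak; rewrite expr0 leNgt a1.
  exists k; split => //; rewrite ltNge; apply/negP => /kmin; by rewrite ltnn.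
have xE : E k x.
  exists j; last by apply: sub; rewrite /= /qball/= dxx.
  rewrite /= -(fineK (fin _ mBj)) lte_fin -/mj -ltr_pdivlMr//.
apply: (@le_trans _ _ (c k)%:E).
  by rewrite lee_fin /c ge0_ler_powR ?nnegrE ?(ltW q0)//; pos.
apply: (@le_trans _ _ (Psi x)); last by rewrite leeDr.
rewrite /Psi (nneseries_split 0 k.+1)//.
rewrite add0n big_nat_recr//=.
rewrite indicE mem_set// mulr1.
rewrite -[leLHS]adde0; apply: leeD; last exact: nneseries_ge0.
by rewrite leeDr// sume_ge0.
Qed.

End maximal.

(** * Variable exponents *)

Section oscillation.
Context {R : realType}.

Lemma powR_le_pow (x1 x e b : R) : 1 <= x -> x <= x1 -> `|e| <= b ->
  x `^ e <= x1 `^ b.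
Proof.
move=> x_ge1 xx1 eb; apply: (le_trans (powR_le_norm e x_ge1 xx1)).
by rewrite ler_powR// (le_trans x_ge1).
Qed.

(* At dyadic scale [n] the exponent oscillates by [A / n.+1], which just
   compensates quantities growing geometrically in [n]. *)
Lemma powR_oscillation (C0 A lam e : R) n : 1 <= C0 ->
  (C0 ^+ n.+1)^-1 <= lam -> lam <= C0 ^+ n.+1 -> `|e| <= A / n.+1%:R ->
  lam `^ e <= C0 `^ A.
Proof.
move=> C01 l1 l2 eA.
have C00 : 0 < C0 by lra.
have lam0 : 0 < lam by apply: lt_le_trans l1; pos.
have E : (C0 ^+ n.+1) `^ (A / n.+1%:R) = C0 `^ A.
  rewrite -powR_mulrn ?(ltW C00)// -powRrM mulrC divfK//.
have [lam1|lam1] := leP 1 lam.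
  by rewrite -E; apply: powR_le_pow.
rewrite -E -[lam]invrK powR_invr; last by pos.
apply: powR_le_pow; last by rewrite normrN.
  by rewrite invf_ge1// ltW.
by rewrite invf_ple ?posrE//; pos.
Qed.

End oscillation.

Section variable_exponent_ball.
Context {R : realType} {disp : measure_display} {X : measurableType disp}.
Context (dist : X -> X -> R) (mu : {measure set X -> \bar R}) (D c0 Cd : R)
  (H : bounded_doubling dist mu D c0 Cd).
Local Notation B := (qball dist).
Local Notation bm := (mass dist mu).

(** Log-Hoelder continuity read at dyadic scales, where ln(1 / d) is of order n. The shift to [n.+1]
    makes scale 0 a plain bound on the global oscillation. *)
Record dyadic_exponent (p : X -> R) (pm pM A : R) : Prop := DyadicExponent {
  de_measurable : measurable_fun setT p ;
  de_min : forall x, pm <= p x ;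
  de_max : forall x, p x <= pM ;
  de_osc : forall n x y, dist x y < D / 2 ^+ n ->
    `|p x - p y| <= A / n.+1%:R }.

Lemma log_exponent_dyadic p : is_log_exponent dist p ->
  exists pm pM A, 1 < pm /\ dyadic_exponent p pm pM A.
Proof.
move=> [mp p1 p2 [A A0 pA]]; have D0 := bd_D H.
have x0 : X by exact: point.
have [pm pm1 pmP] : exists2 pm : R, 1 < pm & forall x, pm <= p x.
  have pmx x : (ereal_inf [set (p x)%:E | x in setT] <= (p x)%:E)%E.
    by apply: ereal_inf_lbound; exists x.
  move: p1 pmx; case: (ereal_inf _) => [r| |]//=.
    by rewrite lte_fin => r1 rx; exists r => // x; rewrite -lee_fin.
  by move=> _ /(_ x0).
have [pM pMP] : exists pM : R, forall x, p x <= pM.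
  have pmx x : ((p x)%:E <= ereal_sup [set (p x)%:E | x in setT])%E.
    by apply: ereal_sup_ubound; exists x.
  move: p2 pmx; case: (ereal_sup _) => [r| |]//=.
    by move=> _ rx; exists r => // x; rewrite -lee_fin.
  by move=> _ /(_ x0).
have pM0 : 0 < pM by have := pmP x0; have := pMP x0; lra.
have [n1 n1P] : exists n1, D <= 2 ^+ n1.
  exists (Num.truncn D).+1; apply: (le_trans (ltW (truncnS_gt D))).
  by rewrite -natrX ler_nat ltnW// ltn_expl.
have ln20 : 0 < ln 2 :> R by rewrite ln_gt0//; lra.
(* The second summand pays for the coarse scales n <= 2 n1, where only the trivial oscillation bound
   [pM] is at hand. At finer scales d < 2^-(n - n1) and n + 1 <= 2 (n - n1), and the logarithmic
   condition produces the first summand. *)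
pose A' := 2 * A / ln 2 + pM * (2 * n1 + 1)%:R.
exists pm, pM, A'; split => //; split => // n x y dxy.
rewrite ler_pdivlMr//.
have A1 : 0 <= 2 * A / ln 2 by pos.
have A2 : 0 <= pM * (2 * n1 + 1)%:R by pos.
have osc : `|p x - p y| <= pM.
  by rewrite ler_norml; have := pmP x; have := pmP y; have := pMP x; have := pMP y; lra.
have [nn|nn] := leqP n.+1 (2 * n1 + 1)%N.
  apply: (@le_trans _ _ (pM * (2 * n1 + 1)%:R)); last by rewrite lerDr.
  by rewrite ler_pM// ler_nat.
have [xy|xy] := eqVneq x y.
  by rewrite xy subrr normr0 mul0r addr_ge0.
have d0 : 0 < dist x y.
  rewrite lt_neqAle (qdist_ge0 (bd_quasi H)) andbT eq_sym; apply/eqP => h.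
  by move/eqP: xy; apply; exact/(qdist_eq0 (bd_quasi H)).
have n1n : (n1 <= n)%N by move: nn; clear; lia.
pose k := (n - n1)%N.
have dk : dist x y < (2 ^+ k)^-1.
  apply: (lt_le_trans dxy); rewrite ler_pdivrMr; last by pos.
  have -> : (2 : R) ^+ n = 2 ^+ k * 2 ^+ n1.
    by rewrite -exprD subnK.
  by rewrite mulKf// expf_eq0/= pnatr_eq0 andbF.
have k1 : (1 <= k)%N by rewrite /k; move: nn; clear; lia.
have kn : (n.+1 <= 2 * k)%N by rewrite /k; move: nn; clear; lia.
have d12 : dist x y <= 1 / 2.
  apply: (le_trans (ltW dk)); rewrite div1r lef_pV2 ?posrE; [|by pos|by pos].
  by rewrite -[leLHS]expr1 ler_eXn2l// ltr1n.
have lnd : k%:R * ln 2 <= ln (1 / dist x y).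
  rewrite mulr_natl -lnXn// ler_ln ?posrE; [|by pos|by pos].
  by rewrite div1r ltW// invf_pgt ?posrE//; pos.
have kln : 0 < k%:R * ln 2 :> R by rewrite mulr_gt0// ltr0n.
apply: (@le_trans _ _ (2 * A / ln 2)); last by rewrite lerDl.
apply: (@le_trans _ _ (A / (k%:R * ln 2) * n.+1%:R)).
  rewrite ler_wpM2r//; apply: (le_trans (pA x y d0 d12)).
  by rewrite ler_pM2l// lef_pV2 ?posrE// (lt_le_trans kln).
have -> : A / (k%:R * ln 2) * n.+1%:R = A / ln 2 * (n.+1%:R / k%:R).
  by rewrite invfM; ring.
have -> : 2 * A / ln 2 = A / ln 2 * 2 by ring.
rewrite ler_wpM2l//; first by pos.
by rewrite ler_pdivrMr ?ltr0n// -natrM ler_nat.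
Qed.

(* Splitting at height [lam] replaces Jensen's inequality. *)
Lemma integral_split (S : set X) (g s : X -> R) (lam K s0 : R) :
  measurable S -> measurable_fun setT g -> measurable_fun setT s ->
  (forall x, 0 <= g x) -> (forall x, 1 <= s x) -> 0 < lam -> 0 <= K ->
  (forall y, S y -> lam `^ (s0 - s y) <= K) ->
  (\int[mu]_(y in S) (g y)%:E <=
    lam%:E * mu S + (K * lam `^ (1 - s0))%:E * \int[mu]_(y in S) (g y `^ s y)%:E)%E.
Proof.
move=> mS mg ms g0 s1 lam0 K0 lamK.
have mgs : measurable_fun S (fun y => (g y `^ s y)%:E).
  by apply: measurable_funTS; apply/measurable_EFinP; exact: measurable_powR2.
have k0 : 0 <= K * lam `^ (1 - s0) by pos.
rewrite -integral_cst// -ge0_integralZl_EFin//.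
rewrite -ge0_integralD//; first last.
- exact: measurable_funeM.
- by move=> y _; apply: mule_ge0; rewrite lee_fin ?powR_ge0.
- by move=> y _; rewrite lee_fin ltW.
apply: ge0_le_integral => //.
- by move=> y _; rewrite lee_fin.
- by apply: measurable_funTS; exact/measurable_EFinP.
- by apply: emeasurable_funD => //; exact: measurable_funeM.
move=> y Sy; rewrite -EFinM -EFinD lee_fin.
have [gl|lg] := leP (g y) lam; first by rewrite ler_wpDr//; pos.
apply: ler_wpDl; first exact: ltW.
have gy0 : 0 < g y by exact: lt_trans lg.
(* Above height [lam] the exponent 1 - s(y) is nonpositive, so g^(1 - s(y)) <= lam^(1 - s(y)), and
   the hypothesis exchanges s(y) for [s0]. *)
have e1 : g y = g y `^ (1 - s y) * g y `^ s y.
  rewrite -powRD; last by rewrite (gt_eqF gy0) implybT.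
  by rewrite subrK powRr1// ltW.
rewrite [leLHS]e1 ler_pM2r; last by pos.
have e2 : lam `^ (1 - s y) <= K * lam `^ (1 - s0).
  have -> : 1 - s y = (s0 - s y) + (1 - s0) by ring.
  rewrite powRD; last by rewrite (gt_eqF lam0) implybT.
  by rewrite ler_pM2r ?lamK//; pos.
apply: le_trans e2.
rewrite -[1 - s y]opprB !powRN lef_pV2 ?posrE; [|by pos|by pos].
by rewrite ge0_ler_powR ?nnegrE ?(ltW lam0) ?(ltW gy0) ?(ltW lg)// subr_ge0.
by move=> y _; rewrite lee_fin powR_ge0.
Qed.

Lemma dyadic_scale (x : X) (r : R) : 0 < r -> exists n,
  (forall y, B x r y -> dist x y < D / 2 ^+ n) /\ D / 2 ^+ n.+1 <= r.
Proof.
move=> r0; have D0 := bd_D H.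
have [Dr|rD] := leP D r.
  exists 0%N; split; first by move=> y _; rewrite expr0 divr1; exact: bd_lt H x y.
  by rewrite expr1; lra.
have [n [h1 h2]] := geometric_bracket (ltac:(lra) : 0 < 2^-1 :> R)
  (ltac:(lra) : 2^-1 < 1 :> R) r0 (ltW rD).
exists n; split; last by move: h1; rewrite exprVn mulrC => /ltW.
by move=> y; rewrite /qball/= => h; move: h2; rewrite exprVn mulrC; exact: lt_le_trans.
Qed.

(** A Jensen inequality for a variable exponent, up to an additive 1. The height is chosen with
    lam^s(x) = 1 + I / mu(B): the 1 makes lam >= 1, doubling bounds lam by C0^(n+1), and the
    oscillation of [s] over the ball then costs only C0^A. *)
Lemma ball_average_power (s : X -> R) (sM A I0 : R) : 0 <= A -> 0 < I0 ->
  dyadic_exponent s 1 sM A -> exists2 K : R, 0 < K &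
  forall g : X -> R, measurable_fun setT g -> (forall x, 0 <= g x) ->
  (\int[mu]_x (g x `^ s x)%:E <= I0%:E)%E -> forall x r, 0 < r ->
  (fine (\int[mu]_(y in B x r) (g y)%:E) / bm x r) `^ s x <=
    K * (1 + fine (\int[mu]_(y in B x r) (g y `^ s y)%:E) / bm x r).
Proof.
move=> A0 I00 [ms s1 s2 sosc].
have x0 : X by exact: point.
have M0 := bd_mass_gt0 H x0 (bd_D H); set M := bm x0 D in M0.
have Cd1 := bd_Cd H; have Cd0 : 0 < Cd by lra.
pose C0 := (1 + I0 / M) * Cd.
have IM : 0 < I0 / M by pos.
have C01 : 1 <= C0.
  by rewrite /C0 -[leLHS]mulr1 ler_pM//; lra.
have C00 : 0 < C0 by lra.
pose K1 := 1 + C0 `^ A.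
have K11 : 1 <= K1 by rewrite /K1 lerDl; pos.
have K10 : 0 < K1 by lra.
exists (K1 `^ sM); first by pos.
move=> g mg g0 gI x r r0.
have [n [nB nr]] := dyadic_scale x r0.
have mr0 := bd_mass_gt0 H x r0.
have mBr := bd_measurable H x r.
have mgs : measurable_fun setT (fun y => (g y `^ s y)%:E).
  by apply/measurable_EFinP; exact: measurable_powR2.
have leI : (\int[mu]_(y in B x r) (g y `^ s y)%:E <= I0%:E)%E.
  apply: le_trans gI; apply: ge0_subset_integral => //.
  by move=> y _; rewrite lee_fin powR_ge0.
have geI : (0 <= \int[mu]_(y in B x r) (g y `^ s y)%:E)%E.
  by apply: integral_ge0 => y _; rewrite lee_fin powR_ge0.
have IE : (\int[mu]_(y in B x r) (g y `^ s y)%:E)%E =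
    (fine (\int[mu]_(y in B x r) (g y `^ s y)%:E)%E)%:E.
  by rewrite fineK// ge0_fin_numE// (le_lt_trans leI)// ltry.
set I := fine (\int[mu]_(y in B x r) (g y `^ s y)%:E)%E in IE *.
have I_ge0 : 0 <= I by rewrite -lee_fin -IE.
have I_le : I <= I0 by rewrite -lee_fin -IE.
pose Lam := 1 + I / bm x r.
have Lam1 : 1 <= Lam by rewrite /Lam lerDl; pos.
have Lam0 : 0 < Lam by lra.
have LamC : Lam <= C0 ^+ n.+1.
  have mr : M / Cd ^+ n.+1 <= bm x r.
    rewrite ler_pdivrMr; last by pos.
    rewrite mulrC; apply: (le_trans (mass_dyadic H x x0 n.+1)).
    by rewrite ler_pM2l; [exact: (mass_le H)|pos].
  apply: (@le_trans _ _ (1 + I0 / M * Cd ^+ n.+1)).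
    rewrite lerD2l -mulrA; apply: ler_pM => //; first by rewrite invr_ge0 ltW.
    rewrite -[leRHS]invrK lef_pV2 ?posrE//; last by pos.
    by rewrite invfM invrK.
  have Cdn : 1 <= Cd ^+ n.+1 by rewrite exprn_ege1.
  rewrite /C0 exprMn; apply: (@le_trans _ _ ((1 + I0 / M) * Cd ^+ n.+1)).
    by rewrite mulrDl mul1r lerD2r.
  rewrite ler_pM2r; last by pos.
  rewrite exprS ler_peMr//; first lra.
  by rewrite exprn_ege1//; lra.
have sx0 : 0 < s x by have := s1 x; lra.
pose lam := Lam `^ (s x)^-1.
have lamE : lam `^ s x = Lam by rewrite /lam -powRrM mulVf ?gt_eqF// powRr1// ltW.
have lam1 : 1 <= lam by rewrite /lam -[leLHS](powRr0 Lam) ler_powR// invr_ge0 ltW.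
have lam0 : 0 < lam by lra.
have lamL : lam <= Lam by rewrite /lam ler1_powR// invf_le1.
have osc y : B x r y -> lam `^ (s x - s y) <= C0 `^ A.
  move=> /nB/sosc; apply: powR_oscillation => //.
    apply: le_trans lam1; rewrite invf_le1 ?exprn_ege1//; pos.
  exact: le_trans LamC.
have := integral_split mBr mg ms g0 s1 lam0 (powR_ge0 C0 A) osc.
rewrite IE -(bd_massE H) -!EFinM -EFinD.
have -> : lam * bm x r + C0 `^ A * lam `^ (1 - s x) * I =
    lam * bm x r + C0 `^ A * lam * (I / Lam).
  rewrite powRB; last by rewrite (gt_eqF lam0) implybT.
  rewrite powRr1 ?(ltW lam0)// lamE; ring.
move=> hI.
have ILam : I / Lam <= bm x r.
  rewrite ler_pdivrMr// /Lam mulrDr mulr1 mulrC divfK ?gt_eqF//.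
  by rewrite lerDr ltW.
have Ig0 : (0 <= \int[mu]_(y in B x r) (g y)%:E)%E.
  by apply: integral_ge0 => y _; rewrite lee_fin.
have favg : fine (\int[mu]_(y in B x r) (g y)%:E) <= K1 * lam * bm x r.
  apply: (@le_trans _ _ (lam * bm x r + C0 `^ A * lam * (I / Lam))).
    rewrite -lee_fin fineK// ge0_fin_numE// (le_lt_trans hI)// ltry//.
  rewrite /K1 mulrDl mul1r mulrDl lerD2l ler_wpM2l//; pos.
apply: (@le_trans _ _ ((K1 * lam) `^ s x)).
  apply: ge0_ler_powR; rewrite ?nnegrE.
  - exact: ltW.
  - by rewrite divr_ge0 ?(ltW mr0)// fine_ge0.
  - by pos.
  - by rewrite ler_pdivrMr.
rewrite powRM ?(ltW K10) ?(ltW lam0)// lamE ler_pM2r//.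
by rewrite ler_powR.
Qed.

Lemma powR_addn_le (a b q : R) : 0 <= a -> 0 <= b -> 0 <= q ->
  (a + b) `^ q <= 2 `^ q * (a `^ q + b `^ q).
Proof.
move=> a0 b0 q0.
have h x y : 0 <= x -> 0 <= y -> x <= y -> (x + y) `^ q <= 2 `^ q * (x `^ q + y `^ q).
  move=> x0 y0 xy; apply: (@le_trans _ _ ((2 * y) `^ q)).
    by rewrite ge0_ler_powR ?nnegrE//; [pos|pos|lra].
  by rewrite powRM// ler_wpM2l ?powR_ge0// lerDr powR_ge0.
have [ab|ba] := leP a b; first exact: h.
by rewrite addrC [_ `^ q + _]addrC; apply: h => //; exact: ltW.
Qed.

(** The exponent factors as p = s pm with s >= 1. Averages of g to the power s are controlled by
    averages of g^s, and the remaining constant exponent [pm] is greater than 1, so the strong type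
    bound applies to g^s. *)
Lemma maximal_modular (p : X -> R) (pm pM A : R) : 0 <= A -> 1 < pm ->
  dyadic_exponent p pm pM A -> exists2 K : R, 0 < K &
  forall g : X -> R, measurable_fun setT g -> (forall x, 0 <= g x) ->
  (\int[mu]_x (g x `^ p x)%:E <= 1)%E ->
  exists Psi : X -> \bar R, [/\ measurable_fun setT Psi,
    (forall x, 0 <= Psi x)%E, (\int[mu]_x Psi x <= K%:E)%E &
    forall x r, 0 < r ->
     (((fine (\int[mu]_(y in B x r) (g y)%:E) / bm x r) `^ p x)%:E <=
        K%:E * (1 + Psi x))%E].
Proof.
move=> A0 pm1 [mp pmP pMP posc].
have x0 : X by exact: point.
have pm0 : 0 < pm by lra.
pose s x := p x / pm.
have ms : measurable_fun setT s by apply: measurable_funM.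
have s1 x : 1 <= s x by rewrite /s ler_pdivlMr// mul1r.
have sE x : s x * pm = p x by rewrite /s divfK// gt_eqF.
have ds : dyadic_exponent s 1 (pM / pm) A.
  split => //; first by move=> x; rewrite ler_pM2r// invr_gt0.
  move=> n x y /posc; rewrite /s -mulrBl normrM [`|pm^-1|]gtr0_norm ?invr_gt0//.
  by apply: le_trans; rewrite ler_piMr// invf_le1// ltW.
have M0 := bd_mass_gt0 H x0 (bd_D H); set M := bm x0 D in M0.
have [K1 K10 h1] := ball_average_power A0 (ltac:(lra) : 0 < M + 1) ds.
have [K2 K20 h2] := maximal_strong_type H pm1.
exists (K2 + K1 `^ pm * 2 `^ pm * (1 + K2)); first by pos.
move=> g mg g0 gI.
have mh : measurable_fun setT (fun x => g x `^ s x) by exact: measurable_powR2.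
have mgp : measurable_fun setT (fun x => g x `^ p x) by exact: measurable_powR2.
have muX : mu setT = M%:E by rewrite (bd_massE H) (ball_full H).
have hI : (\int[mu]_x (g x `^ s x)%:E <= (M + 1)%:E)%E.
  apply: (@le_trans _ _ (\int[mu]_x (1%:E + (g x `^ p x)%:E))%E).
    apply: ge0_le_integral => //.
    - by move=> x _; rewrite lee_fin powR_ge0.
    - exact/measurable_EFinP.
    - by apply: emeasurable_funD => //; exact/measurable_EFinP.
    move=> x _; rewrite -EFinD lee_fin.
    have [g1|g1] := leP 1 (g x).
      apply: ler_wpDl => //; apply: ler_powR => //.
      by rewrite /s ler_pdivrMr// ler_peMr ?(ltW pm1)//; have := pmP x; lra.
    rewrite ler_wpDr ?powR_ge0//; have := @ge0_ler_powR R (s x) _ (g x) 1.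
    by rewrite powR1 !nnegrE; apply => //; [have := s1 x; lra|exact: ltW].
  rewrite ge0_integralD//; first last.
  - exact/measurable_EFinP.
  - by move=> x _; rewrite lee_fin powR_ge0.
  by rewrite integral_cst// mul1e muX EFinD leeD2l.
have [Psi [mPsi Psi0 PsiI PsiP]] := h2 _ mh (fun x => powR_ge0 _ _)
  (le_lt_trans hI (ltry _)).
have Kge : K2 <= K2 + K1 `^ pm * 2 `^ pm * (1 + K2) by rewrite lerDl; pos.
exists Psi; split; [exact: mPsi|exact: Psi0| |].
  apply: (le_trans PsiI).
  have -> : (\int[mu]_x ((g x `^ s x) `^ pm)%:E = \int[mu]_x (g x `^ p x)%:E)%E.
    by apply: eq_integral => x _; rewrite -powRrM sE.
  apply: (@le_trans _ _ (K2%:E * 1)%E).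
    by apply: lee_wpmul2l => //; rewrite lee_fin ltW.
  by rewrite mule1 lee_fin.
move=> x r r0; have mr0 := bd_mass_gt0 H x r0.
have P1 := PsiP x r r0; have P2 := h1 g mg g0 hI x r r0.
set a := fine (\int[mu]_(y in B x r) (g y)%:E) / bm x r in P2 *.
set h := fine (\int[mu]_(y in B x r) (g y `^ s y)%:E) / bm x r in P1 P2.
have h_ge0 : 0 <= h.
  by rewrite /h divr_ge0 ?(ltW mr0)// fine_ge0// integral_ge0// => y _; rewrite lee_fin powR_ge0.
have a1 : a `^ p x <= K1 `^ pm * 2 `^ pm * (1 + h `^ pm).
  rewrite -sE powRrM; apply: (@le_trans _ _ ((K1 * (1 + h)) `^ pm)).
    by rewrite ge0_ler_powR ?nnegrE ?(ltW pm0) ?powR_ge0//; pos.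
  rewrite powRM ?(ltW K10)//; last by pos.
  rewrite -mulrA ler_pM2l; last by pos.
  by have := powR_addn_le ler01 h_ge0 (ltW pm0); rewrite powR1.
apply: (@le_trans _ _ (K1 `^ pm * 2 `^ pm * (1 + h `^ pm))%:E); first by rewrite lee_fin.
have one_le : (1 <= 1 + Psi x)%E by rewrite leeDl.
apply: (@le_trans _ _ ((K1 `^ pm * 2 `^ pm * (1 + K2))%:E * (1 + Psi x))%E).
  rewrite (EFinM _ (1 + h `^ pm)) (EFinM _ (1 + K2)) -muleA.
  apply: lee_wpmul2l; first by rewrite lee_fin; pos.
  rewrite !EFinD ge0_muleDl ?lee_fin ?(ltW K20)//.
  by apply: leeD; rewrite ?mul1e.
apply: lee_wpmul2r; first exact: le_trans one_le.
by rewrite lee_fin lerDr ltW.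
Qed.

End variable_exponent_ball.

(** * Dyadic annuli *)

Section geometric_kernel.
Context {R : realType}.

Definition absdiff (i j : nat) : nat := (i - j + (j - i))%N.

Lemma absdiffC i j : absdiff i j = absdiff j i.
Proof. by rewrite /absdiff addnC. Qed.

Lemma geometric_sum_bound (th : R) i n : 0 < th -> th < 1 ->
  \sum_(j < n) th ^+ absdiff i j <= 2 / (1 - th).
Proof.
move=> th0 th1; have t1 : 0 < 1 - th by lra.
have tn : 1 - th != 0 by rewrite gt_eqF.
have h1 k : (k <= i.+1)%N -> \sum_(j < k) th ^+ absdiff i j <= th ^+ (i.+1 - k) / (1 - th).
  elim: k => [_|k IH ki]; first by rewrite big_ord0; pos.
  rewrite big_ord_recr/=; apply: (le_trans (lerD (IH (ltnW ki)) (lexx _))).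
  have -> : absdiff i k = (i - k)%N by rewrite /absdiff; lia.
  have -> : (i.+1 - k = (i - k).+1)%N by lia.
  have -> : (i.+1 - k.+1 = i - k)%N by lia.
  by rewrite le_eqVlt exprS; apply/orP; left; apply/eqP; field.
have h2 k : \sum_(j < i.+1 + k) th ^+ absdiff i j <= (1 + th - th ^+ k.+1) / (1 - th).
  elim: k => [|k IH].
    by rewrite addn0 expr1 addrK; have := h1 i.+1 (leqnn _); rewrite subnn expr0.
  rewrite addnS big_ord_recr/=; apply: (le_trans (lerD IH (lexx _))).
  have -> : absdiff i (i.+1 + k) = k.+1 by rewrite /absdiff; lia.
  by rewrite le_eqVlt [in th ^+ k.+2]exprS; apply/orP; left; apply/eqP; field.
have [ni|ni] := leqP n i.+1.
  apply: (le_trans (h1 n ni)); rewrite ler_pM2r ?invr_gt0//.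
  have : th ^+ (i.+1 - n) <= 1 by rewrite exprn_ile1// ltW.
  lra.
have -> : n = (i.+1 + (n - i.+1))%N by lia.
apply: (le_trans (h2 _)); rewrite ler_pM2r ?invr_gt0//.
have : 0 < th ^+ (n - i.+1).+1 by pos.
lra.
Qed.

Lemma geometric_series_bound (th : R) i : 0 < th -> th < 1 ->
  (\sum_(0 <= j <oo) (th ^+ absdiff i j)%:E <= (2 / (1 - th))%:E)%E.
Proof.
move=> th0 th1; apply: lime_le.
  by apply: is_cvg_nneseries => j _ _; rewrite lee_fin exprn_ge0// ltW.
by apply: nearW => n; rewrite sumEFin lee_fin big_mkord; exact: geometric_sum_bound.
Qed.

(* A discrete Young inequality for the kernel [th ^ |i - j|], by splitting each
   term at height [lam]. *)
Lemma geometric_young (th q Ts : R) : 0 < th -> th < 1 -> 1 < q -> 0 < Ts ->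
  exists2 K : R, 0 < K & forall T : nat -> R, (forall j, 0 < T j) ->
  (\sum_(0 <= j <oo) (T j)%:E <= Ts%:E)%E ->
  exists Lam : nat -> R, [/\
    (forall i j, th ^+ absdiff i j * T j <= Lam i),
    (forall i, Lam i <= K),
    (\sum_(0 <= i <oo) (Lam i)%:E <= K%:E)%E &
    forall i, (\sum_(0 <= j <oo) (th ^+ absdiff i j * T j `^ q^-1)%:E <=
      (K * Lam i `^ q^-1)%:E)%E].
Proof.
move=> th0 th1 q1 Ts0.
have t1 : 0 < 1 - th by lra.
pose Th := 2 / (1 - th); have Th0 : 0 < Th by rewrite /Th; pos.
exists (Ts + Th * Ts + (Th + 1)); first by pos.
have ThTs : 0 < Th * Ts by pos.
move=> T T0 TTs.
have thle n : th ^+ n <= 1 by rewrite exprn_ile1// ltW.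
have thgt n : 0 < th ^+ n by pos.
have p i j : (0 <= (th ^+ absdiff i j * T j)%:E)%E.
  by rewrite lee_fin; have := T0 j => ?; pos.
have pT j : (0 <= (T j)%:E)%E by rewrite lee_fin ltW.
have Sle i : (\sum_(0 <= j <oo) (th ^+ absdiff i j * T j)%:E <= Ts%:E)%E.
  apply: le_trans TTs; apply: lee_nneseries => [j _ _|j _]; first exact: p.
  by rewrite lee_fin ler_piMl// ltW.
have Sfin i : (\sum_(0 <= j <oo) (th ^+ absdiff i j * T j)%:E)%E \is a fin_num.
  rewrite ge0_fin_numE; first exact: le_lt_trans (Sle i) (ltry _).
  exact: nneseries_ge0.
pose Lam i := fine (\sum_(0 <= j <oo) (th ^+ absdiff i j * T j)%:E)%E.
have LamE i : (Lam i)%:E = (\sum_(0 <= j <oo) (th ^+ absdiff i j * T j)%:E)%E.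
  by rewrite fineK.
have term i j : th ^+ absdiff i j * T j <= Lam i.
  rewrite -lee_fin LamE (nneseries_split 0 j.+1)// add0n big_nat_recr//=.
  rewrite -[leLHS]adde0; apply: leeD; last exact: nneseries_ge0.
  by rewrite leeDr// sume_ge0.
have Lam0 i : 0 < Lam i.
  by apply: lt_le_trans (term i i); have := T0 i => ?; pos.
exists Lam; split => //.
- move=> i; apply: (@le_trans _ _ Ts); first by rewrite -lee_fin LamE.
  by rewrite -addrA lerDl; pos.
- under eq_eseriesr do rewrite LamE.
  rewrite nneseries_interchange//.
  apply: (@le_trans _ _ (Th * Ts)%:E); last by rewrite lee_fin; lra.
  rewrite EFinM; apply: (@le_trans _ _ (Th%:E * \sum_(0 <= j <oo) (T j)%:E)%E); last first.
    by apply: lee_wpmul2l => //; rewrite lee_fin ltW.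
  rewrite -nneseriesZl//; apply: lee_nneseries => [j _ _|j _]; first exact: nneseries_ge0.
  under eq_eseriesr do rewrite mulrC EFinM.
  rewrite nneseriesZl; last by move=> i _; rewrite lee_fin ltW.
  rewrite muleC; apply: lee_wpmul2r => //.
  under eq_eseriesr do rewrite absdiffC.
  exact: geometric_series_bound.
(* At this height T_j^(1/q) <= lam + lam^(1-q) T_j. Summed against the kernel, the first term gives
   at most [Th * lam] and the second lam^(1-q) Lam_i, which equals lam. *)
move=> i; pose lam := Lam i `^ q^-1.
have lam0 : 0 < lam by rewrite /lam; have := Lam0 i => ?; pos.
have lamq : lam `^ q = Lam i.
  by rewrite /lam -powRrM mulVf ?powRr1 ?ltW// gt_eqF//; lra.
apply: (@le_trans _ _ (\sum_(0 <= j <oo) (lam%:E * (th ^+ absdiff i j)%:E +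
    (lam `^ (1 - q))%:E * (th ^+ absdiff i j * T j)%:E))%E).
  apply: lee_nneseries => [j _ _|j _].
    by rewrite lee_fin; pos.
  rewrite -!EFinM -EFinD lee_fin mulrC.
  have -> : lam * th ^+ absdiff i j + lam `^ (1 - q) * (th ^+ absdiff i j * T j) =
    (lam + lam `^ (1 - q) * T j) * th ^+ absdiff i j by ring.
  rewrite ler_pM2r//; have Tj := T0 j.
  have [tl|lt] := leP (T j `^ q^-1) lam; first by apply: ler_wpDr => //; pos.
  apply: ler_wpDl; first exact: ltW.
  set t := T j `^ q^-1 in lt *; have t0 : 0 < t by exact: lt_trans lt.
  have tq : T j = t `^ q by rewrite /t -powRrM mulVf ?powRr1 ?ltW// gt_eqF//; lra.
  rewrite tq; apply: (@le_trans _ _ (t `^ (1 - q) * t `^ q)).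
    rewrite -powRD; last by rewrite (gt_eqF t0) implybT.
    by rewrite subrK powRr1// ltW.
  rewrite ler_pM2r; last by pos.
  rewrite -[1 - q]opprB !powRN lef_pV2 ?posrE; [|by pos|by pos].
  by rewrite ge0_ler_powR ?nnegrE ?(ltW lam0) ?(ltW t0) ?(ltW lt)// subr_ge0 ltW.
rewrite nneseriesD; [|by move=> *; rewrite -EFinM lee_fin; pos|
  by move=> *; apply: mule_ge0 => //; rewrite lee_fin powR_ge0].
rewrite nneseriesZl; last by move=> j _; rewrite lee_fin ltW.
rewrite nneseriesZl//.
apply: (@le_trans _ _ (lam%:E * Th%:E + (lam `^ (1 - q))%:E * (Lam i)%:E)%E).
  apply: leeD; last by rewrite LamE.
  by apply: lee_wpmul2l; [rewrite lee_fin ltW|exact: geometric_series_bound].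
rewrite -!EFinM -EFinD lee_fin -lamq -powRD; last by rewrite (gt_eqF lam0) implybT.
rewrite subrK powRr1 ?(ltW lam0)// lamq -/lam.
have -> : lam * Th + lam = (Th + 1) * lam by ring.
by rewrite ler_pM2r// lerDr; lra.
Qed.

(** Absorbs a prefactor into the base, to reach the form of bound that [powR_oscillation]
    requires. *)
Lemma geometric_domination (a b : R) : 1 <= b -> exists2 C0 : R, 1 <= C0 &
  forall n, a * b ^+ n <= C0 ^+ n.+1.
Proof.
move=> b1; pose M := Num.max 1 a.
have M1 : 1 <= M by rewrite le_max lexx.
have aM : a <= M by rewrite le_max lexx orbT.
exists (M * b); first by rewrite -[leLHS]mulr1 ler_pM.
move=> n; rewrite exprMn; apply: (@le_trans _ _ (M * b ^+ n)).
  by rewrite ler_wpM2r// exprn_ge0//; lra.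
have bn : 1 <= b ^+ n by rewrite exprn_ege1.
apply: ler_pM; [by lra|by lra|rewrite exprS ler_peMr ?exprn_ege1//; lra|].
by rewrite exprS ler_peMl//; lra.
Qed.

End geometric_kernel.

Section dyadic_index.
Context {R : realType}.
Context (r0 : R) (r00 : 0 < r0).
Definition dyadic (j : nat) : R := r0 / 2 ^+ j.

Lemma dyadic_gt0 j : 0 < dyadic j. Proof. by rewrite /dyadic; pos. Qed.

Lemma dyadicS j : dyadic j = 2 * dyadic j.+1.
Proof. by rewrite /dyadic exprS; field; rewrite expf_eq0/= pnatr_eq0 andbF. Qed.

Lemma dyadic_le i j : (i <= j)%N -> dyadic j <= dyadic i.
Proof.
move=> ij; rewrite /dyadic ler_pM2l// lef_pV2 ?posrE; [|by pos|by pos].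
by rewrite ler_eXn2l// ltr1n.
Qed.

Lemma dyadic_ratio i j : (i <= j)%N -> dyadic j / dyadic i = 2^-1 ^+ (j - i).
Proof.
move=> ij; rewrite /dyadic exprVn; have -> : (2 : R) ^+ j = 2 ^+ (j - i) * 2 ^+ i.
  by rewrite -exprD subnK.
by field; rewrite !expf_eq0/= !pnatr_eq0 !andbF gt_eqF.
Qed.

(** Index 0 collects every t >= r0 / 2, without upper limit, and through the default value also
    every t <= 0. A positive index therefore means 0 < t < r0 / 2. *)
Definition dyadic_index (t : R) : nat :=
  xget 0%N [set j | dyadic j.+1 <= t /\ (j = 0%N \/ t < dyadic j)].

Lemma dyadic_indexP t : 0 < t -> dyadic (dyadic_index t).+1 <= t /\
  (dyadic_index t = 0%N \/ t < dyadic (dyadic_index t)).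
Proof.
move=> t0; suff : [set j | dyadic j.+1 <= t /\ (j = 0%N \/ t < dyadic j)] (dyadic_index t) by [].
have exP : exists j, dyadic j.+1 <= t.
  have [n nt] := @exprn_lt_exists R 2^-1 (t / r0) ltac:(lra) ltac:(lra) ltac:(pos).
  exists n; apply: (le_trans (dyadic_le (leqnSn n))).
  by rewrite /dyadic -exprVn mulrC ltW// -ltr_pdivlMr.
case: (ex_minnP exP) => j jt jmin.
apply: (@xgetI _ _ _ j); split => //.
case: j jt jmin => [|j] jt jmin; first by left.
by right; rewrite ltNge; apply/negP => /jmin; rewrite ltnn.
Qed.

Lemma dyadic_index_eq t j : dyadic j.+1 <= t -> t < dyadic j ->
  dyadic_index t = j.
Proof.
move=> jt tj; have t0 : 0 < t by exact: lt_le_trans (dyadic_gt0 _) jt.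
have [i1 i2] := dyadic_indexP t0; set i := dyadic_index t in i1 i2 *.
apply/eqP; rewrite eqn_leq; apply/andP; split; rewrite leqNgt; apply/negP => ij.
  case: i2 => [i0|ti]; first by rewrite i0 in ij.
  by have := dyadic_le ij; lra.
by have := dyadic_le ij; lra.
Qed.

Lemma dyadic_index_le0 t : t <= 0 -> dyadic_index t = 0%N.
Proof.
move=> t0; rewrite /dyadic_index; apply: xgetPN => j [jt _].
by have := dyadic_gt0 j.+1; lra.
Qed.

Lemma dyadic_index_pos t : (0 < dyadic_index t)%N ->
  [/\ 0 < t, dyadic (dyadic_index t).+1 <= t & t < dyadic (dyadic_index t)].
Proof.
move=> J0; have t0 : 0 < t.
  by rewrite ltNge; apply/negP => /dyadic_index_le0 J00; rewrite J00 in J0.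
have [h1 [h2|h2]] := dyadic_indexP t0; first by rewrite h2 in J0.
by split.
Qed.

End dyadic_index.

Section index_integral.
Context {R : realType} {disp : measure_display} {X : measurableType disp}.
Context (mu : {measure set X -> \bar R}) (J : X -> nat)
  (mJ : forall i, measurable (J @^-1` [set i])).

Lemma measurable_index (phi : nat -> R) : measurable_fun setT (phi \o J).
Proof.
move=> _ Y mY; rewrite setTI.
rewrite (_ : _ @^-1` _ = \bigcup_(i in [set i | Y (phi i)]) J @^-1` [set i]).
  by apply: bigcup_measurable => i _; exact: mJ.
apply/seteqP; split=> [x /= Yx|x [i /= Yi xi]]; first by exists (J x).
by rewrite /= xi.
Qed.

Lemma integral_index (phi : nat -> R) (f : X -> \bar R) :
  (forall i, 0 <= phi i) -> measurable_fun setT f -> (forall x, 0 <= f x)%E ->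
  (\int[mu]_x ((phi (J x))%:E * f x) =
   \sum_(0 <= i <oo) ((phi i)%:E * \int[mu]_(x in J @^-1` [set i]) f x))%E.
Proof.
move=> phi0 mf f0.
have cover : setT = \bigcup_i J @^-1` [set i].
  by apply/seteqP; split=> // x _; exists (J x).
rewrite [in LHS]cover ge0_integral_bigcup//.
- apply: eq_eseriesr => i _.
  rewrite -ge0_integralZl_EFin//; last exact: measurable_funTS.
  by apply: eq_integral => x /set_mem /= ->.
- rewrite -cover; apply: emeasurable_funM => //.
  by apply/measurable_EFinP; exact: measurable_index.
- by move=> x _; apply: mule_ge0 => //; rewrite lee_fin.
- apply/trivIsetP => i j _ _ ij; apply/seteqP; split=> // x [/= xi xj].
  by move: ij; rewrite -xi -xj eqxx.
Qed.

End index_integral.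

(** * The Hardy estimate at a point *)

Section weight_at_point.
Context {R : realType} {disp : measure_display} {X : measurableType disp}.
Context (dist : X -> X -> R) (mu : {measure set X -> \bar R}) (D c0 Cd : R)
  (H : bounded_doubling dist mu D c0 Cd).
Context (l : R) (l0 : 0 < l).
Local Notation bm := (mass dist mu).

(* [u j] stands for [w (dyadic r0 j)], normalised by [u 0 = 1]. *)
Record weight_at (r0 : R) (z : X) (q : R) (w : R -> R) (u : nat -> R)
    (th C : R) : Prop := WeightAt {
  wa_th0 : 0 < th ;
  wa_th1 : th < 1 ;
  wa_C : 1 <= C ;
  wa_u0 : u 0%N = 1 ;
  wa_u : forall j, 0 < u j ;
  wa_kernel : forall i j,
    u i / u j * (bm z (dyadic r0 j) / bm z (dyadic r0 (minn i j))) <=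
    C * th ^+ absdiff i j * (bm z (dyadic r0 j) / bm z (dyadic r0 i)) `^ q^-1 ;
  wa_cmp : forall t, 0 < t -> t <= l ->
    u (dyadic_index r0 t) <= C * w t /\ w t <= C * u (dyadic_index r0 t) ;
  wa_loc : forall s t, 0 < s -> s <= l -> 0 < t -> t <= l ->
    s <= 2 * c0 * t -> t <= 2 * c0 * s -> w s <= C * w t ;
  wa_null : mu [set z] = 0%E }.

Lemma weight_at_le r0 z q w u th C C' : (forall t, 0 < t -> t <= l -> 0 < w t) ->
  C <= C' -> weight_at r0 z q w u th C -> weight_at r0 z q w u th C'.
Proof.
move=> w0 CC [h1 h2 h3 h4 h5 h6 h7 h8 h9]; have C0 : 0 < C by lra.
split => //.
- by lra.
- move=> i j; apply: (le_trans (h6 i j)); rewrite -!mulrA ler_wpM2r//.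
  by rewrite mulr_ge0 ?powR_ge0// exprn_ge0// ltW.
- move=> t t0 tl; have [a b] := h7 t t0 tl; split.
    by apply: (le_trans a); rewrite ler_pM2r// w0.
  by apply: (le_trans b); rewrite ler_pM2r.
- move=> s t s0 sl t0 tl st ts; apply: (le_trans (h8 s t s0 sl t0 tl st ts)).
  by rewrite ler_pM2r// w0.
Qed.

(** The kernel inequality is a count of exponents. With x = 2^-|i-j|, the weight has a margin [e]
    over the critical exponents -m/q and m - m/q. The mass of balls is controlled only with exponent
    m - e/2, which consumes at most half of this margin; what remains is x^(e/2), that is [th] to
    the power |i-j|. *)
Lemma weight_at_exists (r0 : R) (z : X) (q : R) (w : R -> R) (m e : R) :
  0 < r0 -> r0 <= l -> 1 < q -> 0 < e -> e < m ->
  pow_between l w (- (m / q) + e) (m - m / q - e) ->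
  (forall L, 0 < L -> lower_pow L (bm z) (m - e / 2)) ->
  exists u th C, weight_at r0 z q w u th C.
Proof.
move=> r00 r0l q1 e0 em [w0 wlo whi] lpm.
have q0 : 0 < q by lra.
have rr0 j : 0 < dyadic r0 j := dyadic_gt0 r00 j.
have rrl j : dyadic r0 j <= l.
  apply: le_trans r0l; have := dyadic_le r00 (leq0n j).
  by rewrite {2}/dyadic expr0 divr1.
have wr j : 0 < w (dyadic r0 j) by exact: w0.
have iw0 : positive_on l (fun r => (w r)^-1) by move=> r r_0 rl; rewrite invr_gt0 w0.
have br j : 0 < bm z (dyadic r0 j) := bd_mass_gt0 H z (rr0 j).
pose u j := w (dyadic r0 j) / w (dyadic r0 0).
pose th : R := 2^-1 `^ (e / 2).
have half0 : 0 < 2^-1 :> R by lra.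
have th0 : 0 < th by rewrite /th; pos.
have th1 : th < 1.
  by rewrite /th /powR gt_eqF//= expR_lt1 pmulr_rlt0 ?ln_lt0 ?half0//; lra.
have thn n : (2^-1 ^+ n) `^ (e / 2) = th ^+ n.
  rewrite -(powR_mulrn n (ltW th0)) -(powR_mulrn n (ltW half0)) /th -!powRrM.
  by rewrite (mulrC (e / 2)).
have hn n x : e / 2 <= x -> (2^-1 ^+ n) `^ x <= th ^+ n.
  move=> ex; rewrite -thn ger_powR//; apply/andP; split; first by pos.
  by rewrite exprn_ile1//; lra.
have [C1 C10 P1] := wlo; have [C2 C20 P2] := whi.
have [C3 C30 P3] := lpm l l0.
have iq0 : 0 < q^-1 by pos.
have iq1 : q^-1 < 1 by rewrite invf_lt1.
have ker i j : u i / u j * (bm z (dyadic r0 j) / bm z (dyadic r0 (minn i j))) <=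
    (C2 * C3 `^ (1 - q^-1) + C1 * C3 `^ q^-1) * th ^+ absdiff i j *
    (bm z (dyadic r0 j) / bm z (dyadic r0 i)) `^ q^-1.
  have -> : u i / u j = w (dyadic r0 i) / w (dyadic r0 j).
    by rewrite /u; field; rewrite !gt_eqF.
  have K1 : 0 < C2 * C3 `^ (1 - q^-1) by pos.
  have K2 : 0 < C1 * C3 `^ q^-1 by pos.
  set b := (bm z (dyadic r0 j) / bm z (dyadic r0 i)).
  have b0 : 0 < b by rewrite /b divr_gt0.
  have T0 : 0 < th ^+ absdiff i j * b `^ q^-1 by pos.
  rewrite -[leRHS]mulrA mulrDl.
  (* For i <= j the mass ratio on the left is b, and its part b^(1 - 1/q) compensates the weight
     ratio. For j < i that mass ratio is 1, and instead b^(1/q) has to be bounded below. *)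
  have [ij|ji] := leqP i j.
    apply: (@le_trans _ _ (C2 * C3 `^ (1 - q^-1) * (th ^+ absdiff i j * b `^ q^-1))); last first.
      by rewrite lerDl; pos.
    have -> : absdiff i j = (j - i)%N by rewrite /absdiff; move: ij; clear; lia.
    have h2 := P2 _ _ (rr0 j) (dyadic_le r00 ij) (rrl i).
    have h3 := P3 _ _ (rr0 j) (dyadic_le r00 ij) (rrl i).
    rewrite dyadic_ratio// in h2 h3.
    set x := 2^-1 ^+ (j - i) in h2 h3.
    have x0 : 0 < x by rewrite /x; pos.
    have h2' : w (dyadic r0 i) / w (dyadic r0 j) <= C2 * x `^ (- (m - m / q - e)).
      by rewrite mulrC -ler_pdivlMr.
    have h3' : b <= C3 * x `^ (m - e / 2) by rewrite /b ler_pdivrMr.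
    have bE : b = b `^ (1 - q^-1) * b `^ q^-1.
      by rewrite -powRD ?(gt_eqF b0) ?implybT// subrK powRr1// ltW.
    have h4 : b `^ (1 - q^-1) <= C3 `^ (1 - q^-1) * x `^ ((m - e / 2) * (1 - q^-1)).
      rewrite powRrM -powRM ?powR_ge0 ?(ltW C30)// ge0_ler_powR ?nnegrE ?(ltW b0)//.
        by rewrite subr_ge0 ltW.
      by pos.
    rewrite -/b {1}bE; apply: (@le_trans _ _ (C2 * x `^ (- (m - m / q - e)) *
       ((C3 `^ (1 - q^-1) * x `^ ((m - e / 2) * (1 - q^-1))) * b `^ q^-1))).
      apply: ler_pM => //; [by rewrite divr_ge0// ltW|by pos|].
      by rewrite ler_pM2r//; pos.
    have -> : C2 * x `^ (- (m - m / q - e)) *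
        (C3 `^ (1 - q^-1) * x `^ ((m - e / 2) * (1 - q^-1)) * b `^ q^-1) =
      C2 * C3 `^ (1 - q^-1) * (x `^ (- (m - m / q - e) + (m - e / 2) * (1 - q^-1)) * b `^ q^-1).
      by rewrite (@powRD _ x (- (m - m / q - e))) ?(gt_eqF x0) ?implybT//; ring.
    rewrite ler_pM2l// ler_pM2r; last by pos.
    apply: hn.
    have -> : - (m - m / q - e) + (m - e / 2) * (1 - q^-1) = e - e / 2 * (1 - q^-1) by ring.
    have : e / 2 * (1 - q^-1) <= e / 2 by rewrite ler_piMr//; lra.
    lra.
  have ji' := ltnW ji.
  apply: (@le_trans _ _ (C1 * C3 `^ q^-1 * (th ^+ absdiff i j * b `^ q^-1))); last first.
    by rewrite lerDr; pos.
  have -> : absdiff i j = (i - j)%N by rewrite /absdiff; move: ji; clear; lia.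
  rewrite divff ?gt_eqF// mulr1.
  have h2 := P1 _ _ (rr0 i) (dyadic_le r00 ji') (rrl j).
  have h3 := P3 _ _ (rr0 i) (dyadic_le r00 ji') (rrl j).
  rewrite dyadic_ratio// in h2 h3.
  set x := 2^-1 ^+ (i - j) in h2 h3.
  have x0 : 0 < x by rewrite /x; pos.
  have h2' : w (dyadic r0 i) / w (dyadic r0 j) <= C1 * x `^ (- (m / q) + e) by rewrite ler_pdivrMr.
  have h3' : b^-1 <= C3 * x `^ (m - e / 2) by rewrite /b invf_div ler_pdivrMr.
  have h4 : (b^-1) `^ q^-1 <= C3 `^ q^-1 * x `^ ((m - e / 2) * q^-1).
    by rewrite powRrM -powRM ?powR_ge0 ?(ltW C30)// ge0_ler_powR ?nnegrE ?(ltW iq0)//; pos.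
  have h5 : 1 <= C3 `^ q^-1 * x `^ ((m - e / 2) * q^-1) * b `^ q^-1.
    have e1 : b^-1 `^ q^-1 * b `^ q^-1 = 1.
      by rewrite -powRM ?invr_ge0 ?(ltW b0)// mulVf ?powR1// gt_eqF.
    by rewrite -[leLHS]e1 ler_pM2r// powR_gt0.
  apply: (le_trans h2'); apply: (@le_trans _ _ (C1 * x `^ (- (m / q) + e) *
    (C3 `^ q^-1 * x `^ ((m - e / 2) * q^-1) * b `^ q^-1))).
    by rewrite ler_peMr//; pos.
  have -> : C1 * x `^ (- (m / q) + e) * (C3 `^ q^-1 * x `^ ((m - e / 2) * q^-1) * b `^ q^-1) =
    C1 * C3 `^ q^-1 * (x `^ (- (m / q) + e + (m - e / 2) * q^-1) * b `^ q^-1).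
    by rewrite (@powRD _ x (- (m / q) + e)) ?(gt_eqF x0) ?implybT//; ring.
  rewrite ler_pM2l// ler_pM2r; last by pos.
  apply: hn.
  have -> : - (m / q) + e + (m - e / 2) * q^-1 = e - e / 2 * q^-1 by ring.
  have : e / 2 * q^-1 <= e / 2 by rewrite ler_piMr// ltW//; lra.
  lra.
have halflt1 : 2^-1 < 1 :> R by lra.
have [c1 c10 c1P] := lower_pow_local half0 halflt1 w0 wlo.
have [c2 c20 c2P] := lower_pow_local half0 halflt1 iw0 whi.
have c01 := bd_c0 H.
have k0 : 0 < (2 * c0)^-1 by rewrite invr_gt0; lra.
have k1 : (2 * c0)^-1 < 1 by rewrite invf_lt1; lra.
have [c3 c30 c3P] := lower_pow_local k0 k1 w0 wlo.
have [c4 c40 c4P] := lower_pow_local k0 k1 iw0 whi.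
have [b [Bd [b0 Bd0 bB]]] := lower_pow_bounds l0 w0 wlo (rr0 1%N) (rrl 1%N).
pose W0 := w (dyadic r0 0).
have W00 : 0 < W0 by exact: wr.
have cmp t : 0 < t -> t <= l ->
    w (dyadic r0 (dyadic_index r0 t)) <= (c2 + Bd / b) * w t /\
    w t <= (c1 + Bd / b) * w (dyadic r0 (dyadic_index r0 t)).
  move=> t0 tl; have [i1 i2] := dyadic_indexP r00 t0.
  set j := dyadic_index r0 t in i1 i2 *; have wt := w0 _ t0 tl; have wj := wr j.
  have Bb : 0 < Bd / b by pos.
  have [tj|jt] := leP t (dyadic r0 j).
    have hh : 2^-1 * dyadic r0 j <= t by rewrite dyadicS mulKf.
    have a1 := c1P _ _ t0 tj (rrl j) hh; have a2 := c2P _ _ t0 tj (rrl j) hh.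
    split.
      apply: (@le_trans _ _ (c2 * w t)); last by rewrite ler_pM2r// lerDl ltW.
      by move: a2; rewrite ler_pdivlMr// mulrC ler_pdivrMr.
    by apply: (le_trans a1); rewrite ler_pM2r// lerDl ltW.
  (* Exceeding [dyadic r0 j] is possible only at index 0. Both arguments then lie in [r0 / 2, l],
     where [w] is bounded on both sides. *)
  have j0 : j = 0%N by case: i2 => // /(lt_trans jt); rewrite ltxx.
  have h1 : dyadic r0 1 <= t by rewrite -[1%N]/(0.+1) -j0.
  have [e1 e2] := bB _ h1 tl.
  have [e3 e4] := bB _ (dyadic_le r00 (leq0n 1)) (rrl 0%N).
  have ge a x : 0 <= a -> b <= x -> Bd <= (a + Bd / b) * x.
    move=> a0 bx; apply: (@le_trans _ _ (Bd / b * x)).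
      by rewrite mulrAC ler_pdivlMr// ler_pM2l.
    by rewrite ler_wpM2r ?lerDr//; lra.
  by rewrite j0; split; [apply: (le_trans e4)|apply: (le_trans e2)]; apply: ge => //; exact: ltW.
pose K1 := C2 * C3 `^ (1 - q^-1) + C1 * C3 `^ q^-1.
have K10 : 0 < K1 by rewrite /K1; pos.
pose K2 := (c2 + Bd / b) / W0; have K20 : 0 < K2 by rewrite /K2; pos.
pose K3 := (c1 + Bd / b) * W0; have K30 : 0 < K3 by rewrite /K3; pos.
exists u, th, (1 + K1 + K2 + K3 + c3 + c4).
clear -th0 th1 W00 K10 K20 K30 c30 c40 wr ker cmp c3P c4P k0 w0 H l0 lpm q1 q0 em e0 c01 wlo r00.
split => //.
- by lra.
- by rewrite /u divff// gt_eqF.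
- by move=> j; rewrite /u divr_gt0.
- move=> i j; apply: (le_trans (ker i j)); rewrite -/K1 -!mulrA ler_wpM2r//; last by lra.
  by rewrite mulr_ge0 ?powR_ge0// exprn_ge0// ltW.
- move=> t t0 tl; have [a1 a2] := cmp t t0 tl; have wt := w0 _ t0 tl; split.
    apply: (@le_trans _ _ (K2 * w t)); last by rewrite ler_pM2r//; lra.
    by rewrite /u /K2 mulrAC ler_pM2r// invr_gt0.
  apply: (@le_trans _ _ (K3 * u (dyadic_index r0 t))).
    by rewrite /K3 /u -mulrA [W0 * _]mulrC divfK ?gt_eqF.
  by rewrite ler_pM2r; [lra|rewrite /u divr_gt0].
- move=> s t s0 sl t0 tl st ts; have ws := w0 _ s0 sl; have wt := w0 _ t0 tl.
  have [st'|ts'] := leP s t.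
    apply: (@le_trans _ _ (c3 * w t)); last by rewrite ler_pM2r//; lra.
    by apply: c3P => //; rewrite ler_pdivrMl//; lra.
  apply: (@le_trans _ _ (c4 * w t)); last by rewrite ler_pM2r//; lra.
  have : (w t)^-1 <= c4 * (w s)^-1.
    by apply: c4P => //; [exact: ltW|rewrite ler_pdivrMl//; lra].
  by rewrite ler_pdivlMr// mulrC ler_pdivrMr.
- by apply: (mass_point H _ l0 (lpm l l0)); lra.
Qed.

End weight_at_point.

Lemma le_sum5 {R : realType} (a b c d e : R) :
  0 < a -> 0 < b -> 0 < c -> 0 < d -> 0 < e ->
  [/\ 0 < a + b + c + d + e, a <= a + b + c + d + e, b <= a + b + c + d + e &
    [/\ c <= a + b + c + d + e, d <= a + b + c + d + e & e <= a + b + c + d + e]].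
Proof. by move=> *; split; [lra|lra|lra|split; lra]. Qed.

Section hardy.
Context {R : realType} {disp : measure_display} {X : measurableType disp}.
Context (dist : X -> X -> R) (mu : {measure set X -> \bar R}) (D c0 Cd : R)
  (H : bounded_doubling dist mu D c0 Cd).
Local Notation bm := (mass dist mu).
Local Notation B := (qball dist).

Let dC x y : dist x y = dist y x. Proof. exact: qdistC (bd_quasi H) x y. Qed.

Definition annulus_index (r0 : R) (z y : X) : nat := dyadic_index r0 (dist y z).

Lemma half_power_series : (\sum_(0 <= j <oo) (2^-1 ^+ j : R)%:E <= 4%:E)%E.
Proof.
have h0 : 0 < 2^-1 :> R by lra.
have h1 : 2^-1 < 1 :> R by lra.
have := geometric_series_bound 0 h0 h1.
have -> : 2 / (1 - 2^-1) = 4 :> R by field.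
apply: le_trans; apply: lee_nneseries => [j _ _|j _]; first by rewrite lee_fin exprn_ge0// ltW.
by rewrite /absdiff sub0n add0n subn0.
Qed.

Lemma annulus_sub (r0 : R) z j : 0 < r0 -> (0 < j)%N ->
  annulus_index r0 z @^-1` [set j] `<=` B z (dyadic r0 j).
Proof.
move=> r00 j0 y /= Jy; rewrite /qball/= dC.
have := @dyadic_index_pos _ _ r00 (dist y z); rewrite -/(annulus_index r0 z y) Jy.
by move=> /(_ j0)[].
Qed.

(** Positive indices give differences of balls; index 0, which also contains the centre, is the
    complement of all the others. *)
Lemma measurable_annulus (r0 : R) z j : 0 < r0 ->
  measurable (annulus_index r0 z @^-1` [set j]).
Proof.
move=> r00.
have mS i : measurable (annulus_index r0 z @^-1` [set i.+1]).
  rewrite (_ : _ @^-1` _ = B z (dyadic r0 i.+1) `\` B z (dyadic r0 i.+2)).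
    by apply: measurableD; exact: bd_measurable H _ _.
  apply/seteqP; split=> y /=; rewrite /qball/= dC.
    move=> Jy; have := @dyadic_index_pos _ _ r00 (dist y z).
    rewrite -/(annulus_index r0 z y) Jy => /(_ isT)[_ h1 h2]; split => //.
    by apply/negP; rewrite -leNgt.
  by move=> [h1 /negP]; rewrite -leNgt => h2; exact: dyadic_index_eq.
case: j => [|j]; last exact: mS.
rewrite (_ : _ @^-1` _ = ~` \bigcup_i annulus_index r0 z @^-1` [set i.+1]).
  by apply: measurableC; apply: bigcup_measurable.
apply/seteqP; split=> y /=; first by move=> Jy [i _ /=]; rewrite Jy.
by move=> nJ; case E : (annulus_index r0 z y) => [//|k]; exfalso; apply: nJ; exists k.
Qed.

Context (p : X -> R) (pm pM A : R) (A0 : 0 <= A) (pm1 : 1 < pm)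
  (Hp : dyadic_exponent dist D p pm pM A).
Context (l : R) (n0 : nat).
Local Notation r0 := (D / 2 ^+ n0).

(** A discretised Hardy inequality. [E j] is what splitting at a suitable height yields for the
    integral of [g] over the annulus j, divided by [u j]. The relation V_i^q beta_i = Lam_i makes
    the summability of [Lam] a bound on the modular of [V] near [z]. The clauses at index 0 prepare
    the region where the exponent need not be close to [p z]. *)
Lemma hardy_point (z : X) (w : R -> R) (u : nat -> R) (th C : R) :
  weight_at dist mu c0 l r0 z (p z) w u th C ->
  exists2 K : R, 0 < K & forall g : X -> R, measurable_fun setT g ->
  (forall x, 0 <= g x) -> (\int[mu]_x (g x `^ p x)%:E <= 1)%E ->
  exists (V E Phi : nat -> R),
  [/\ (forall i, 0 < V i /\ u i <= K * V i) /\ V 0%N <= K,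
      (forall j, 0 <= E j) /\ 1 <= K * E 0%N,
      (forall j, (0 < j)%N ->
        (\int[mu]_(y in annulus_index r0 z @^-1` [set j]) (g y)%:E <= (u j * E j)%:E)%E),
      (forall i, (\sum_(0 <= j <oo) (E j / bm z (dyadic r0 (minn i j)))%:E <=
         (K * V i / u i)%:E)%E) &
      [/\ (forall i, 0 <= Phi i), (forall x, (0 < annulus_index r0 z x)%N ->
         V (annulus_index r0 z x) `^ p x <= Phi (annulus_index r0 z x)) &
        (\int[mu]_x (Phi (annulus_index r0 z x))%:E <= K%:E)%E]].
Proof.
move=> [th0 th1 C1 u0 u_gt0 ker _ _ _].
have [mp pmP pMP posc] := Hp.
have D0 := bd_D H; have r00 : 0 < r0 by pos.
have Cd1 := bd_Cd H; have Cd0 : 0 < Cd by lra.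
set q := p z in ker *.
have q1 : 1 < q := lt_le_trans pm1 (pmP z).
have q0 : 0 < q by lra.
have iq0 : 0 < q^-1 by pos.
have iq1 : q^-1 <= 1 by rewrite invf_le1// ltW.
pose beta j := bm z (dyadic r0 j).
have beta0 j : 0 < beta j by apply: (bd_mass_gt0 H); exact: dyadic_gt0.
pose M := bm z D; have M0 : 0 < M by apply: (bd_mass_gt0 H).
have betaM j : beta j <= M by apply: (mass_le_full H).
have betaL j : M <= Cd ^+ n0 * Cd ^+ j * beta j.
  have := mass_dyadic H z z (n0 + j); rewrite exprD.
  by rewrite /beta /dyadic [in X in _ -> _ <= _ * X](_ : r0 / 2 ^+ j = D / 2 ^+ (n0 + j))// exprD invfM mulrA.
pose J := annulus_index r0 z; pose An j := J @^-1` [set j].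
have mA j : measurable (An j) by exact: measurable_annulus.
have C0 : 0 < C by lra.
have [Ky Ky0 young] := geometric_young th0 th1 q1 (ltac:(lra) : 0 < 5 :> R).
have Cdn j : 1 <= Cd ^+ j by rewrite exprn_ege1.
have thle n : th ^+ n <= 1 by rewrite exprn_ile1// ltW.
have ith1 : 1 <= th^-1 by rewrite invf_ge1// ltW.
(* The base must dominate three growth rates: [Cd] for 1 / beta, 2 for 1 / T and th^-1 for 1 /
   Lam. *)
pose bb := Num.max (Num.max Cd 2) th^-1.
have bb1 : 1 <= bb by rewrite /bb !le_max Cd1.
have bbC : Cd <= bb by rewrite /bb !le_max lexx.
have bb2 : 2 <= bb by rewrite /bb !le_max lexx orbT.
have bbt : th^-1 <= bb by rewrite /bb le_max lexx orbT.
have bbp (x : R) n : 0 <= x -> x <= bb -> x ^+ n <= bb ^+ n.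
  by move=> x0 xb; rewrite lerXn2r ?nnegrE//; lra.
pose aa := (Ky + 5) * Cd ^+ n0 / M + M.
have Kyp : 0 < (Ky + 5) * Cd ^+ n0 / M by pos.
have [G G1 GP] := geometric_domination aa bb1.
have G0 : 0 < G by lra.
(* [T i / beta i] and [Lam i / beta i] below stay between [G ^- i.+1] and
   [G ^+ i.+1], which is what [powR_oscillation] requires. *)
have ratio_hi i (x : R) : x <= Ky + 5 -> x / beta i <= G ^+ i.+1.
  move=> xK; apply: le_trans (GP i); rewrite ler_pdivrMr//.
  apply: (le_trans xK); rewrite /aa mulrDl mulrDl.
  apply: ler_wpDr; first by have := beta0 i => ?; pos.
  have -> : (Ky + 5) * Cd ^+ n0 / M * bb ^+ i * beta i =
    (Ky + 5) * ((Cd ^+ n0 * bb ^+ i * beta i) / M) by ring.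
  rewrite ler_peMr//; first by lra.
  rewrite ler_pdivlMr// mul1r; apply: (le_trans (betaL i)).
  by rewrite ler_pM2r// ler_pM2l ?bbp//; [lra|pos].
have ratio_lo i (x : R) : 0 < x -> (x^-1 <= bb ^+ i) -> (G ^+ i.+1)^-1 <= x / beta i.
  move=> x0 xb; rewrite invf_ple ?posrE; [|by pos|by have := beta0 i => ?; pos].
  rewrite invf_div; apply: le_trans (GP i); rewrite /aa mulrDl.
  apply: ler_wpDl; first by pos.
  by apply: ler_pM; [exact: ltW|pos|exact: betaM|].
have root (x : R) n : (G ^+ n.+1)^-1 <= x -> x <= G ^+ n.+1 ->
    (G ^+ n.+1)^-1 <= x `^ q^-1 /\ x `^ q^-1 <= G ^+ n.+1.
  move=> x1 x2; have Gn : 1 <= G ^+ n.+1 by rewrite exprn_ege1.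
  have Gn0 : 0 < G ^+ n.+1 by lra.
  have x0 : 0 < x by apply: lt_le_trans x1; pos.
  have [x_ge1|x_lt1] := leP 1 x.
    split; last by apply: le_trans x2; exact: ler1_powR.
    apply: (@le_trans _ _ 1); first by rewrite invf_le1.
    by rewrite -(powRr0 x) ler_powR// ltW.
  split; first by apply: (le_trans x1); apply: ger1_powR => //; rewrite x0 ltW.
  apply: le_trans Gn; have := @ge0_ler_powR R q^-1 (ltW iq0) x 1.
  by rewrite powR1 !nnegrE; apply => //; exact: ltW.
pose K1 := 1 + G `^ A; have K11 : 1 <= K1 by rewrite /K1 lerDl; pos.
have K10 : 0 < K1 by lra.
pose Ku := C * (beta 0%N) `^ q^-1.
have Ku0 : 0 < Ku by have := beta0 0%N => ?; rewrite /Ku; pos.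
pose KE := (K1 * beta 0%N * (beta 0%N)^-1 `^ q^-1)^-1.
have KE0 : 0 < KE by have := beta0 0%N => ?; rewrite /KE; pos.
pose Ks := K1 * C * Ky; have Ks0 : 0 < Ks by rewrite /Ks; pos.
pose Kv := G ^+ 1; have Kv0 : 0 < Kv by rewrite /Kv; pos.
pose Kp := G `^ A * Ky; have Kp0 : 0 < Kp by rewrite /Kp; pos.
have [K0 KuK KEK [KsK KvK KpK]] := le_sum5 Ku0 KE0 Ks0 Kv0 Kp0.
set K := Ku + KE + Ks + Kv + Kp in K0 KuK KEK KsK KvK KpK.
exists K => //.
move=> g mg g0 gI.
have mgp : measurable_fun setT (fun x => (g x `^ p x)%:E).
  by apply/measurable_EFinP; exact: measurable_powR2.
have gp0 x : (0 <= (g x `^ p x)%:E)%E by rewrite lee_fin powR_ge0.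
have SE j : (\int[mu]_(y in An j) (g y `^ p y)%:E <= 1)%E.
  by apply: le_trans gI; exact: ge0_subset_integral.
have S_ge0 j : (0 <= \int[mu]_(y in An j) (g y `^ p y)%:E)%E by exact: integral_ge0.
pose S j := fine (\int[mu]_(y in An j) (g y `^ p y)%:E)%E.
have SfE j : (S j)%:E = (\int[mu]_(y in An j) (g y `^ p y)%:E)%E.
  by rewrite fineK// ge0_fin_numE// (le_lt_trans (SE j))// ltry.
have S0 j : 0 <= S j by rewrite -lee_fin SfE.
have S1 j : S j <= 1 by rewrite -lee_fin SfE.
(* The added term is summable and keeps T_j / beta_j above a geometric lower bound even where [g]
   vanishes. The total 5 below is 1 for the modular of [g] plus 4 for this series. *)
pose T j := S j + 2^-1 ^+ j.
have hj0 j : 0 < 2^-1 ^+ j :> R by apply: exprn_gt0; lra.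
have hj1 j : 2^-1 ^+ j <= 1 :> R by rewrite exprn_ile1//; lra.
have T0 j : 0 < T j by rewrite /T addrC ltr_pwDl.
have T2 j : T j <= 2 by rewrite /T (_ : 2 = 1 + 1)// lerD.
have TS : (\sum_(0 <= j <oo) (T j)%:E <= 5%:E)%E.
  under eq_eseriesr do rewrite /T EFinD.
  rewrite nneseriesD; [|by move=> *; rewrite lee_fin|by move=> *; rewrite lee_fin ltW].
  rewrite (_ : (5 : R) = 1 + 4); last by ring.
  rewrite EFinD; apply: leeD.
    under eq_eseriesr do rewrite SfE.
    have hh := integral_index mu mA (fun=> ler01) mgp gp0.
    apply: le_trans gI.
    rewrite (_ : \int[mu]_x _ = \int[mu]_x (1%:E * (g x `^ p x)%:E))%E ?hh; last first.
      by rewrite -hh; apply: eq_integral => y _; rewrite mul1e.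
    by apply: lee_nneseries => [j _ _|j _]; rewrite ?mul1e ?S_ge0.
  exact: half_power_series.
have [Lam [L1 L2 L3 L4]] := young T T0 TS.
have L0 i : 0 < Lam i.
  by apply: lt_le_trans (L1 i i); have := T0 i => ?; pos.
have Lth i : th ^+ i <= Lam i.
  apply: le_trans (L1 i 0%N); rewrite /absdiff subn0 sub0n addn0.
  rewrite ler_peMr//; first by pos.
  by rewrite /T expr0 lerDr.
pose V i := (Lam i / beta i) `^ q^-1.
have Lb i : 0 < Lam i / beta i by rewrite divr_gt0.
have V0 i : 0 < V i by rewrite /V powR_gt0.
pose E j := K1 * beta j * (T j / beta j) `^ q^-1 / u j.
have E0 j : 0 <= E j by have := T0 j; have := beta0 j; have := u_gt0 j => *; rewrite /E; pos.
have LK i : Lam i <= Ky + 5 by apply: (le_trans (L2 i)); rewrite lerDl.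
have LG i : (G ^+ i.+1)^-1 <= V i /\ V i <= G ^+ i.+1.
  apply: root; last exact: ratio_hi.
  apply: ratio_lo => //; apply: le_trans (bbp th^-1 i _ bbt); last by pos.
  by rewrite exprVn lef_pV2 ?posrE//; pos.
have TG j : (G ^+ j.+1)^-1 <= (T j / beta j) `^ q^-1 /\ (T j / beta j) `^ q^-1 <= G ^+ j.+1.
  apply: root; last first.
    by apply: ratio_hi; apply: (le_trans (T2 j)); apply: le_trans (_ : 5 <= _); rewrite ?ler_nat// lerDr ltW.
  apply: ratio_lo => //; apply: le_trans (bbp 2 j _ bb2) => //.
  rewrite -[leRHS]invrK -exprVn lef_pV2 ?posrE//.
  by rewrite /T lerDr.
have osc i y : (0 < i)%N -> An i y -> `|q - p y| <= A / i.+1%:R.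
  move=> i0 Ay; have := annulus_sub r00 i0 Ay; rewrite /qball/= => dzy.
  have : dist z y < D / 2 ^+ (n0 + i) by rewrite exprD invfM mulrA.
  move=> /posc; rewrite -/q => h; apply: (le_trans h).
  by rewrite ler_wpM2l// lef_pV2 ?posrE ?ltr0n// ler_nat ltnS leq_addl.
(* Index 0 is left out, since that annulus is not contained in a small ball and the exponent there
   cannot be replaced by [q]. *)
pose Phi i := if i == 0%N then 0 else G `^ A * (Lam i / beta i).
exists V, E, Phi; split.
- split=> [i|].
    split => //; apply: (@le_trans _ _ (Ku * V i)); last first.
      by rewrite ler_pM2r.
    have := ker i 0%N; rewrite u0 divr1 minn0 [X in _ * X]divff ?(gt_eqF (beta0 0%N))// mulr1.
    rewrite /absdiff subn0 sub0n addn0 => h; apply: (le_trans h).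
    rewrite -/(beta 0%N) -/(beta i) /Ku /V -[leLHS]mulrA -[leRHS]mulrA ler_pM2l// -[leRHS]powRM ?(ltW (beta0 0%N)) ?(ltW (Lb i))//.
    have -> : beta 0%N * (Lam i / beta i) = Lam i * (beta 0%N / beta i) by ring.
    rewrite [leRHS]powRM ?(ltW (L0 i))//; last by rewrite divr_ge0// ltW.
    rewrite ler_wpM2r ?powR_ge0//.
    apply: (@le_trans _ _ ((th ^+ i) `^ q^-1)).
      by apply: ger1_powR => //; rewrite thle andbT; pos.
    by rewrite ge0_ler_powR ?nnegrE ?(ltW iq0) ?(ltW (L0 i))//; pos.
  apply: (@le_trans _ _ Kv); last by [].
  exact: (LG 0%N).2.
- split => //; apply: (@le_trans _ _ (KE * E 0%N)); last first.
    by rewrite ler_wpM2r.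
  rewrite /E u0 divr1 /KE mulrC ler_pdivlMr; last by have := beta0 0%N => ?; pos.
  rewrite mul1r ler_wpM2l//; first by have := beta0 0%N => ?; pos.
  rewrite ge0_ler_powR ?nnegrE ?(ltW iq0) ?invr_ge0 ?divr_ge0 ?(ltW (beta0 _)) ?(ltW (T0 _))//.
  by rewrite ler_peMl ?invr_ge0 ?(ltW (beta0 _))// /T expr0 lerDr.
- move=> j j0.
  (* This height balances the two terms of the splitting: lam^q = T_j / beta_j gives lam^(1-q) S_j
     <= lam beta_j. *)
  pose lam := (T j / beta j) `^ q^-1.
  have Tb : 0 < T j / beta j by rewrite divr_gt0.
  have lam0 : 0 < lam by rewrite /lam powR_gt0.
  have lamq : lam `^ q = T j / beta j by rewrite /lam -powRrM mulVf ?gt_eqF// powRr1// ltW.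
  have s1 x : 1 <= p x by apply: le_trans (pmP x); exact: ltW.
  have K_osc y : An j y -> lam `^ (q - p y) <= G `^ A.
    move=> Ay; apply: (@powR_oscillation R G A lam _ j) => //; [exact: (TG j).1|exact: (TG j).2|].
    exact: osc.
  have := integral_split mu (mA j) mg mp g0 s1 lam0 (powR_ge0 G A) K_osc.
  rewrite -SfE => h; apply: (le_trans h).
  apply: (@le_trans _ _ (lam%:E * (beta j)%:E + (G `^ A * lam `^ (1 - q))%:E * (S j)%:E)%E).
    apply: leeD => //; apply: lee_wpmul2l; first by rewrite lee_fin ltW.
    rewrite (bd_massE H); apply: le_measure; rewrite ?inE; [exact: mA|exact: bd_measurable H _ _|].
    exact: annulus_sub.
  rewrite -!EFinM -EFinD lee_fin.
  have -> : u j * E j = lam * beta j + G `^ A * lam * beta j.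
    by rewrite /E /K1 -/lam mulrC divfK ?gt_eqF//; ring.
  rewrite lerD2l -!mulrA ler_wpM2l ?powR_ge0//.
  rewrite powRB; last by rewrite (gt_eqF lam0) implybT.
  rewrite powRr1 ?(ltW lam0)// lamq -mulrA ler_pM2l// invf_div.
  rewrite mulrAC ler_pdivrMr// ler_pM2l//.
  by rewrite /T lerDl ltW.
- move=> i.
  have ui := u_gt0 i; have bi := beta0 i.
  apply: (@le_trans _ _ ((Ks * V i / u i)%:E)); last first.
    by rewrite lee_fin ler_pM2r ?invr_gt0// ler_pM2r.
  have Bi : 0 < beta i `^ q^-1 by rewrite powR_gt0.
  pose cc := K1 * C / (beta i `^ q^-1) / u i.
  have cc0 : 0 < cc by rewrite /cc; pos.
  apply: (@le_trans _ _ (cc%:E * \sum_(0 <= j <oo) (th ^+ absdiff i j * T j `^ q^-1)%:E)%E).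
    rewrite -nneseriesZl; last by move=> j _; rewrite lee_fin; pos.
    apply: lee_nneseries => [j _ _|j _].
      by rewrite lee_fin divr_ge0// (mass_ge0 H).
    rewrite -EFinM lee_fin.
    have k := ker i j; rewrite -/(beta j) -/(beta i) -/(beta (minn i j)) in k *.
    have bj := beta0 j; have uj := u_gt0 j; have Tj := T0 j.
    have bm_ := beta0 (minn i j).
    have -> : E j / beta (minn i j) = K1 * (T j / beta j) `^ q^-1 / u i *
        (u i / u j * (beta j / beta (minn i j))).
      by rewrite /E; field; rewrite !gt_eqF.
    apply: (@le_trans _ _ (K1 * (T j / beta j) `^ q^-1 / u i *
       (C * th ^+ absdiff i j * (beta j / beta i) `^ q^-1))).
      by rewrite ler_wpM2l//; pos.
    have e1 : (T j / beta j) `^ q^-1 * (beta j / beta i) `^ q^-1 = T j `^ q^-1 / beta i `^ q^-1.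
      rewrite -powRM ?divr_ge0 ?(ltW Tj) ?(ltW bj) ?(ltW bi)//.
      rewrite mulrA divfK ?gt_eqF// powRM ?invr_ge0 ?(ltW Tj) ?(ltW bi)//.
      by rewrite powR_invr// powRN.
    rewrite (_ : K1 * (T j / beta j) `^ q^-1 / u i * (C * th ^+ absdiff i j * (beta j / beta i) `^ q^-1) =
      K1 * C / u i * th ^+ absdiff i j * ((T j / beta j) `^ q^-1 * (beta j / beta i) `^ q^-1)); last by ring.
    by rewrite e1 /cc le_eqVlt; apply/orP; left; apply/eqP; ring.
  apply: (@le_trans _ _ (cc%:E * (Ky * Lam i `^ q^-1)%:E)%E).
    by apply: lee_wpmul2l => //; rewrite lee_fin ltW.
  rewrite -EFinM lee_fin /cc /Ks /V powRM ?invr_ge0 ?(ltW (L0 i)) ?(ltW bi)//.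
  by rewrite powR_invr// powRN le_eqVlt; apply/orP; left; apply/eqP; ring.
- have Phi0 i : 0 <= Phi i.
    by rewrite /Phi; case: ifP => // _; have := Lb i => ?; pos.
  split => //.
    move=> x Jx; rewrite /Phi gtn_eqF//.
    set i := annulus_index r0 z x in Jx *.
    have Vq : V i `^ q = Lam i / beta i.
      by rewrite /V -powRrM mulVf ?gt_eqF// powRr1// ltW.
    have -> : p x = (p x - q) + q by ring.
    rewrite powRD; last by rewrite (gt_eqF (V0 i)) implybT.
    rewrite Vq ler_wpM2r ?(ltW (Lb i))//.
    apply: (@powR_oscillation R G A (V i) _ i) => //; [exact: (LG i).1|exact: (LG i).2|].
    by rewrite distrC; apply: osc.
  have := integral_index mu mA Phi0 (@measurable_cst _ _ X _ setT 1%E) (fun=> lee01).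
  under eq_integral do rewrite mule1.
  rewrite -/J => ->.
  apply: (@le_trans _ _ ((G `^ A)%:E * \sum_(0 <= i <oo) (Lam i)%:E)%E); last first.
    apply: (@le_trans _ _ ((G `^ A)%:E * Ky%:E)%E).
      by apply: lee_wpmul2l => //; rewrite lee_fin powR_ge0.
    by rewrite -EFinM lee_fin.
  rewrite -nneseriesZl; last by move=> i _; rewrite lee_fin ltW.
  apply: lee_nneseries => [i _ _|i _].
    by apply: mule_ge0; [rewrite lee_fin|exact: integral_ge0].
  rewrite integral_cst ?mul1e /Phi; last exact: mA.
  case: eqP => [_|/eqP i0].
    by rewrite mul0e -EFinM lee_fin; have := L0 i => ?; pos.
  rewrite EFinM -muleA; apply: lee_wpmul2l; first by rewrite lee_fin powR_ge0.
  apply: (@le_trans _ _ ((Lam i / beta i)%:E * (beta i)%:E)%E).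
    apply: lee_wpmul2l; first by rewrite lee_fin ltW.
    rewrite (bd_massE H); apply: le_measure; rewrite ?inE; [exact: mA|exact: bd_measurable H _ _|].
    by apply: annulus_sub => //; rewrite lt0n.
  by rewrite -EFinM lee_fin divfK// gt_eqF.
Qed.

End hardy.

(** * The weighted maximal theorem *)

(** Two quasi-subadditivity steps cost 2^q each, and 4c >= 1 allows the exponent of the constant to
    be raised to the uniform bound [qM]. *)
Lemma powR_affine_le {R : realType} (t c a v q qM : R) :
  0 <= t -> 1 <= c -> 0 <= a -> 0 <= v -> 1 <= q -> q <= qM ->
  t <= c * (a + (1 + v)) ->
  t `^ q <= (4 * c) `^ qM * (a `^ q + (1 + v `^ q)).
Proof.
move=> t0 c1 a0 v0 q1 qqM tle.
have q0 : 0 <= q by lra.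
have aq := powR_ge0 a q; have vq := powR_ge0 v q.
apply: (@le_trans _ _ ((c * (a + (1 + v))) `^ q)).
  by rewrite ge0_ler_powR ?nnegrE//; nra.
rewrite powRM; [|lra|lra].
have h1 := powR_addn_le a0 (ltac:(lra) : 0 <= 1 + v) q0.
have h2 := powR_addn_le ler01 v0 q0; rewrite powR1 in h2.
have t1 : 1 <= 2 `^ q by have := @ler_powR R 2 (ltac:(rewrite ler1n//)) 0 q q0; rewrite powRr0.
have cq0 := powR_ge0 c q.
apply: (@le_trans _ _ (c `^ q * (2 `^ q * (2 `^ q * (a `^ q + (1 + v `^ q)))))).
  rewrite ler_wpM2l//; apply: (le_trans h1); rewrite ler_wpM2l ?powR_ge0//.
  rewrite mulrDr; apply: lerD => //; nra.
rewrite !mulrA ler_wpM2r//; first by lra.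
have -> : c `^ q * 2 `^ q * 2 `^ q = (4 * c) `^ q.
  have -> : 4 * c = c * 2 * 2 by ring.
  by rewrite !powRM//; lra.
by rewrite ler_powR//; lra.
Qed.

(** Since c0 b < a / 2, the term c0 b is absorbed by the left-hand side of the triangle
    inequality. *)
Lemma far_point {R : realType} (c0 a b d : R) : 1 <= c0 -> 0 <= b ->
  2 * c0 * b < a -> a <= c0 * (d + b) -> a <= 2 * c0 * d /\ b <= 2 * c0 * d.
Proof. by move=> *; split; nra. Qed.

Section assembly.
Context {R : realType} {disp : measure_display} {X : measurableType disp}.
Context (dist : X -> X -> R) (mu : {measure set X -> \bar R}) (D c0 Cd : R)
  (H : bounded_doubling dist mu D c0 Cd).
Local Notation bm := (mass dist mu).
Local Notation B := (qball dist).

Let dC x y : dist x y = dist y x. Proof. exact: qdistC (bd_quasi H) x y. Qed.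
Let d0 x y : 0 <= dist x y. Proof. exact: qdist_ge0 (bd_quasi H) x y. Qed.
Let dtri x y z : dist x y <= c0 * (dist x z + dist z y).
Proof. exact: bd_triangle H x y z. Qed.
Let c01 : 1 <= c0. Proof. exact: bd_c0 H. Qed.
Let c00 : 0 < c0. Proof. exact: lt_le_trans ltr01 c01. Qed.

Context (l r0 : R) (r00 : 0 < r0) (dl : forall x y, dist x y <= l).
Context (N : nat) (z : 'I_N -> X) (w : 'I_N -> R -> R) (q : 'I_N -> R)
  (u : 'I_N -> nat -> R) (th : 'I_N -> R) (C : R)
  (w0 : forall k, positive_on l (w k))
  (C1 : 1 <= C)
  (hW : forall k, weight_at dist mu c0 l r0 (z k) (q k) (w k) (u k) (th k) C)
  (sep : forall j k y, (0 < annulus_index dist r0 (z j) y)%N ->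
     (0 < annulus_index dist r0 (z k) y)%N -> j = k).
Local Notation J k := (annulus_index dist r0 (z k)).

Definition product_weight (y : X) : R := \prod_(k < N) w k (dist y (z k)).
(** Because the centres are separated, at most one factor differs from 1. The product thus reduces
    to a single [u k j], which [product_weight] does not do although it is comparable. *)
Definition dyadic_weight (y : X) : R := \prod_(k < N) u k (J k y).
Definition regular_point (y : X) : Prop := forall k, y <> z k.
Local Notation rho := product_weight.

Let C0 : 0 < C. Proof. exact: lt_le_trans ltr01 C1. Qed.
Let CN : 0 < C ^+ N. Proof. exact: exprn_gt0. Qed.

Let dpos y k : regular_point y -> 0 < dist y (z k).
Proof.
move=> ry; rewrite lt_neqAle d0 andbT eq_sym; apply/eqP => e0.
by apply: (ry k); apply/(qdist_eq0 (bd_quasi H)).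
Qed.

Lemma dyadic_weight_gt0 y : 0 < dyadic_weight y.
Proof. by apply: prodr_gt0 => k _; exact: wa_u (hW k) _. Qed.

Lemma dyadic_weight_pick k y : (0 < J k y)%N -> dyadic_weight y = u k (J k y).
Proof.
move=> Jk; rewrite /dyadic_weight (bigD1 k)//= big1 ?mulr1// => j jk.
have [->|J0] := posnP (J j y); first exact: wa_u0 (hW j).
by rewrite (sep J0 Jk) eqxx in jk.
Qed.

Lemma dyadic_weight_one y : (forall k, J k y = 0%N) -> dyadic_weight y = 1.
Proof. by move=> J0; rewrite /dyadic_weight big1// => k _; rewrite J0; exact: wa_u0 (hW k). Qed.

Lemma product_weight_gt0 y : regular_point y -> 0 < rho y.
Proof. by move=> ry; apply: prodr_gt0 => k _; apply: w0; [exact: dpos|exact: dl]. Qed.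

Let prod_le (f g : 'I_N -> R) : (forall k, 0 < f k) -> (forall k, f k <= C * g k) ->
  \prod_(k < N) f k <= C ^+ N * \prod_(k < N) g k.
Proof.
move=> f0 fg; have -> : C ^+ N = \prod_(k < N) C by rewrite prodr_const card_ord.
by rewrite -big_split/=; apply: ler_prod => k _; rewrite fg ltW.
Qed.

Lemma product_weight_le y : regular_point y -> rho y <= C ^+ N * dyadic_weight y.
Proof.
move=> ry; apply: prod_le => k; first by apply: w0; [exact: dpos|exact: dl].
by have [] := wa_cmp (hW k) (dpos k ry) (dl _ _).
Qed.

Lemma product_weight_ge y : regular_point y -> dyadic_weight y <= C ^+ N * rho y.
Proof.
move=> ry; apply: prod_le => k; first exact: wa_u (hW k) _.
by have [] := wa_cmp (hW k) (dpos k ry) (dl _ _).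
Qed.

(** If the distances of [x] and [y] to each centre agree within the factor 2 c0, all factors of the
    weight are comparable. Otherwise one distance to some centre far exceeds the other, and the
    triangle inequality makes [dist x y] dominate both. *)
Lemma product_weight_dichotomy x y : regular_point x -> regular_point y ->
  rho x <= C ^+ N * rho y \/
  exists k, dist x (z k) <= 2 * c0 * dist x y /\ dist y (z k) <= 2 * c0 * dist x y.
Proof.
move=> rx ry.
have [near|] := pselect (forall k, dist x (z k) <= 2 * c0 * dist y (z k) /\
                              dist y (z k) <= 2 * c0 * dist x (z k)).
  left; apply: prod_le => k; first by apply: w0; [exact: dpos|exact: dl].
  by apply: wa_loc (hW k) _ _ _ _ _ _ _ _ ; rewrite ?dl ?dpos//; case: (near k).
move/existsNP => [k /not_andP kP]; right; exists k.

have a0 := d0 x (z k); have b0 := d0 y (z k).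
case: kP => /negP; rewrite -ltNge => far.
  exact: far_point far (dtri x (z k) y).
by rewrite (dC x y) and_comm; apply: far_point far (dtri y (z k) x).
Qed.

(** Replaces 1 / mu(B(x, r)) by a kernel that depends on annulus indices only. The dyadic radius is
    at most twice a distance to the centre, hence below 4 c0 r, and one more triangle inequality
    gives 6 c0^2 r. *)
Lemma mass_dyadic_min : exists2 K : R, 0 < K & forall x y k r,
  regular_point x -> regular_point y -> dist x y < r ->
  dist x (z k) <= 2 * c0 * dist x y -> dist y (z k) <= 2 * c0 * dist x y ->
  bm (z k) (dyadic r0 (minn (J k x) (J k y))) <= K * bm x r.
Proof.
have [K K0 KP] := mass_scale H (6 * c0 ^+ 2); exists K => //.
move=> x y k r rx ry xyr xk yk.

have rp : 0 < r by apply: le_lt_trans xyr.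
apply: le_trans (KP x r rp); apply: (mass_subset H) => v /=; rewrite /qball/= => kv.
have [a _] := dyadic_indexP r00 (dpos k rx); have [b _] := dyadic_indexP r00 (dpos k ry).
rewrite -/(J k x) in a; rewrite -/(J k y) in b.
have a2 := dyadicS r0 (J k x); have b2 := dyadicS r0 (J k y).
have cr : 2 * c0 * dist x y < 2 * c0 * r by rewrite ltr_pM2l// mulr_gt0.
have kv' : dist (z k) v < 4 * c0 * r.
  apply: (lt_le_trans kv); rewrite /minn; case: ifP => _; lra.
apply: (le_lt_trans (dtri x v (z k))).
have -> : 6 * c0 ^+ 2 * r = c0 * (2 * c0 * r + 4 * c0 * r) by ring.
by rewrite ltr_pM2l// ler_ltD// (le_trans xk)// ltW.
Qed.

Context (p : X -> R) (pm pM A : R) (A0 : 0 <= A) (pm1 : 1 < pm)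
  (Hp : dyadic_exponent dist D p pm pM A).

(** [f] is the function to be averaged and [g] its weighted version, normalised to modular at most
    1. At the centres, where the weight is not controlled, [f] is set to 0. *)
Record unit_pair (f g : X -> R) : Prop := UnitPair {
  up_f : measurable_fun setT f ;
  up_f0 : forall y, 0 <= f y ;
  up_g : measurable_fun setT g ;
  up_g0 : forall y, 0 <= g y ;
  up_sing : forall k, f (z k) = 0 ;
  up_eq : forall y, regular_point y -> g y = rho y * f y ;
  up_int : (\int[mu]_y (g y `^ p y)%:E <= 1)%E }.

Let mJ k j : measurable (J k @^-1` [set j]).
Proof. exact: (measurable_annulus H). Qed.

(* [E j] bounds the mass of [f] on the annulus of index [j] around [z k], and
   [V i / u k i] the resulting Hardy sum at a point of the annulus of index [i]. *)
Record hardy_bounds (k : 'I_N) (g : X -> R) (K : R) (V E Phi : nat -> R) : Prop :=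
  HardyBounds {
  hb_V0 : forall i, 0 < V i ;
  hb_u : forall i, u k i <= K * V i ;
  hb_V1 : V 0%N <= K ;
  hb_E0 : forall j, 0 <= E j ;
  hb_E1 : 1 <= K * E 0%N ;
  hb_E : forall j, (0 < j)%N ->
    (\int[mu]_(y in J k @^-1` [set j]) (g y)%:E <= (u k j * E j)%:E)%E ;
  hb_sum : forall i, (\sum_(0 <= j <oo) (E j / bm (z k) (dyadic r0 (minn i j)))%:E <=
    (K * V i / u k i)%:E)%E ;
  hb_Phi0 : forall i, 0 <= Phi i ;
  hb_Phi : forall y, (0 < J k y)%N -> V (J k y) `^ p y <= Phi (J k y) ;
  hb_PhiI : (\int[mu]_y (Phi (J k y))%:E <= K%:E)%E }.

Lemma hardy_bounds_exist n0 : r0 = D / 2 ^+ n0 -> (forall k, q k = p (z k)) ->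
  exists2 K : R, 1 <= K & forall f g, unit_pair f g ->
  exists V E Phi : 'I_N -> nat -> R, forall k, hardy_bounds k g K (V k) (E k) (Phi k).
Proof.
move=> r0E qE.
have /choice[Kf Kfp] k : exists K, 0 < K /\ forall g : X -> R, measurable_fun setT g ->
  (forall x, 0 <= g x) -> (\int[mu]_x (g x `^ p x)%:E <= 1)%E ->
  exists W : (nat -> R) * (nat -> R) * (nat -> R), hardy_bounds k g K W.1.1 W.1.2 W.2.
  have hk := hW k; rewrite r0E qE in hk.
  have [K K0 KP] := hardy_point H A0 pm1 Hp hk; exists K; split => // g mg g0 gI.
  have [V [E [Phi [[a1 a2] [b1 b2] b3 b4 [b5 b6 b7]]]]] := KP g mg g0 gI.
  by exists (V, E, Phi) => /=; split; rewrite ?r0E// => i; case: (a1 i).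
pose K := 1 + \sum_k Kf k.
have K1 : 1 <= K by rewrite lerDl sumr_ge0// => k _; apply: ltW; case: (Kfp k).
exists K => // f g fg.
have /choice[W WP] k := (Kfp k).2 g (up_g fg) (up_g0 fg) (up_int fg).
exists (fun k => (W k).1.1), (fun k => (W k).1.2), (fun k => (W k).2) => k.
have KK : Kf k <= K.
  rewrite /K (bigD1 k)//= addrCA lerDl addr_ge0// sumr_ge0// => j _.
  by apply: ltW; case: (Kfp j).
case: (WP k) => h1 h2 h3 h4 h5 h6 h7 h8 h9 h10; split => //.
- by move=> i; apply: (le_trans (h2 i)); rewrite ler_wpM2r// ltW.
- exact: le_trans h3 KK.
- by apply: (le_trans h5); rewrite ler_wpM2r.
- move=> i; apply: (le_trans (h7 i)); rewrite lee_fin.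
  by rewrite ler_wpM2r ?invr_ge0 ?(ltW (wa_u (hW k) i))// ler_wpM2r// ltW.
- by apply: (le_trans h10); rewrite lee_fin.
Qed.

Section pair.
Context (f g : X -> R) (fg : unit_pair f g).

Lemma unit_pair_le y : f y <= C ^+ N * (g y / dyadic_weight y).
Proof.
have [ry|] := pselect (regular_point y).
  rewrite (up_eq fg ry) mulrA ler_pdivlMr ?dyadic_weight_gt0// mulrA mulrC.
  by rewrite ler_wpM2r ?(up_f0 fg)// product_weight_ge.
move=> /existsNP [k /contrapT ->]; rewrite (up_sing fg).
have Y := dyadic_weight_gt0 (z k); have G := up_g0 fg (z k).
by rewrite mulr_ge0 ?divr_ge0 ?(ltW Y) ?(ltW CN).
Qed.

Lemma unit_pair_full : (\int[mu]_y (g y)%:E <= (bm (point : X) D + 1)%:E)%E.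
Proof.
have [mp pmP _ _] := Hp.
have mgp := measurable_powR2 (up_g fg) mp.
apply: (@le_trans _ _ (\int[mu]_y (1%:E + (g y `^ p y)%:E))%E).
  apply: ge0_le_integral => //.
  - by move=> y _; rewrite lee_fin (up_g0 fg).
  - by apply/measurable_EFinP; exact: up_g fg.
  - by apply/measurable_EFinP; apply: measurable_funD.
  move=> y _; rewrite lee_fin; have gy := up_g0 fg y.
  have py : 1 <= p y by apply: le_trans (pmP y); exact: ltW.
  have [g1|g1] := leP (g y) 1; first by apply: (le_trans g1); rewrite lerDl powR_ge0.
  apply: ler_wpDl => //; rewrite -{1}(powRr1 gy).
  by apply: ler_powR => //; exact: ltW.
rewrite ge0_integralD//; [|by move=> y _; rewrite lee_fin powR_ge0|exact/measurable_EFinP].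
rewrite integral_cst// mul1e EFinD leeD ?(up_int fg)//.
by rewrite (bd_massE H) (ball_full H).
Qed.

Lemma unit_pair_annulus k (E : nat -> R) j : (0 < j)%N ->
  (\int[mu]_(y in J k @^-1` [set j]) (g y)%:E <= (u k j * E j)%:E)%E ->
  (\int[mu]_(y in J k @^-1` [set j]) (f y)%:E <= (C ^+ N * E j)%:E)%E.
Proof.
move=> j0 gE; have uj : 0 < u k j := wa_u (hW k) j.
have c0' : 0 <= C ^+ N / u k j by rewrite divr_ge0 ?(ltW CN) ?(ltW uj).
apply: (@le_trans _ _ (\int[mu]_(y in J k @^-1` [set j]) ((C ^+ N / u k j)%:E * (g y)%:E))%E).
  apply: ge0_le_integral => //.
  - by move=> y _; rewrite lee_fin (up_f0 fg).
  - by apply/measurable_EFinP; apply: measurable_funTS; exact: up_f fg.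
  - apply: measurable_funeM; apply/measurable_EFinP; apply: measurable_funTS.
    exact: up_g fg.
  move=> y /= Jy; rewrite -EFinM lee_fin; apply: (le_trans (unit_pair_le y)).
  by rewrite (@dyadic_weight_pick k) Jy// mulrAC mulrA.
rewrite ge0_integralZl_EFin//; [|by move=> y _; rewrite lee_fin (up_g0 fg)|].
  apply: (@le_trans _ _ ((C ^+ N / u k j)%:E * (u k j * E j)%:E)%E).
    by apply: lee_wpmul2l => //; rewrite lee_fin.
  by rewrite -EFinM lee_fin mulrA divfK ?gt_eqF.
by apply/measurable_EFinP; apply: measurable_funTS; exact: up_g fg.
Qed.

Context (K : R) (V E Phi : 'I_N -> nat -> R) (K1 : 1 <= K)
  (hb : forall k, hardy_bounds k g K (V k) (E k) (Phi k)).
Let K0 : 0 < K. Proof. exact: lt_le_trans ltr01 K1. Qed.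

(** The first summand covers the points far from all centres, where the dyadic weight is 1. The
    others sum the annuli around each centre by means of [hb_sum] at index 0, where K V_0 <= K K. *)
Definition total_bound (k : R) : R := C ^+ N * (bm (point : X) D + 1) +
  \sum_(j < N) C ^+ N * bm (z j) (dyadic r0 0) * (k * k).

Lemma total_bound_ge0 k : 0 <= k -> 0 <= total_bound k.
Proof.
move=> k0; apply: addr_ge0.
  by rewrite mulr_ge0 ?(ltW CN)// addr_ge0// (mass_ge0 H).
by apply: sumr_ge0 => j _; rewrite !mulr_ge0 ?(ltW CN)// (mass_ge0 H).
Qed.

Let mf : measurable_fun setT (fun y => (f y)%:E).
Proof. by apply/measurable_EFinP; exact: up_f fg. Qed.
Let mg : measurable_fun setT (fun y => (g y)%:E).
Proof. by apply/measurable_EFinP; exact: up_g fg. Qed.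
Let f0 y : (0 <= (f y)%:E)%E. Proof. by rewrite lee_fin (up_f0 fg). Qed.
Let g0 y : (0 <= (g y)%:E)%E. Proof. by rewrite lee_fin (up_g0 fg). Qed.

Lemma unit_pair_total : (\int[mu]_y (f y)%:E <= (total_bound K)%:E)%E.
Proof.
pose phi (j : nat) : R := (0 < j)%N%:R.
have phi0 j : 0 <= phi j by exact: ler0n.
have mphi k : measurable_fun setT (fun y => ((phi (J k y))%:E * (f y)%:E)%E).
  apply: emeasurable_funM => //; apply/measurable_EFinP.
  exact: (measurable_index (mJ k) phi).
have phif0 k y : (0 <= (phi (J k y))%:E * (f y)%:E)%E by apply: mule_ge0 => //; rewrite lee_fin.
apply: (@le_trans _ _ (\int[mu]_y ((C ^+ N)%:E * (g y)%:E +
    \sum_(k < N) (phi (J k y))%:E * (f y)%:E))%E).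
  apply: ge0_le_integral => //.
  - by apply: emeasurable_funD; [exact: measurable_funeM|exact: emeasurable_sum].
  move=> y _.
  have [[k Jk]|noJ] := pselect (exists k, (0 < J k y)%N).
    rewrite (bigD1 k)//= {1}/phi Jk mul1e addeCA leeDl// adde_ge0//.
      by rewrite mule_ge0 ?lee_fin ?(ltW CN) ?(up_g0 fg).
    by apply: sume_ge0.
  apply: (@le_trans _ _ ((C ^+ N)%:E * (g y)%:E)%E); last by rewrite leeDl// sume_ge0.
  rewrite -EFinM lee_fin; have := unit_pair_le y; rewrite dyadic_weight_one ?divr1// => k.
  by have [//|Jk] := posnP (J k y); exfalso; apply: noJ; exists k.
rewrite ge0_integralD//; last 4 first.
- by move=> y _; rewrite mule_ge0 ?lee_fin ?(ltW CN) ?(up_g0 fg).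
- exact: measurable_funeM.
- by move=> y _; exact: sume_ge0.
- exact: emeasurable_sum.
rewrite ge0_integralZl_EFin ?(ltW CN)//.
rewrite ge0_integral_sum//.
rewrite /total_bound EFinD; apply: leeD.
  by rewrite EFinM lee_wpmul2l ?lee_fin ?(ltW CN)// unit_pair_full.
rewrite -sumEFin; apply: lee_sum => k _.
rewrite (integral_index mu (mJ k) phi0 mf f0).
have b0 : 0 < bm (z k) (dyadic r0 0) by apply: (bd_mass_gt0 H); exact: dyadic_gt0.
have [hV0 hu hV1 hE0 hE1 hE hsum _ _ _] := hb k.
have s0 := hsum 0%N; rewrite (wa_u0 (hW k)) divr1 in s0.
apply: (@le_trans _ _ ((C ^+ N * bm (z k) (dyadic r0 0))%:E *
   \sum_(0 <= j <oo) (E k j / bm (z k) (dyadic r0 (minn 0 j)))%:E)%E).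
  rewrite -nneseriesZl; last first.
    by move=> j _; rewrite lee_fin divr_ge0// (mass_ge0 H).
  apply: lee_nneseries => [j _ _|j _].
    by rewrite mule_ge0 ?lee_fin// integral_ge0.
  rewrite min0n -EFinM -mulrA [X in (C ^+ N * X)%:E]mulrC divfK ?gt_eqF// /phi.
  case: j => [|j]; first by rewrite mul0e lee_fin mulr_ge0 ?(ltW CN).
  by rewrite mul1e (unit_pair_annulus _ (hE _ _)).
rewrite [leRHS]EFinM lee_wpmul2l ?lee_fin ?mulr_ge0 ?(ltW CN) ?(ltW b0)//.
by apply: (le_trans s0); rewrite lee_fin ler_wpM2l// ltW.
Qed.

(** On annuli of positive index around [z k] only the weight of that centre acts. Annulus 0 may
    contain the other centres, so its integral is bounded by the total one, and 1 <= K E_0 brings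
    this bound into the same Hardy sum. *)
Lemma unit_pair_kernel k i :
  (\int[mu]_y ((bm (z k) (dyadic r0 (minn i (J k y))))^-1%:E * (f y)%:E) <=
   ((C ^+ N + total_bound K * K) * (K * V k i / u k i))%:E)%E.
Proof.
have [hV0 hu hV1 hE0 hE1 hE hsum _ _ _] := hb k.
have b0 j : 0 < bm (z k) (dyadic r0 j) by apply: (bd_mass_gt0 H); exact: dyadic_gt0.
have T0 := total_bound_ge0 (ltW K0).
pose phi j := (bm (z k) (dyadic r0 (minn i j)))^-1.
have phi0 j : 0 <= phi j by rewrite invr_ge0 ltW.
rewrite (integral_index mu (mJ k) phi0 mf f0).
have C10 : 0 <= C ^+ N + total_bound K * K.
  by rewrite addr_ge0 ?mulr_ge0 ?(ltW CN) ?(ltW K0).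
apply: (@le_trans _ _ ((C ^+ N + total_bound K * K)%:E *
   \sum_(0 <= j <oo) (E k j / bm (z k) (dyadic r0 (minn i j)))%:E)%E); last first.
  by rewrite [leRHS]EFinM lee_wpmul2l ?lee_fin.
rewrite -nneseriesZl; last by move=> j _; rewrite lee_fin divr_ge0// (mass_ge0 H).
apply: lee_nneseries => [j _ _|j _].
  by rewrite mule_ge0 ?lee_fin// integral_ge0.
rewrite -EFinM mulrA -/(phi j) [X in (_ <= X)%E]EFinM [leRHS]muleC lee_wpmul2l ?lee_fin//.
case: j => [|j].
  apply: (@le_trans _ _ (\int[mu]_y (f y)%:E)%E).
    by apply: ge0_subset_integral => //; exact: mJ.
  apply: (le_trans unit_pair_total); rewrite lee_fin mulrDl.
  apply: ler_wpDl; first by rewrite mulr_ge0 ?(ltW CN).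
  by rewrite -mulrA ler_peMr.
apply: (le_trans (unit_pair_annulus (ltn0Sn j) (hE _ (ltn0Sn j)))).
by rewrite lee_fin ler_wpM2r// lerDl mulr_ge0// ltW.
Qed.

Definition annular_sum (x : X) : R :=
  \sum_(k < N) if (0 < J k x)%N then V k (J k x) else 0.

Lemma annular_sum_ge0 x : 0 <= annular_sum x.
Proof.
by apply: sumr_ge0 => k _; case: ifP => // _; apply: ltW; exact: hb_V0 (hb k) _.
Qed.

Lemma annular_sum_pick k x : (0 < J k x)%N -> annular_sum x = V k (J k x).
Proof.
move=> Jk; rewrite /annular_sum (bigD1 k)//= Jk big1 ?addr0// => j jk.
by case: ifP => // Jj; rewrite (sep Jj Jk) eqxx in jk.
Qed.

(** Close to [z k] the weight cancels [u k] and leaves [V k]. At index 0 of [z k] the point may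
    still be close to another centre j, whose weight is then at most K V_j by [hb_u]. *)
Lemma dyadic_weight_annular k x :
  dyadic_weight x * (V k (J k x) / u k (J k x)) <= K * K * (1 + annular_sum x).
Proof.
have A0' := annular_sum_ge0 x.
have [Jk|Jk] := posnP (J k x); last first.
  rewrite (dyadic_weight_pick Jk) [leLHS]mulrC divfK; last by rewrite gt_eqF// (wa_u (hW k)).
  rewrite -(annular_sum_pick Jk); apply: (@le_trans _ _ (1 + annular_sum x)).
    by rewrite lerDr.
  by rewrite ler_peMl ?addr_ge0// mulr_ege1.
rewrite Jk (wa_u0 (hW k)) divr1 mulrC -mulrA.
apply: ler_pM.
- by apply: ltW; exact: hb_V0 (hb k) _.
- by rewrite ltW// dyadic_weight_gt0.
- exact: hb_V1 (hb k).
have [[j Jj]|noJ] := pselect (exists j, (0 < J j x)%N).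
  rewrite (dyadic_weight_pick Jj) (annular_sum_pick Jj).
  apply: (le_trans (hb_u (hb j) _)); rewrite ler_wpM2l ?(ltW K0)//.
  by rewrite lerDr.
rewrite dyadic_weight_one => [|j].
  by rewrite mulr_ege1// lerDl.
by have [//|Jj] := posnP (J j x); exfalso; apply: noJ; exists j.
Qed.

(** The integrand is bounded by the sum of both alternatives of the dichotomy, over all centres, so
    no measurable partition of the ball according to that dichotomy is required. *)
Lemma unit_pair_average (Km : R) x r : 0 < Km ->
  (forall x y k r, regular_point x -> regular_point y -> dist x y < r ->
    dist x (z k) <= 2 * c0 * dist x y -> dist y (z k) <= 2 * c0 * dist x y ->
    bm (z k) (dyadic r0 (minn (J k x) (J k y))) <= Km * bm x r) ->
  regular_point x -> 0 < r ->
  rho x * (fine (\int[mu]_(y in B x r) (f y)%:E) / bm x r) <=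
  C ^+ N * (fine (\int[mu]_(y in B x r) (g y)%:E) / bm x r) +
  (Km * N%:R * C ^+ N * (C ^+ N + total_bound K * K) * K * (K * K)) *
     (1 + annular_sum x).
Proof.
move=> Km0 KmP rx rr0.
have rhox := product_weight_gt0 rx.
have bx : 0 < bm x r by apply: (bd_mass_gt0 H).
have mB : measurable (B x r) by exact: bd_measurable H _ _.
have b0 k j : 0 < bm (z k) (dyadic r0 j) by apply: (bd_mass_gt0 H); exact: dyadic_gt0.
pose ker k y := (bm (z k) (dyadic r0 (minn (J k x) (J k y))))^-1.
have ker0 k y : 0 < ker k y by rewrite invr_gt0.
pose a := C ^+ N; pose b := rho x * Km * bm x r.
have b_ge0 : 0 <= b by rewrite !mulr_ge0 ?ltW.
pose S k := (C ^+ N + total_bound K * K) * (K * V k (J k x) / u k (J k x)).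
have kS k : (\int[mu]_y ((ker k y)%:E * (f y)%:E) <= (S k)%:E)%E := unit_pair_kernel k (J k x).
have mker k : measurable_fun setT (fun y => ((ker k y)%:E * (f y)%:E)%E).
  apply: emeasurable_funM => //; apply/measurable_EFinP.
  exact: (measurable_index (mJ k) (fun j => (bm (z k) (dyadic r0 (minn (J k x) j)))^-1)).
have kerf0 k y : (0 <= (ker k y)%:E * (f y)%:E)%E by rewrite mule_ge0// lee_fin ltW.
have mfB : measurable_fun (B x r) (fun y => (f y)%:E) by exact: measurable_funTS.
have mgB : measurable_fun (B x r) (fun y => (g y)%:E) by exact: measurable_funTS.
have msB : measurable_fun (B x r) (fun y => \sum_(k < N) ((ker k y)%:E * (f y)%:E))%E.
  by apply: measurable_funTS; exact: emeasurable_sum.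
have s0 y : (0 <= \sum_(k < N) ((ker k y)%:E * (f y)%:E))%E by exact: sume_ge0.
have intf : (\int[mu]_(y in B x r) (f y)%:E <= (total_bound K)%:E)%E.
  by apply: le_trans unit_pair_total; exact: ge0_subset_integral.
have intg : (\int[mu]_(y in B x r) (g y)%:E <= (bm (point : X) D + 1)%:E)%E.
  by apply: le_trans unit_pair_full; exact: ge0_subset_integral.
have If0 : (0 <= \int[mu]_(y in B x r) (f y)%:E)%E by exact: integral_ge0.
have Ig0 : (0 <= \int[mu]_(y in B x r) (g y)%:E)%E by exact: integral_ge0.
have key : rho x * fine (\int[mu]_(y in B x r) (f y)%:E) <=
    a * fine (\int[mu]_(y in B x r) (g y)%:E) + b * \sum_k S k.
  rewrite -lee_fin EFinD [(rho x * _)%:E]EFinM [(a * _)%:E]EFinM [(b * _)%:E]EFinM !fineK; last 2 first.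
  - by rewrite ge0_fin_numE// (le_lt_trans intg)// ltry.
  - by rewrite ge0_fin_numE// (le_lt_trans intf)// ltry.
  rewrite -ge0_integralZl_EFin ?(ltW rhox)//.
  apply: (@le_trans _ _ (\int[mu]_(y in B x r) (a%:E * (g y)%:E +
      b%:E * \sum_(k < N) ((ker k y)%:E * (f y)%:E)))%E).
    apply: ge0_le_integral => //.
    - by move=> y _; rewrite mule_ge0// lee_fin ltW.
    - exact: measurable_funeM.
    - by apply: emeasurable_funD; exact: measurable_funeM.
    move=> y /= xy; have [ry|] := pselect (regular_point y); last first.
      move=> /existsNP [k /contrapT yk]; rewrite {1}yk (up_sing fg) mule0.
      by apply: adde_ge0; apply: mule_ge0 => //; rewrite lee_fin// ltW.
    have [near|[k [k1 k2]]] := product_weight_dichotomy rx ry.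
      apply: (@le_trans _ _ (a%:E * (g y)%:E)%E).
        rewrite -!EFinM lee_fin (up_eq fg ry) mulrA ler_wpM2r//.
        exact: up_f0 fg y.
      by rewrite leeDl// mule_ge0 ?lee_fin.
    apply: (@le_trans _ _ (b%:E * ((ker k y)%:E * (f y)%:E))%E).
      rewrite -!EFinM lee_fin mulrA ler_wpM2r ?(up_f0 fg)//.
      rewrite /b -!mulrA ler_peMr ?(ltW rhox)// mulrA /ker ler_pdivlMr// mul1r.
      exact: KmP.
    apply: (@le_trans _ _ (b%:E * \sum_(k < N) ((ker k y)%:E * (f y)%:E))%E).
      by rewrite lee_wpmul2l ?lee_fin// (bigD1 k)//= leeDl// sume_ge0.
    by rewrite leeDr// mule_ge0// lee_fin ltW.
  rewrite ge0_integralD//; last 4 first.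
  - by move=> y _; rewrite mule_ge0// lee_fin ltW.
  - exact: measurable_funeM.
  - by move=> y _; rewrite mule_ge0 ?lee_fin.
  - exact: measurable_funeM.
  rewrite ge0_integralZl_EFin ?(ltW CN)//; apply: leeD => //.
  rewrite ge0_integralZl_EFin// lee_wpmul2l ?lee_fin//.
  rewrite ge0_integral_sum//; last by move=> k; exact: measurable_funTS.
  rewrite -sumEFin; apply: lee_sum => k _; apply: le_trans (kS k).
  exact: ge0_subset_integral.
have rS k : rho x * S k <= C ^+ N * (C ^+ N + total_bound K * K) * K * (K * K) *
     (1 + annular_sum x).
  have T0 := total_bound_ge0 (ltW K0).
  have C10 : 0 <= C ^+ N + total_bound K * K by rewrite addr_ge0 ?mulr_ge0 ?(ltW CN) ?(ltW K0).
  have Vu : 0 <= V k (J k x) / u k (J k x).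
    by rewrite divr_ge0 ?(ltW (wa_u (hW k) _))// ltW// (hb_V0 (hb k)).
  apply: (@le_trans _ _ (C ^+ N * dyadic_weight x * S k)).
    rewrite ler_wpM2r ?product_weight_le// /S mulr_ge0// -mulrA mulr_ge0//.
    exact: ltW.
  have -> : C ^+ N * dyadic_weight x * S k = C ^+ N * (C ^+ N + total_bound K * K) * K *
     (dyadic_weight x * (V k (J k x) / u k (J k x))) by rewrite /S; ring.
  rewrite -[leRHS]mulrA ler_wpM2l ?dyadic_weight_annular//.
  by rewrite !mulr_ge0 ?(ltW CN) ?(ltW K0).
set F := fine (\int[mu]_(y in B x r) (f y)%:E) in key *.
set G := fine (\int[mu]_(y in B x r) (g y)%:E) in key *.
rewrite [leLHS]mulrA ler_pdivrMr//; apply: (le_trans key).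
rewrite mulrDl -[X in _ <= X + _]mulrA divfK ?gt_eqF// /a lerD2l.
apply: (@le_trans _ _ (bm x r * Km * \sum_k rho x * S k)).
  by rewrite /b -mulr_sumr le_eqVlt; apply/orP; left; apply/eqP; ring.
rewrite [leRHS]mulrC -mulrA ler_wpM2l ?(ltW bx)// -!mulrA ler_wpM2l ?(ltW Km0)//.
rewrite !mulrA; apply: le_trans (_ : \sum_(k < N) (C ^+ N * (C ^+ N + total_bound K * K) * K * (K * K) *
     (1 + annular_sum x)) <= _); first exact: ler_sum.
by rewrite sumr_const card_ord -mulr_natl le_eqVlt; apply/orP; left; apply/eqP; ring.
Qed.

End pair.

Lemma weighted_maximal_modular n0 : r0 = D / 2 ^+ n0 -> (forall k, q k = p (z k)) ->
  exists2 K : R, 0 < K & forall f g, unit_pair f g ->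
  (\int[mu]_y (f y)%:E < +oo)%E /\
  exists F : X -> \bar R, [/\ measurable_fun setT F, (forall x, 0 <= F x)%E,
    (\int[mu]_x F x <= K%:E)%E &
    forall x r, regular_point x -> 0 < r ->
    (((rho x * (fine (\int[mu]_(y in B x r) (f y)%:E) / bm x r)) `^ p x)%:E <= F x)%E].
Proof.
move=> r0E qE; have [mp pmP pMP _] := Hp.
have [K K1 hbE] := hardy_bounds_exist r0E qE.
have [Km Km0 KmP] := mass_dyadic_min.
have [K2 K20 mm] := maximal_modular H A0 pm1 Hp.
have K0 : 0 < K := lt_le_trans ltr01 K1.
pose C3 := Km * N%:R * C ^+ N * (C ^+ N + total_bound K * K) * K * (K * K).
have C30 : 0 <= C3.
  have T0 := total_bound_ge0 (ltW K0).
  by rewrite !mulr_ge0 ?ler0n ?addr_ge0 ?mulr_ge0 ?(ltW CN) ?(ltW K0) ?(ltW Km0).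
pose c := C ^+ N + C3.
have c1 : 1 <= c by rewrite /c ler_wpDr// exprn_ege1.
pose Kc := (4 * c) `^ pM; have Kc0 : 0 <= Kc by exact: powR_ge0.
pose M := bm (point : X) D; have M0 : 0 <= M := mass_ge0 H _ _.
have MS : 0 <= \sum_(k < N) K by apply: sumr_ge0 => k _; exact: ltW.
exists (1 + Kc * (K2 * (M + K2) + (M + \sum_(k < N) K))).
  rewrite ltr_pwDl// mulr_ge0// !addr_ge0// mulr_ge0 ?(ltW K20)//.
  by rewrite addr_ge0// ltW.
move=> f g fg; have [V [E [Phi hb]]] := hbE f g fg.
have [Psi [mPsi Psi0 IPsi PsiP]] := mm g (up_g fg) (up_g0 fg) (up_int fg).
split; first exact: le_lt_trans (unit_pair_total fg K1 hb) (ltry _).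
have mPhi k : measurable_fun setT (fun x => (Phi k (J k x))%:E).
  by apply/measurable_EFinP; exact: (measurable_index (mJ k) (Phi k)).
have Phi0 k x : (0 <= (Phi k (J k x))%:E)%E by rewrite lee_fin (hb_Phi0 (hb k)).
have mSum : measurable_fun setT (fun x => \sum_(k < N) (Phi k (J k x))%:E)%E.
  exact: emeasurable_sum.
have Sum0 x : (0 <= \sum_(k < N) (Phi k (J k x))%:E)%E by exact: sume_ge0.
have one0 : (0 <= 1 :> \bar R)%E by exact: lee01.
(* [F1] dominates the p-th power of the average of [g], and [F2] one plus that of the annular sum,
   in which at most one term is nonzero. *)
pose F1 x := (K2%:E * (1 + Psi x))%E.
pose F2 x := (1 + \sum_(k < N) (Phi k (J k x))%:E)%E.
have mF1 : measurable_fun setT F1 by apply: measurable_funeM; exact: emeasurable_funD.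
have mF2 : measurable_fun setT F2 by exact: emeasurable_funD.
have F10 x : (0 <= F1 x)%E by rewrite mule_ge0 ?adde_ge0// lee_fin ltW.
have F20 x : (0 <= F2 x)%E by rewrite adde_ge0.
have muE : mu [set: X] = M%:E by rewrite /M (bd_massE H) (ball_full H).
exists (fun x => Kc%:E * (F1 x + F2 x))%E; split.
- by apply: measurable_funeM; exact: emeasurable_funD.
- by move=> x; rewrite mule_ge0 ?adde_ge0.
- rewrite ge0_integralZl_EFin//; [|by move=> x _; rewrite adde_ge0|exact: emeasurable_funD].
  rewrite ge0_integralD// [X in (_ * (X + _))%E]ge0_integralZl_EFin ?(ltW K20)//; last 2 first.
  - by move=> x _; rewrite adde_ge0.
  - exact: emeasurable_funD.
  rewrite ge0_integralD// [X in (_ * (_ + X))%E]ge0_integralD// ge0_integral_sum//.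
  rewrite integral_cst// mul1e muE EFinD.
  apply: (@le_trans _ _ ((Kc * (K2 * (M + K2) + (M + \sum_(k < N) K)))%:E)); last first.
    by rewrite leeDr.
  rewrite EFinM lee_wpmul2l ?lee_fin// !EFinD; apply: leeD.
    by rewrite EFinM lee_wpmul2l ?lee_fin ?(ltW K20)// EFinD leeD.
  by rewrite leeD// -sumEFin lee_sum// => k _; exact: hb_PhiI (hb k).
move=> x r rx rr0.
have rhox := product_weight_gt0 rx.
have bx : 0 < bm x r by apply: (bd_mass_gt0 H).
have I0 h : (forall y, 0 <= h y) -> 0 <= fine (\int[mu]_(y in B x r) (h y)%:E) / bm x r.
  move=> h0; rewrite divr_ge0 ?(ltW bx)// fine_ge0// integral_ge0// => y _.
  by rewrite lee_fin.
have av := unit_pair_average fg K1 hb Km0 KmP rx rr0.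
have px1 : 1 <= p x by apply: le_trans (pmP x); exact: ltW.
set a := fine (\int[mu]_(y in B x r) (g y)%:E) / bm x r in av.
have a0 : 0 <= a by apply: I0; exact: up_g0 fg.
have v0 := annular_sum_ge0 hb x.
have av' : rho x * (fine (\int[mu]_(y in B x r) (f y)%:E) / bm x r) <=
    c * (a + (1 + annular_sum V x)).
  apply: (le_trans av); rewrite -/C3 [leRHS]mulrDr; apply: lerD.
    by rewrite ler_wpM2r// lerDl.
  by rewrite ler_wpM2r ?addr_ge0// lerDr ltW.
have t0 : 0 <= rho x * (fine (\int[mu]_(y in B x r) (f y)%:E) / bm x r).
  by rewrite mulr_ge0 ?(ltW rhox)// I0//; exact: up_f0 fg.
have := powR_affine_le t0 c1 a0 v0 px1 (pMP x) av'; rewrite -/Kc -lee_fin => h.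
apply: (le_trans h); rewrite EFinM lee_wpmul2l ?lee_fin// EFinD.
apply: leeD; first exact: PsiP.
rewrite EFinD leeD//.
have [[k Jk]|noJ] := pselect (exists k, (0 < J k x)%N).
  rewrite (annular_sum_pick V Jk) (bigD1 k)//=.
  apply: (@le_trans _ _ (Phi k (J k x))%:E); last by rewrite leeDl// sume_ge0.
  by rewrite lee_fin (hb_Phi (hb k)).
rewrite /annular_sum big1 ?powR0 ?sume_ge0//; first by rewrite gt_eqF// (lt_le_trans ltr01 px1).
by move=> k _; case: ifP => // Jk; exfalso; apply: noJ; exists k.
Qed.

End assembly.

(** * Modulars, norms and suprema of averages *)

Section modular.
Context {R : realType} {disp : measure_display} {X : measurableType disp}.
Implicit Types mu : {measure set X -> \bar R}.

(* [\int] is a lower integral on nonmeasurable nonnegative functions, which is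
   what a maximal function over balls that need not be open requires. *)
Lemma lower_integral_le mu (f g : X -> \bar R) : (forall x, 0 <= f x)%E ->
  (forall x, f x <= g x)%E -> (\int[mu]_x f x <= \int[mu]_x g x)%E.
Proof.
move=> f0 fg; have g0 x : (0 <= g x)%E := le_trans (f0 x) (fg x).
rewrite !ge0_integralTE//; apply: ge_ereal_sup => _ [h hf <-].
by apply: ereal_sup_ubound; exists h => // x; exact: le_trans (hf x) (fg x).
Qed.

Lemma Lvar_norm_le mu (p rho : X -> R) (f g : X -> \bar R) (K : R) : 0 < K ->
  (forall lam : R, 0 < lam ->
    (\int[mu]_x (`| (rho x)%:E * f x * (lam^-1)%:E | `^ (p x)) <= 1)%E ->
    (\int[mu]_x (`| (rho x)%:E * g x * ((K * lam)^-1)%:E | `^ (p x)) <= 1)%E) ->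
  (Lvar_norm mu p rho g <= K%:E * Lvar_norm mu p rho f)%E.
Proof.
move=> K0 h; rewrite -lee_pdivrMl//; apply: le_ereal_inf_tmp => _ [lam [lam0 lamP] <-].
rewrite lee_pdivrMl//; apply: ereal_inf_lbound.
by exists (K * lam); rewrite ?EFinM//; split; [rewrite mulr_gt0|exact: h].
Qed.

Lemma measurable_normc (f : X -> R[i]) : cmeasurable f ->
  measurable_fun setT (fun x => Normc.normc (f x)).
Proof.
move=> [mr mi].
rewrite (_ : (fun x => _) = (fun x =>
  ((complex.Re (f x)) ^+ 2 + (complex.Im (f x)) ^+ 2) `^ 2^-1)).
  by apply: measurableT_comp (measurable_powR _) _; apply: measurable_funD; exact: measurable_funX.
by apply/funext => x; rewrite powR12_sqrt ?addr_ge0 ?sqr_ge0//; case: (f x).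
Qed.

Lemma normc_ge0 (x : R[i]) : 0 <= Normc.normc x.
Proof. by case: x => a b; exact: sqrtr_ge0. Qed.

(** The power passes to the supremum by bounding the supremum itself: for finite [F] every element
    of [S] is at most F^(1/q) / (rho c), which also shows that the supremum is finite. *)
Lemma sup_modular_le (S : set (\bar R)) (F : \bar R) (rho c q : R) :
  0 < rho -> 0 < c -> 0 < q -> (exists2 s, S s & 0 <= s)%E ->
  (forall s, S s -> exists2 a : R, (0 <= a)%R & s = a%:E /\ ((rho * a * c) `^ q)%:E <= F)%E ->
  (`| rho%:E * ereal_sup S * c%:E | `^ q <= F)%E.
Proof.
move=> rho0 c0 q0 [s0 Ss0 s00] SF.
case: F SF => [v| |] SF; last 2 first.
- by rewrite leey.
- by have [a _ []] := SF _ Ss0.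
have rc0 : 0 < rho * c by rewrite mulr_gt0.
have v0 : 0 <= v.
  have [a a0 [_]] := SF _ Ss0; rewrite lee_fin; apply: le_trans; exact: powR_ge0.
pose b := v `^ q^-1 / (rho * c).
have supb : (ereal_sup S <= b%:E)%E.
  apply: ge_ereal_sup => s /SF[a a0 [-> h]]; rewrite lee_fin /b ler_pdivlMr//.
  rewrite lee_fin in h; have rac0 : 0 <= rho * a * c by rewrite !mulr_ge0// ltW.
  have -> : a * (rho * c) = ((rho * a * c) `^ q) `^ q^-1.
    by rewrite -powRrM mulfV ?gt_eqF// powRr1//; ring.
  by rewrite ge0_ler_powR ?nnegrE ?powR_ge0// invr_ge0 ltW.
have sup0 : (0 <= ereal_sup S)%E by apply: le_trans s00 _; exact: ereal_sup_ubound.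
have supf : ereal_sup S \is a fin_num by rewrite ge0_fin_numE// (le_lt_trans supb)// ltry.
move: sup0 supb; rewrite -(fineK supf) !lee_fin => sup0 supb.
rewrite ger0_norm; last by rewrite !mulr_ge0// ltW.
have -> : v = (rho * b * c) `^ q.
  have -> : rho * b * c = v `^ q^-1 by rewrite /b; field; rewrite !gt_eqF.
  by rewrite -powRrM mulVf ?gt_eqF// powRr1.
rewrite ge0_ler_powR ?nnegrE ?(ltW q0)//.
- by rewrite !mulr_ge0// ltW.
- by rewrite /b !mulr_ge0 ?powR_ge0 ?invr_ge0 ?(ltW rho0) ?(ltW c0) ?(ltW rc0).
- by rewrite ler_pM2r// ler_pM2l.
Qed.

End modular.

(** * Measurability of the weight *)

Section weight_measurability.
Context {R : realType} {disp : measure_display} {X : measurableType disp}.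
Context (dist : X -> X -> R) (mu : {measure set X -> \bar R}) (D c0 Cd : R)
  (H : bounded_doubling dist mu D c0 Cd).

Lemma measurable_dist z : measurable_fun setT (fun y => dist y z).
Proof.
apply: (measurability (@RGenCInfty.G R)) => [|/= _ [_] [r] -> <-].
  exact: RGenCInfty.measurableE.
rewrite setTI (_ : _ @^-1` _ = ~` qball dist z r).
  by apply: measurableC; exact: bd_measurable H _ _.
apply/seteqP; split=> y /=; rewrite /qball/= in_itv/= andbT (qdistC (bd_quasi H) z).
  by move=> ry; apply/negP; rewrite -leNgt.
by move/negP; rewrite -leNgt.
Qed.

(** The class controls [w] on ]0, l] only. The value [w 0] is attained at the centre alone, so that
    singleton is treated apart. *)
Lemma measurable_weight (l : R) (w : R -> R) z : 0 < l ->
  (forall x y, dist x y <= l) -> measurable [set z] -> class_Wt l w ->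
  measurable_fun setT (fun y => w (dist y z)).
Proof.
move=> l0 dl mz [a [u [cu _ _] ue]].
have mw : measurable_fun `]0, l] w.
  apply: (@eq_measurable_fun _ _ _ _ _ (fun t => t `^ (- a) * u t)).
    move=> t; rewrite inE/= in_itv/= => /andP[t0 tl]; rewrite ue// mulrA -powRD ?addNr ?powRr0 ?mul1r//.
    by rewrite (gt_eqF t0) implybT.
  apply: measurable_funM; first by apply: measurable_funTS; exact: measurable_powR.
  apply: (@measurable_funS _ _ _ _ `[0, l]) => //.
    by move=> t /=; rewrite !in_itv/= => /andP[t0 ->]; rewrite ltW.
  exact: subspace_continuous_measurable_fun.
rewrite -(setUv [set z]); apply/measurable_funU => //; first exact: measurableC.
split; first exact: measurable_fun_set1.
apply: (@measurable_comp _ _ _ _ _ _ `]0, l]) => //.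
  move=> _ [y /= yz <-]; rewrite in_itv/= dl andbT lt_neqAle (qdist_ge0 (bd_quasi H)) andbT.
  by rewrite eq_sym; apply/eqP => /(qdist_eq0 (bd_quasi H)).
by apply: measurable_funTS; exact: measurable_dist.
Qed.

End weight_measurability.

Section weighted_maximal.
Context {R : realType} {disp : measure_display} {X : measurableType disp}.
Context (dist : X -> X -> R) (mu : {measure set X -> \bar R}) (D c0 Cd : R)
  (H : bounded_doubling dist mu D c0 Cd).
Context (N : nat) (z : 'I_N -> X) (w : 'I_N -> R -> R) (p : X -> R).
Local Notation bm := (mass dist mu).
Local Notation B := (qball dist).
Local Notation rho := (product_weight dist z w).
Local Notation regular := (regular_point z).

Lemma measurable_points : (forall k, measurable [set z k]) ->
  measurable [set y | ~ regular y].
Proof.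
move=> mz; rewrite (_ : [set y | _] = \big[setU/set0]_(k < N) [set z k]).
  by apply: bigsetU_measurable => k _; exact: mz.
apply/seteqP; split => y /=.
  by move=> /existsNP[k /contrapT ->]; rewrite (bigD1 k)//=; left.
by elim/big_rec: _ => [//|k A _ IH [->|/IH//]] /(_ k).
Qed.

Lemma points_null : (forall k, measurable [set z k]) ->
  (forall k, mu [set z k] = 0%E) -> mu [set y | ~ regular y] = 0%E.
Proof.
move=> mz z0.
rewrite (_ : [set y | _] = \big[setU/set0]_(k < N) [set z k]); last first.
  apply/seteqP; split => y /=.
    by move=> /existsNP[k /contrapT ->]; rewrite (bigD1 k)//=; left.
  by elim/big_rec: _ => [//|k A _ IH [->|/IH//]] /(_ k).
apply/negligibleP; first by apply: bigsetU_measurable => k _; exact: mz.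
elim/big_ind: _ => [|A B|k _]; [exact: negligible_set0|exact: negligibleU|].
by apply/negligibleP; [exact: mz|exact: z0].
Qed.

Lemma weighted_maximal_norm : measurable_fun setT p -> (forall y, 1 < p y) ->
  measurable_fun setT rho -> (forall k, measurable [set z k]) ->
  (forall k, mu [set z k] = 0%E) -> (forall y, regular y -> 0 < rho y) ->
  (exists2 K : R, 0 < K & forall f g, unit_pair dist mu z w p f g ->
    (\int[mu]_y (f y)%:E < +oo)%E /\
    exists F : X -> \bar R, [/\ measurable_fun setT F, (forall x, 0 <= F x)%E,
      (\int[mu]_x F x <= K%:E)%E &
      forall x r, regular x -> 0 < r ->
      (((rho x * (fine (\int[mu]_(y in B x r) (f y)%:E) / bm x r)) `^ p x)%:E <= F x)%E]) ->
  exists2 C : R, 0 < C & forall f : X -> R[i], cmeasurable f ->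
    (Lvar_norm mu p rho (maximal_function dist mu f) <=
     C%:E * Lvar_norm mu p rho (cmod f))%E.
Proof.
move=> mp p1 mrho mz z0 rho0 [K K0 core].
have mP := measurable_points mz; have P0 := points_null mz z0.
(* For exponents above 1, dividing by K1 >= 1 inside the power gains a factor 1 / K1, so a modular
   at most K becomes at most K / (1 + K), hence at most 1. *)
pose K1 := 1 + K; have K11 : 1 <= K1 by rewrite lerDl ltW.
have K10 : 0 < K1 := lt_le_trans ltr01 K11.
exists K1 => // h mh; apply: Lvar_norm_le => // lam lam0 modh.
pose cf y := Normc.normc (h y).
have mcf : measurable_fun setT cf := measurable_normc mh.
have cf0 y : 0 <= cf y := normc_ge0 (h y).
pose reg : X -> R := \1_(~` [set y | ~ regular y]).
have mreg : measurable_fun setT reg by apply: measurable_indic; exact: measurableC.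
have reg1 y : regular y -> reg y = 1.
  by move=> ry; rewrite /reg indicE mem_set//= => /(_ ry).
have reg0 y : ~ regular y -> reg y = 0.
  by move=> ry; rewrite /reg indicE memNset//= => /(_ ry).
have reg_ge0 y : 0 <= reg y by rewrite /reg indicE ler0n.
(* Setting [f] to 0 at the centres changes no integral, because they form a null set, and removes
   the points where [rho] may vanish. *)
pose f y := reg y * cf y / lam.
pose g : X -> R := fun y => `|rho y * f y|.
have f0 y : 0 <= f y by rewrite /f divr_ge0 ?mulr_ge0// ltW.
have mf : measurable_fun setT f.
  by apply: measurable_funM => //; exact: measurable_funM.
have fg : unit_pair dist mu z w p f g.
  split; [exact: mf|exact: f0| | | | |].
  - by apply: measurableT_comp => //; exact: measurable_funM.
  - by move=> y; rewrite /g.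
  - by move=> k; rewrite /f reg0 ?mul0r// => /(_ k).
  - by move=> y ry; rewrite /g ger0_norm// mulr_ge0// ltW// rho0.
  apply: le_trans modh; apply: lower_integral_le => y; first by rewrite lee_fin powR_ge0.
  rewrite /cmod -!EFinM/= lee_fin.
  have p0 : 0 < p y := lt_trans ltr01 (p1 y).
  apply: ge0_ler_powR; rewrite ?nnegrE ?(ltW p0) ?normr_ge0//.
  rewrite /g /f.
  rewrite -/(cf y) !normrM -!mulrA ler_wpM2l//.
  by rewrite ler_piMl ?mulr_ge0// ger0_norm// /reg indicE lern1 leq_b1.
have [If [F [mF F0 IF FP]]] := core f g fg.
have avE x r : 0 < r -> (((fine (mu (B x r)))^-1)%:E * \int[mu]_(y in B x r) cmod h y =
    (lam * (fine (\int[mu]_(y in B x r) (f y)%:E) / bm x r))%:E)%E.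
  move=> r0; have mB : measurable (B x r) by exact: bd_measurable H _ _.
  have -> : (\int[mu]_(y in B x r) cmod h y = \int[mu]_(y in B x r) (lam%:E * (f y)%:E))%E.
    apply: ge0_ae_eq_integral => //.
    - by apply/measurable_EFinP; exact: measurable_funTS.
    - by apply: measurable_funeM; apply/measurable_EFinP; exact: measurable_funTS.
    - by move=> y _; rewrite lee_fin normc_ge0.
    - by move=> y _; rewrite -EFinM lee_fin mulr_ge0// ltW.
    exists [set y | ~ regular y]; split => // y /= /not_implyP[_ hy] ry.
    by apply: hy; rewrite -EFinM /f reg1// mul1r mulrC divfK// gt_eqF.
  rewrite ge0_integralZl_EFin ?(ltW lam0)//; last 2 first.
  - by move=> y _; rewrite lee_fin.
  - by apply/measurable_EFinP; exact: measurable_funTS.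
  have Ir : (\int[mu]_(y in B x r) (f y)%:E < +oo)%E.
    apply: le_lt_trans If; apply: ge0_subset_integral => //.
    - by apply/measurable_EFinP.
    - by move=> y _; rewrite lee_fin.
  have Ir0 : (0 <= \int[mu]_(y in B x r) (f y)%:E)%E.
    by apply: integral_ge0 => y _; rewrite lee_fin.
  rewrite -[X in (_ * (_ * X))%E]fineK ?ge0_fin_numE// -!EFinM; congr EFin.
  by rewrite /mass; ring.
(* The value +oo at the centres dominates whatever the maximal function does there, and on a null
   set it leaves the integral unchanged. *)
pose G x := (if reg x == 1%R then K1^-1%:E * F x else +oo)%E.
have G1 x : regular x -> G x = (K1^-1%:E * F x)%E by move=> rx; rewrite /G reg1// eqxx.
have G0 x : ~ regular x -> G x = +oo%E by move=> rx; rewrite /G reg0// eq_sym oner_eq0.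
apply: (@le_trans _ _ (\int[mu]_x G x)%E).
  apply: lower_integral_le => x; first exact: poweR_ge0.
  have [rx|rx] := pselect (regular x); [rewrite G1//|by rewrite G0// leey].
  have p0 : 0 < p x := lt_trans ltr01 (p1 x).
  apply: sup_modular_le => //; [exact: rho0|by rewrite invr_gt0 mulr_gt0| |].
    exists ((fine (mu (B x 1)))^-1%:E * \int[mu]_(y in B x 1) cmod h y)%E.
      by exists 1 => //=; rewrite ltr01.
    rewrite avE// lee_fin mulr_ge0 ?(ltW lam0)// divr_ge0 ?(mass_ge0 H)//.
    by rewrite fine_ge0// integral_ge0// => y _; rewrite lee_fin.
  move=> _ [r /= r0 <-]; rewrite avE//.
  set a := fine _ / _.
  have a0 : 0 <= a.
    rewrite /a divr_ge0 ?(mass_ge0 H)//.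
    by rewrite fine_ge0// integral_ge0// => y _; rewrite lee_fin.
  exists (lam * a); first by rewrite mulr_ge0// ltW.
  split => //.
  have -> : rho x * (lam * a) / (K1 * lam) = K1^-1 * (rho x * a).
    by field; rewrite !gt_eqF.
  have rx0 := rho0 x rx.
  rewrite powRM; [|by rewrite invr_ge0 ltW|by rewrite mulr_ge0// ltW].
  rewrite EFinM; apply: lee_pmul; rewrite ?lee_fin ?powR_ge0//; last exact: FP.
  rewrite -[leRHS]powRr1; last by rewrite invr_ge0 ltW.
  by apply: ger_powR; [rewrite invr_gt0 K10 invf_le1|exact: ltW].
apply: (@le_trans _ _ (\int[mu]_x (K1^-1%:E * F x))%E); last first.
  rewrite ge0_integralZl_EFin//; last by rewrite invr_ge0 ltW.
  apply: (@le_trans _ _ (K1^-1%:E * K%:E)%E).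
    by rewrite lee_wpmul2l// lee_fin invr_ge0 ltW.
  by rewrite -EFinM lee_fin mulrC ler_pdivrMr// mul1r /K1 lerDr.
rewrite le_eqVlt; apply/orP; left; apply/eqP.
apply: ge0_ae_eq_integral => //.
- apply: measurable_fun_ifT => //; last exact: measurable_funeM.
  exact: measurable_fun_eqr.
- exact: measurable_funeM.
- move=> x _; have [rx|rx] := pselect (regular x); [rewrite G1//|by rewrite G0].
  by rewrite mule_ge0// lee_fin invr_ge0 ltW.
- by move=> x _; rewrite mule_ge0// lee_fin invr_ge0 ltW.
exists [set y | ~ regular y]; split => // y /= /not_implyP[_ hy] ry.
by apply: hy; rewrite G1.
Qed.

End weighted_maximal.

(** * A scale that separates the centres *)

Section choice_of_scale.
Context {R : realType} {disp : measure_display} {X : measurableType disp}.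
Context (dist : X -> X -> R) (mu : {measure set X -> \bar R}) (D c0 Cd : R)
  (H : bounded_doubling dist mu D c0 Cd).

(** The inverse of [S] is at most [l] and at most each distance between distinct centres. Once 2 c0
    times the scale is below it, the triangle inequality forbids a point to be close to two
    centres. *)
Lemma separating_scale (N : nat) (z : 'I_N -> X) (l : R) : 0 < l -> injective z ->
  exists n, D / 2 ^+ n <= l /\ forall j k y,
    (0 < annulus_index dist (D / 2 ^+ n) (z j) y)%N ->
    (0 < annulus_index dist (D / 2 ^+ n) (z k) y)%N -> j = k.
Proof.
move=> l0 zinj; have D0 := bd_D H; have c01 := bd_c0 H.
have c00 : 0 < c0 := lt_le_trans ltr01 c01.
have d0 x y : 0 <= dist x y := qdist_ge0 (bd_quasi H) x y.
(* the terms with [j = k] are junk inverses [0^-1 = 0] *)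
pose S := l^-1 + \sum_j \sum_k (dist (z j) (z k))^-1.
have dj0 j : 0 <= \sum_k (dist (z j) (z k))^-1.
  by apply: sumr_ge0 => k _; rewrite invr_ge0.
have il0 : 0 < l^-1 by rewrite invr_gt0.
have S0 : 0 < S by rewrite ltr_pwDl// sumr_ge0.
have Sd j k : j <> k -> S^-1 <= dist (z j) (z k).
  move=> jk; have d1 : 0 < dist (z j) (z k).
    rewrite lt_neqAle d0 andbT eq_sym; apply/eqP => /(qdist_eq0 (bd_quasi H)) e.
    by apply: jk; exact: zinj.
  rewrite -[leRHS]invrK lef_pV2 ?posrE ?invr_gt0// /S (bigD1 j)//= (bigD1 k)//=.
  rewrite addrCA -addrA lerDl !addr_ge0 ?(ltW il0)//.
    by apply: sumr_ge0 => i _; rewrite invr_ge0.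
  by apply: sumr_ge0 => i _; exact: dj0.
have Sl : S^-1 <= l.
  by rewrite -[leRHS]invrK lef_pV2 ?posrE// /S lerDl sumr_ge0.
pose e := S^-1 / (2 * c0 * D).
have cD : 0 < 2 * c0 * D by rewrite !mulr_gt0.
have e0 : 0 < e by rewrite divr_gt0 ?invr_gt0.
have [n ne] := @exprn_lt_exists R 2^-1 e ltac:(lra) ltac:(lra) e0.
have rS : 2 * c0 * (D / 2 ^+ n) < S^-1.
  by move: ne; rewrite /e ltr_pdivlMr// exprVn mulrC mulrA.
have r0 : 0 < D / 2 ^+ n by rewrite divr_gt0// exprn_gt0.
have lt_scale w y : (0 < annulus_index dist (D / 2 ^+ n) w y)%N -> dist y w < D / 2 ^+ n.
  move=> J0; have [_ _ h] := dyadic_index_pos r0 J0; apply: (lt_le_trans h).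
  by have := dyadic_le r0 (leq0n (dyadic_index (D / 2 ^+ n) (dist y w))); rewrite {2}/dyadic expr0 divr1.
exists n; split.
  apply: ltW; apply: le_lt_trans (lt_le_trans rS Sl).
  by rewrite ler_peMl ?(ltW r0)// mulr_ege1// ler1n.
move=> j k y /lt_scale Jj /lt_scale Jk; apply: contrapT => jk.
have := Sd j k jk; rewrite leNgt => /negP; apply; apply: le_lt_trans rS.
apply: (le_trans (bd_triangle H (z j) (z k) y)).
rewrite (qdistC (bd_quasi H) (z j)).
have -> : 2 * c0 * (D / 2 ^+ n) = c0 * (D / 2 ^+ n + D / 2 ^+ n) by ring.
by rewrite ler_pM2l// lerD// ltW.
Qed.

End choice_of_scale.

Theorem theoremB (R : realType) (disp : measure_display)
  (X : measurableType disp) (dist : X -> X -> R)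
  (mu : {measure set X -> \bar R}) (p : X -> R)
  (N : nat) (x : 'I_N -> X) (w : 'I_N -> R -> R) :
  let l := fine (diam dist) in
  let m := lower_index_measure dist mu in
  let rho := fun y => \prod_(k < N) w k (dist y (x k)) in
  is_doubling_space dist mu ->
  (diam dist < +oo)%E ->
  0 < l ->
  is_log_exponent dist p ->
  injective x ->
  let Phi_condition := forall k,
    class_Phi 0 m l (fun r => r `^ (m / p (x k)) * w k r) in
  let index_condition := forall k,
    [/\ class_Wt l (w k),
        ((- (m / p (x k)))%:E < lower_index (w k))%E,
        (lower_index (w k) <= upper_index (w k))%E
      & (upper_index (w k) < (m / conj_exponent p (x k))%:E)%E] in
  (Phi_condition <-> index_condition) /\
  (Phi_condition ->
    exists2 C : R, 0 < C & forall f : X -> R[i], in_Lvar mu p rho f ->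
      (Lvar_norm mu p rho (maximal_function dist mu f)
         <= C%:E * Lvar_norm mu p rho (cmod f))%E).
Proof.
move=> l m rho doub dfin l0 logp xinj Phi_condition index_condition.
have [D [c0 [Cd [H dl]]]] := doubling_space_bounded doub dfin l0.
have [pm [pM [A [pm1 Hp]]]] := log_exponent_dyadic H logp.
have [mp pmP _ posc] := Hp.
have p1 y : 1 < p y := lt_le_trans pm1 (pmP y).
have equiv k := class_Phi_index l0 (w k) m (p1 (x k)).
split; first by split=> h k; apply/equiv; exact: h.
move=> hPhi; have index k := (equiv k).1 (hPhi k).
have wW k : class_Wt l (w k) by have [] := index k.
have c01 := bd_c0 H; have D0 := bd_D H.
(* The sign of [A] is read off by comparing a point with itself at scale 0. *)
have A0 : 0 <= A.
  have x0 : X by exact: point.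
  have d00 : dist x0 x0 < D / 2 ^+ 0.
    by rewrite ((qdist_eq0 (bd_quasi H) x0 x0).2 erefl) expr0 divr1.
  by have := posc _ _ _ d00; rewrite divr1; apply: le_trans; exact: normr_ge0.
have [n [r0l sep]] := separating_scale H l0 xinj.
have r00 : 0 < D / 2 ^+ n by rewrite divr_gt0// exprn_gt0.
have w0 k : positive_on l (w k) := class_Wt_pos (wW k).
have /choice[W Wp] k : exists W : (nat -> R) * R * R,
    weight_at dist mu c0 l (D / 2 ^+ n) (x k) (p (x k)) (w k) W.1.1 W.1.2 W.2.
  have [m0 [e e0 pb]] := class_Phi_weight l0 (hPhi k).
  have em := pow_between_le l0 pb.
  have em' : e < m by lra.
  have pl L : 0 < L -> lower_pow L (mass dist mu (x k)) (m - e / 2).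
    by move=> L0; apply: (mass_lower_pow H) => //; rewrite -/m; lra.
  have [u [th [C hC]]] := weight_at_exists H l0 r00 r0l (p1 (x k)) e0 em' pb pl.
  by exists (u, th, C).
pose C := 1 + \sum_k (W k).2.
have W0 k : 0 <= (W k).2 := le_trans ler01 (wa_C (Wp k)).
have C1 : 1 <= C by rewrite /C lerDl sumr_ge0.
have hW k : weight_at dist mu c0 l (D / 2 ^+ n) (x k) (p (x k)) (w k) (W k).1.1 (W k).1.2 C.
  apply: weight_at_le (Wp k); first exact: w0.
  by rewrite /C (bigD1 k)//= addrCA lerDl addr_ge0// sumr_ge0.
have mx k : measurable [set x k] := measurable_point H (x k).
have mrho : measurable_fun setT rho.
  apply: measurable_prod => k _.
  exact: (measurable_weight H l0 dl (mx k) (wW k)).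
have core := weighted_maximal_modular H r00 dl w0 C1 hW sep A0 pm1 Hp erefl (fun=> erefl).
have [K K0 KP] := weighted_maximal_norm H mp p1 mrho mx (fun k => wa_null (hW k))
  (@product_weight_gt0 _ _ _ _ _ _ _ _ H _ dl _ _ _ w0) core.
by exists K => // f [mf _]; exact: KP.
Qed.
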